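(* Suppose $\mathbf f_v\equiv\mathbf 0$, $\mathbf f_m\equiv\mathbf 0$, $\mathbf g_v\equiv\mathbf 0$, $\mathbf g_m\equiv\mathbf 0$, $\mathbf h_v\equiv\mathbf 0$, $\mathbf h_m\equiv\mathbf 0$, and that the penalty constant $C_{\rm pen}$ is sufficiently large (in the sense specified in the context). Let $(\mathbf u^h,\hat{\mathbf u}^h,p^h,\hat p^h,\mathbf B^h,\hat{\mathbf B}^h,r^h,\hat r^h)$ be a solution of the semi-discrete HDG method (S1)-(S10) written out in the context. Then, for all $t\in(0,\infty)$, $$\frac{d}{dt}\sum_e\int_{\Omega_e}\frac12\Big(\rho|\mathbf u^h|^2+\frac1{\mu_0}|\mathbf B^h|^2\Big)\le0 .$$
   Context: **Conventions.** $(\mathbf a\otimes\mathbf b)_{ij}=a_ib_j$; $(\nabla\mathbf a)_{ij}=\partial a_j/\partial x_i$; $\mathbf C:\mathbf D=\sum_{i,j}C_{ij}D_{ij}$; $\nabla^s\mathbf a=\frac12(\nabla\mathbf a+(\nabla\mathbf a)^T)$; $\nabla^a\mathbf a=\frac12(\nabla\mathbf a-(\nabla\mathbf a)^T)$; $\mathbb 1$ is the $d\times d$ identity; $|\cdot|$ is the Euclidean (Frobenius) norm. **Data.** $\Omega\subset\mathbb R^d$, $d\in\{2,3\}$, is a bounded domain with outward unit normal $\mathbf n$; $\partial\Omega=\overline{\Gamma_D\cup\Gamma_N}$, $\Gamma_D\cap\Gamma_N=\emptyset$. $\rho,\mu_0>0$ are constants; $\nu,\eta:\Omega\times(0,\infty)\to\mathbb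 R^+$; $\mathbf f_v,\mathbf f_m:\Omega\times(0,\infty)\to\mathbb R^d$; $\mathbf g_v,\mathbf g_m:\Gamma_D\times(0,\infty)\to\mathbb R^d$; $\mathbf h_v,\mathbf h_m:\Gamma_N\times(0,\infty)\to\mathbb R^d$; $\mathbf u_0,\mathbf B_0:\Omega\to\mathbb R^d$ (all regular enough that the integrals below make sense). **Mesh and spaces.** $\mathcal T=\{\Omega_e\}$ is a finite triangulation of $\Omega$ into simplices, $\bar\Omega=\overline{\cup_e\Omega_e}$; $\Gamma_{e_i}$ is the $i$-th facet of $\Omega_e$ and $\mathbf n$ on $\Gamma_{e_i}$ is the outward unit normal to $\Omega_e$; $h_e$ is the diameter of $\Omega_e$. $\mathcal F$ is the set of all facets, $\tilde\Gamma=\overline{\cup_{F\in\mathcal F}F}$. Each interior facet (not on $\partial\Omega$) is shared by exactly two elements. With $P_k(D)$ the polynomials of degree at most $k$ on $D$ and $k\ge1$: $V^h=W^h=\{\mathbf v\in[L^2(\Omega)]^d:\mathbf v|_{\Omega_e}\in[P_k(\Omega_e)]^d\ \forall\Omega_e\in\mathcal T\}$; $\hat V^h=\hat W^h=\{\hat{\mathbf v}\in[L^2(\tilde\Gamma)]^d:\hat{\mathbf v}|_F\in[P_k(F)]^d\ \forall F\in\mathcal F\}$; $Q^h_v=Q^h_m=\{q\in L^2(\Omega):q|_{\Omega_e}\in P_{k-1}(\Omega_e)\ \forall\Omega_e\in\mathcal T\}$; $\hat Q^h_v=\hat Q^h_m=\{\hat q\in L^2(\tilde\Gamma):\hat q|_F\in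 P_k(F)\ \forall F\in\mathcal F\}$; $\hat V^h_0,\hat W^h_0$ are the subspaces of $\hat V^h,\hat W^h$ of functions vanishing on $\Gamma_D$; $\hat V^h_g(t),\hat W^h_g(t)$ are the subsets of $\hat V^h,\hat W^h$ of functions equal on $\Gamma_D$ to $\mathbf g_v(\cdot,t)$, $\mathbf g_m(\cdot,t)$ respectively. **Semi-discrete HDG method.** Find $(\mathbf u^h,\hat{\mathbf u}^h,p^h,\hat p^h,\mathbf B^h,\hat{\mathbf B}^h,r^h,\hat r^h)(t)\in V^h\times\hat V^h_g(t)\times Q^h_v\times\hat Q^h_v\times W^h\times\hat W^h_g(t)\times Q^h_m\times\hat Q^h_m$ for each $t\in[0,\infty)$, with $\mathbf u^h,\mathbf B^h$ differentiable in time, satisfying (S1)-(S10). $C_{\rm pen}>0$ is a penalty constant. On each $\Gamma_{e_i}$, $\lambda=1$ where $\mathbf u^h\cdot\mathbf n<0$ and $\lambda=0$ where $\mathbf u^h\cdot\mathbf n\ge0$ ($\mathbf u^h$ and other element fields are evaluated from inside $\Omega_e$). Write $\mathbf M(\mathbf b)=\frac1{\rho\mu_0}(\mathbf b\otimes\mathbf b-\frac12|\mathbf b|^2\mathbb 1)$. The equations, for all $t>0$ in (S1)-(S8), are: (S1) for all $\mathbf v^h\in V^h$: $\sum_e\int_{\Omega_e}\big[\partial_t\mathbf u^h\cdot\mathbf v^h-(\mathbf u^h\otimes\mathbf u^h):\nabla\mathbf v^h-\frac1\rho p^h\mathbb 1:\nabla\mathbf v^h+2\nu\nabla^s\mathbf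 u^h:\nabla^s\mathbf v^h+\mathbf M(\mathbf B^h):\nabla\mathbf v^h-\mathbf f_v\cdot\mathbf v^h\big]$ $+\sum_e\sum_i\int_{\Gamma_{e_i}}\big[(1-\lambda)(\mathbf u^h\otimes\mathbf u^h)+\lambda(\mathbf u^h\otimes\hat{\mathbf u}^h)+\frac1\rho\hat p^h\mathbb 1-2\nu\nabla^s\mathbf u^h+2\frac{C_{\rm pen}}{h_e}\nu\,\mathbf n\otimes(\mathbf u^h-\hat{\mathbf u}^h)-\mathbf M(\hat{\mathbf B}^h)\big]:(\mathbf n\otimes\mathbf v^h)$ $-\sum_e\sum_i\int_{\Gamma_{e_i}}2\nu\big(\mathbf n\otimes(\mathbf u^h-\hat{\mathbf u}^h)\big):\nabla^s\mathbf v^h=0$. (S2) for all $\hat{\mathbf v}^h\in\hat V^h_0$: $\sum_e\sum_i\int_{\Gamma_{e_i}}\big[(1-\lambda)(\mathbf u^h\otimes\mathbf u^h)+\lambda(\mathbf u^h\otimes\hat{\mathbf u}^h)+\frac1\rho\hat p^h\mathbb 1-2\nu\nabla^s\mathbf u^h+2\frac{C_{\rm pen}}{h_e}\nu\,\mathbf n\otimes(\mathbf u^h-\hat{\mathbf u}^h)-\mathbf M(\hat{\mathbf B}^h)\big]:(\mathbf n\otimes\hat{\mathbf v}^h)$ $-\sum_e\sum_i\int_{\Gamma_N\cap\Gamma_{e_i}}(1-\lambda)(\mathbf u^h\otimes\hat{\mathbf u}^h):(\mathbf n\otimes\hat{\mathbf v}^h)+\sum_e\sum_i\int_{\Gamma_N\cap\Gamma_{e_i}}\mathbf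 h_v\cdot\hat{\mathbf v}^h=0$. (S3) for all $q^h_v\in Q^h_v$: $\sum_e\int_{\Omega_e}\frac1\rho(\nabla\cdot\mathbf u^h)q^h_v=0$. (S4) for all $\hat q^h_v\in\hat Q^h_v$: $\sum_e\sum_i\int_{\Gamma_{e_i}}\frac1\rho(\mathbf u^h-\hat{\mathbf u}^h)\cdot\mathbf n\,\hat q^h_v=0$. (S5) for all $\mathbf w^h\in W^h$: $\sum_e\int_{\Omega_e}\big[\partial_t\mathbf B^h\cdot\mathbf w^h-(\mathbf u^h\otimes\mathbf B^h):\nabla\mathbf w^h-r^h\mathbb 1:\nabla\mathbf w^h+2\frac{\eta}{\mu_0}\nabla^a\mathbf B^h:\nabla^a\mathbf w^h-(\mathbf B^h\otimes\mathbf w^h):\nabla\mathbf u^h-\mathbf f_m\cdot\mathbf w^h\big]$ $+\sum_e\sum_i\int_{\Gamma_{e_i}}\big[(1-\lambda)(\mathbf u^h\otimes\mathbf B^h)+\lambda(\mathbf u^h\otimes\hat{\mathbf B}^h)+\hat r^h\mathbb 1-2\frac{\eta}{\mu_0}\nabla^a\mathbf B^h+2\frac{\eta}{\mu_0}\frac{C_{\rm pen}}{h_e}\mathbf n\otimes(\mathbf B^h-\hat{\mathbf B}^h)\big]:(\mathbf n\otimes\mathbf w^h)$ $-\sum_e\sum_i\int_{\Gamma_{e_i}}2\frac{\eta}{\mu_0}\big(\mathbf n\otimes(\mathbf B^h-\hat{\mathbf B}^h)\big):\nabla^a\mathbf w^h=0$. (S6) for all $\hat{\mathbf w}^h\in\hat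 W^h_0$: $\sum_e\sum_i\int_{\Gamma_{e_i}}\big[(1-\lambda)(\mathbf u^h\otimes\mathbf B^h)+\lambda(\mathbf u^h\otimes\hat{\mathbf B}^h)+\hat r^h\mathbb 1-2\frac{\eta}{\mu_0}\nabla^a\mathbf B^h+2\frac{\eta}{\mu_0}\frac{C_{\rm pen}}{h_e}\mathbf n\otimes(\mathbf B^h-\hat{\mathbf B}^h)\big]:(\mathbf n\otimes\hat{\mathbf w}^h)$ $-\sum_e\sum_i\int_{\Gamma_{e_i}}\big(\hat{\mathbf B}^h\otimes\hat{\mathbf w}^h-\frac12(\hat{\mathbf B}^h\cdot\hat{\mathbf w}^h)\mathbb 1\big):\big(\mathbf n\otimes(\mathbf u^h-\hat{\mathbf u}^h)\big)$ $-\sum_e\sum_i\int_{\Gamma_N\cap\Gamma_{e_i}}(1-\lambda)(\mathbf u^h\otimes\hat{\mathbf B}^h):(\mathbf n\otimes\hat{\mathbf w}^h)+\sum_e\sum_i\int_{\Gamma_N\cap\Gamma_{e_i}}\mathbf h_m\cdot\hat{\mathbf w}^h=0$. (S7) for all $q^h_m\in Q^h_m$: $\sum_e\int_{\Omega_e}q^h_m\nabla\cdot\mathbf B^h=0$. (S8) for all $\hat q^h_m\in\hat Q^h_m$: $\sum_e\sum_i\int_{\Gamma_{e_i}}(\mathbf B^h-\hat{\mathbf B}^h)\cdot\mathbf n\,\hat q^h_m=0$. (S9) for all $\mathbf v^h\in V^h$: $\sum_e\int_{\Omega_e}(\mathbf u^h(\cdot,0)-\mathbf u_0)\cdot\mathbf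 v^h=0$. (S10) for all $\mathbf w^h\in W^h$: $\sum_e\int_{\Omega_e}(\mathbf B^h(\cdot,0)-\mathbf B_0)\cdot\mathbf w^h=0$. **''$C_{\rm pen}$ sufficiently large''** means large enough that the following discrete trace inequalities hold for every $t>0$, all $\mathbf v^h\in V^h$ and all $\mathbf w^h\in W^h$: $\sum_e\sum_i\int_{\Gamma_{e_i}}2\frac{h_e}{C_{\rm pen}}\rho\nu|\nabla^s\mathbf v^h\cdot\mathbf n|^2\le\sum_e\int_{\Omega_e}2\rho\nu|\nabla^s\mathbf v^h|^2$ and $\sum_e\sum_i\int_{\Gamma_{e_i}}2\frac{h_e}{C_{\rm pen}}\frac{\eta}{\mu_0^2}|\nabla^a\mathbf w^h\cdot\mathbf n|^2\le\sum_e\int_{\Omega_e}2\frac{\eta}{\mu_0^2}|\nabla^a\mathbf w^h|^2$. *)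

(* Defs.v *)
From HB Require Import structures.
From mathcomp Require Import all_boot all_order all_algebra.
From mathcomp Require Import all_classical all_reals all_analysis.
Set Implicit Arguments.
Unset Strict Implicit.
Unset Printing Implicit Defensive.
Import Order.TTheory GRing.Theory Num.Theory.
Import numFieldNormedType.Exports.
Local Open Scope classical_set_scope.
Local Open Scope ring_scope.

Section cons_measure.
Context (R : realType) (n : nat).
Local Notation RR := (measurableTypeR R).
Context (mu : {sigma_finite_measure set (n.-tuple RR) -> \bar R}).
Local Open Scope ereal_scope.

Definition cons_pair (p : RR * n.-tuple RR) : n.+1.-tuple RR :=
  [the n.+1.-tuple RR of p.1 :: p.2].

Lemma measurable_cons_pair : measurable_fun [set: RR * n.-tuple RR] cons_pair.
Proof. exact: measurable_cons. Qed.

Definition cons_measure : set (n.+1.-tuple RR) -> \bar R :=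
  pushforward (lebesgue_measure \x mu) cons_pair.

Let cons_measure0 : cons_measure set0 = 0.
Proof. by rewrite /cons_measure /pushforward preimage_set0 measure0. Qed.

Let cons_measure_ge0 A : 0 <= cons_measure A.
Proof. by rewrite /cons_measure /pushforward; apply: measure_ge0. Qed.

Let cons_measure_semi_sigma_additive : semi_sigma_additive cons_measure.
Proof.
move=> F mF tF mUF; rewrite /cons_measure /pushforward preimage_bigcup.
apply: measure_semi_sigma_additive.
- by move=> i; rewrite -[X in measurable X]setTI; exact: measurable_cons_pair.
- apply/trivIsetP => /= i j _ _ ij; rewrite -preimage_setI.
  by move/trivIsetP : tF => /(_ _ _ _ _ ij) ->//; rewrite preimage_set0.
- rewrite -preimage_bigcup -[X in measurable X]setTI.
  exact: measurable_cons_pair.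
Qed.

HB.instance Definition _ := isMeasure.Build _ _ _ cons_measure
  cons_measure0 cons_measure_ge0 cons_measure_semi_sigma_additive.

Let split_cons (z : n.+1.-tuple RR) : RR * n.-tuple RR :=
  (thead z, [tuple of behead z]).

Let split_consK : cancel split_cons cons_pair.
Proof. by move=> z; rewrite [RHS]tuple_eta; exact: val_inj. Qed.

Let cons_pairK : cancel cons_pair split_cons.
Proof. by move=> [x y]; congr (_, _); exact: val_inj. Qed.

Let measurable_split_cons : measurable_fun [set: n.+1.-tuple RR] split_cons.
Proof.
apply/measurable_fun_pair => /=.
  exact: measurable_tnth.
exact: measurable_behead.
Qed.

Let cons_measure_sigma_finite : sigma_finite setT cons_measure.
Proof.
have /sigma_finiteP[F [TF ndF Foo]] := sigma_finiteT (@lebesgue_measure R).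
have /sigma_finiteP[G [TG ndG Goo]] := sigma_finiteT mu.
exists (fun i => split_cons @^-1` (F i `*` G i)).
  rewrite -preimage_bigcup -[LHS](preimage_setT split_cons); congr preimage.
  rewrite -setXTT TF TG predeqE => -[x y]; split=> [[/= [i _ Fx] [j _ Gy]]|].
    exists (maxn i j) => //; split.
    - by move: x Fx; exact/subsetPset/ndF/leq_maxl.
    - by move: y Gy; exact/subsetPset/ndG/leq_maxr.
  by move=> [i _ []/= ? ?]; split; exists i.
move=> i; have [? ?] := Foo i; have [? ?] := Goo i; split.
  rewrite -[X in measurable X]setTI; apply: measurable_split_cons => //.
  exact: measurableX.
rewrite /cons_measure /pushforward -comp_preimage (_ : _ \o _ = id); last first.
  by apply/funext => p; exact: cons_pairK.
by rewrite /= product_measure1E// lte_mul_pinfty// ge0_fin_numE.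
Qed.

HB.instance Definition _ := isSFinite.Build _ _ _ cons_measure
  (sfinite_measure_sigma_finite cons_measure_sigma_finite).
HB.instance Definition _ := isSigmaFinite.Build _ _ _ cons_measure
  cons_measure_sigma_finite.

End cons_measure.

Section lebesgue_tuple.
Context (R : realType).
Local Notation RR := (measurableTypeR R).

(* Lebesgue measure on n-tuples of reals, as an iterated product measure. *)
Fixpoint lebesgue_tuple n : {sigma_finite_measure set (n.-tuple RR) -> \bar R} :=
  if n is m.+1 then cons_measure (lebesgue_tuple m)
  else \d_([tuple] : 0.-tuple RR).
End lebesgue_tuple.

Section tensors.
Context (R : realType) (d : nat).
Local Notation E := 'rV[R]_d.

Definition dot (a b : E) : R := \sum_i a 0 i * b 0 i.

Definition tens (a b : E) : 'M[R]_d := \matrix_(i, j) (a 0 i * b 0 j).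

Definition ddot (A B : 'M[R]_d) : R := \sum_i \sum_j A i j * B i j.

(* [`|_|] is the sup norm on matrices, hence the Euclidean norms below. *)
Definition enorm (a : E) : R := Num.sqrt (dot a a).

Definition fnorm (A : 'M[R]_d) : R := Num.sqrt (ddot A A).

(* The matrix-vector product A . n, both vectors being rows. *)
Definition mvmul (A : 'M[R]_d) (n : E) : E := n *m A^T.

Definition grad (a : E -> E) (x : E) : 'M[R]_d :=
  \matrix_(i, j) 'D_(delta_mx 0 i) (fun y => a y 0 j) x.

Definition sgrad (a : E -> E) (x : E) : 'M[R]_d :=
  2^-1 *: (grad a x + (grad a x)^T).

Definition agrad (a : E -> E) (x : E) : 'M[R]_d :=
  2^-1 *: (grad a x - (grad a x)^T).

Definition divergence (a : E -> E) (x : E) : R := \tr (grad a x).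

Definition frontier (A : set E) : set E := closure A `\` interior A.

(* f coincides on D with a polynomial of total degree at most k. *)
Definition poly_on (k : nat) (D : set E) (f : E -> R) : Prop :=
  exists c : {ffun 'I_d -> 'I_k.+1} -> R, forall x, D x ->
    f x = \sum_(a : {ffun 'I_d -> 'I_k.+1} | (\sum_i a i <= k)%N)
            c a * \prod_i x 0 i ^+ a i.

End tensors.

Section integrals.
Context (R : realType).
Local Notation RR := (measurableTypeR R).

Definition row_of_tuple n (y : n.-tuple RR) : 'rV[R]_n := \row_i tnth y i.

(* Integral of f over D with respect to the Lebesgue measure of R^d. *)
Definition vint d (D : set 'rV[R]_d) (f : 'rV[R]_d -> R) : R :=
  \int[lebesgue_tuple R d]_(y in @row_of_tuple d @^-1` D) f (row_of_tuple y).

Definition vintegrable d (D : set 'rV[R]_d) (f : 'rV[R]_d -> R) : Prop :=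
  (lebesgue_tuple R d).-integrable (@row_of_tuple d @^-1` D)
    (fun y => (f (row_of_tuple y))%:E).

Definition unit_simplex n : set (n.-tuple RR) :=
  [set y | (forall i, 0 <= tnth y i) /\ \sum_i tnth y i <= 1].

End integrals.

(* Simplices and facets are given by their sets of vertices. *)
Record mesh (R : realType) (d : nat) := Mesh {
  nvert : nat;
  vtx : 'I_nvert -> 'rV[R]_d;
  elements : {set {set 'I_nvert}} }.
Arguments nvert {R d}.
Arguments vtx {R d}.
Arguments elements {R d}.

Section mesh.
Context (R : realType) (d : nat) (T : mesh R d).
Local Notation E := 'rV[R]_d.
Local Notation vset := {set 'I_(nvert T)}.

Definition hull (S : vset) : set E :=
  [set x | exists w : 'I_(nvert T) -> R,
    [/\ forall i, 0 <= w i, forall i, i \notin S -> w i = 0,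
        \sum_i w i = 1 & x = \sum_i w i *: vtx T i]].

Definition open_simplex (S : vset) : set E :=
  [set x | exists w : 'I_(nvert T) -> R,
    [/\ forall i, i \in S -> 0 < w i, forall i, i \notin S -> w i = 0,
        \sum_i w i = 1 & x = \sum_i w i *: vtx T i]].

Definition affinely_independent (S : vset) : Prop :=
  forall w : 'I_(nvert T) -> R, (forall i, i \notin S -> w i = 0) ->
    \sum_i w i = 0 -> \sum_i w i *: vtx T i = 0 -> forall i, w i = 0.

Definition facets (K : vset) : {set vset} := [set K :\ i | i in K].

Definition mesh_facets : {set vset} := \bigcup_(K in elements T) facets K.

Definition diameter (A : set E) : R :=
  sup [set enorm (z.1 - z.2) | z in A `*` A].

Record triangulation (Omega : set E) : Prop := Triangulation {
  tri_card : forall K, K \in elements T -> #|K| = d.+1;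
  tri_indep : forall K, K \in elements T -> affinely_independent K;
  tri_conforming : forall K K', K \in elements T -> K' \in elements T ->
    hull K `&` hull K' = hull (K :&: K');
  tri_sub : forall K, K \in elements T -> open_simplex K `<=` Omega;
  tri_cover : closure Omega =
    closure (\bigcup_(K in [set` elements T]) open_simplex K);
  tri_interior : forall F, F \in mesh_facets ->
    ~ (hull F `<=` frontier Omega) ->
    #|[set K in elements T | F \in facets K]| = 2%N }.

Definition outward_unit_normal (K F : vset) (n : E) : Prop :=
  [/\ enorm n = 1,
      forall x y, hull F x -> hull F y -> dot n (x - y) = 0 &
      forall x y, open_simplex K x -> hull F y -> dot n (x - y) < 0].

(* The vertices of F are taken in the order of ['I_(nvert T)]. *)
Definition facet_vertex (F : vset) (i : nat) : E :=
  nth 0 [seq vtx T j | j <- enum F] i.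

Definition facet_edges (F : vset) : 'M[R]_(d.-1, d) :=
  \matrix_(i < d.-1) (facet_vertex F i.+1 - facet_vertex F 0).

Definition facet_map (F : vset) (y : d.-1.-tuple (measurableTypeR R)) : E :=
  facet_vertex F 0 + row_of_tuple y *m facet_edges F.

(* Surface integral of f over the part of the facet F lying in A: F is
   parametrized by the unit simplex of R^(d-1), and the surface element is the
   square root of the Gram determinant of its edges. *)
Definition fint (A : set E) (F : vset) (f : E -> R) : R :=
  Num.sqrt (\det (facet_edges F *m (facet_edges F)^T)) *
  \int[lebesgue_tuple R d.-1]_(y in @unit_simplex R d.-1 `&` facet_map F @^-1` A)
     f (facet_map F y).

Definition fintegrable (A : set E) (F : vset) (f : E -> R) : Prop :=
  (lebesgue_tuple R d.-1).-integrable
    (@unit_simplex R d.-1 `&` facet_map F @^-1` A)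
    (fun y => (f (facet_map F y))%:E).

Definition facet_ae (F : vset) (P : E -> Prop) : Prop :=
  {ae lebesgue_tuple R d.-1, forall y, unit_simplex y -> P (facet_map F y)}.

(* Broken polynomials. An element of V^h (or Q^h) is the family, indexed by
   the elements of the mesh, of its polynomial pieces, each extended to the
   whole space: the value of the K-th piece on the boundary of K is thus the
   trace taken from inside K. A facet function is a family indexed by the
   facets, of which only the restriction of the F-th member to F matters. *)
Definition vbroken (k : nat) (v : vset -> E -> E) : Prop :=
  forall K, K \in elements T ->
    forall j, poly_on k setT (fun x => v K x 0 j).

Definition sbroken (k : nat) (q : vset -> E -> R) : Prop :=
  forall K, K \in elements T -> poly_on k setT (q K).

Definition vfacetwise (k : nat) (v : vset -> E -> E) : Prop :=
  forall F, F \in mesh_facets ->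
    forall j, poly_on k (hull F) (fun x => v F x 0 j).

Definition sfacetwise (k : nat) (q : vset -> E -> R) : Prop :=
  forall F, F \in mesh_facets -> poly_on k (hull F) (q F).

(* Equality on A as elements of L^2: a facet meeting A in a null set, such as
   an interior facet with an endpoint in A, is not constrained. *)
Definition facet_eq_on (A : set E) (v : vset -> E -> E) (g : E -> E) : Prop :=
  forall F, F \in mesh_facets -> facet_ae F (fun x => A x -> v F x = g x).

End mesh.
Arguments mesh_facets {R d}.

Record mhd_data (R : realType) (d : nat) := MhdData {
  Omega : set 'rV[R]_d;
  GammaD : set 'rV[R]_d;
  GammaN : set 'rV[R]_d;
  rho : R;
  mu0 : R;
  nu : 'rV[R]_d -> R -> R;
  eta : 'rV[R]_d -> R -> R;
  f_v : 'rV[R]_d -> R -> 'rV[R]_d;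
  f_m : 'rV[R]_d -> R -> 'rV[R]_d;
  g_v : 'rV[R]_d -> R -> 'rV[R]_d;
  g_m : 'rV[R]_d -> R -> 'rV[R]_d;
  h_v : 'rV[R]_d -> R -> 'rV[R]_d;
  h_m : 'rV[R]_d -> R -> 'rV[R]_d;
  u_0 : 'rV[R]_d -> 'rV[R]_d;
  B_0 : 'rV[R]_d -> 'rV[R]_d }.

(* nu and eta also occur in integrals over boundary facets, so they are
   functions on the closure of Omega. The parts GammaD and GammaN cover each
   boundary facet up to a set of surface measure zero. *)
Record admissible_data (R : realType) (d : nat) (P : mhd_data R d)
    (T : mesh R d) : Prop := AdmissibleData {
  adm_open : open (Omega P);
  adm_connected : connected (Omega P);
  adm_nonempty : Omega P !=set0;
  adm_bounded : bounded_set (Omega P);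
  adm_boundary : frontier (Omega P) = closure (GammaD P `|` GammaN P);
  adm_disjoint : GammaD P `&` GammaN P = set0;
  adm_mesh : triangulation T (Omega P);
  adm_cover : forall F, F \in mesh_facets T -> hull F `<=` frontier (Omega P) ->
    facet_ae F (fun x => GammaD P x \/ GammaN P x);
  adm_GammaN : forall F, F \in mesh_facets T ->
    measurable (@unit_simplex R d.-1 `&` facet_map F @^-1` GammaN P);
  adm_rho : 0 < rho P;
  adm_mu0 : 0 < mu0 P;
  adm_nu_gt0 : forall x t, Omega P x -> 0 < t -> 0 < nu P x t;
  adm_eta_gt0 : forall x t, Omega P x -> 0 < t -> 0 < eta P x t;
  adm_nu_ge0 : forall x t, closure (Omega P) x -> 0 < t -> 0 <= nu P x t;
  adm_eta_ge0 : forall x t, closure (Omega P) x -> 0 < t -> 0 <= eta P x t;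
  adm_nu_vint : forall t K, 0 < t -> K \in elements T ->
    vintegrable (open_simplex K) (fun x => nu P x t);
  adm_eta_vint : forall t K, 0 < t -> K \in elements T ->
    vintegrable (open_simplex K) (fun x => eta P x t);
  adm_nu_fint : forall t F, 0 < t -> F \in mesh_facets T ->
    fintegrable setT F (fun x => nu P x t);
  adm_eta_fint : forall t F, 0 < t -> F \in mesh_facets T ->
    fintegrable setT F (fun x => eta P x t);
  adm_f_v : forall t K j, 0 < t -> K \in elements T ->
    vintegrable (open_simplex K) (fun x => f_v P x t 0 j);
  adm_f_m : forall t K j, 0 < t -> K \in elements T ->
    vintegrable (open_simplex K) (fun x => f_m P x t 0 j);
  adm_h_v : forall t F j, 0 < t -> F \in mesh_facets T ->
    fintegrable (GammaN P) F (fun x => h_v P x t 0 j);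
  adm_h_m : forall t F j, 0 < t -> F \in mesh_facets T ->
    fintegrable (GammaN P) F (fun x => h_m P x t 0 j);
  adm_u_0 : forall K j, K \in elements T ->
    vintegrable (open_simplex K) (fun x => u_0 P x 0 j);
  adm_B_0 : forall K j, K \in elements T ->
    vintegrable (open_simplex K) (fun x => B_0 P x 0 j) }.

Record discrete_state (R : realType) (d : nat) (T : mesh R d) :=
  DiscreteState {
  uh : R -> {set 'I_(nvert T)} -> 'rV[R]_d -> 'rV[R]_d;
  uhat : R -> {set 'I_(nvert T)} -> 'rV[R]_d -> 'rV[R]_d;
  ph : R -> {set 'I_(nvert T)} -> 'rV[R]_d -> R;
  phat : R -> {set 'I_(nvert T)} -> 'rV[R]_d -> R;
  Bh : R -> {set 'I_(nvert T)} -> 'rV[R]_d -> 'rV[R]_d;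
  Bhat : R -> {set 'I_(nvert T)} -> 'rV[R]_d -> 'rV[R]_d;
  rh : R -> {set 'I_(nvert T)} -> 'rV[R]_d -> R;
  rhat : R -> {set 'I_(nvert T)} -> 'rV[R]_d -> R }.

Section hdg.
Context (R : realType) (d k : nat) (P : mhd_data R d) (T : mesh R d).
Local Notation E := 'rV[R]_d.
Local Notation vset := {set 'I_(nvert T)}.
Context (n : vset -> vset -> E) (Cpen : R).

Local Notation rho := (rho P).
Local Notation mu0 := (mu0 P).
Local Notation nu := (nu P).
Local Notation eta := (eta P).
Local Notation h K := (diameter (open_simplex K)).
Local Notation Vh := (vbroken (T := T) k).
Local Notation Vhat := (vfacetwise (T := T) k).
Local Notation Qh := (sbroken (T := T) k.-1).
Local Notation Qhat := (sfacetwise (T := T) k).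
Local Notation Vhat0 v :=
  (Vhat v /\ facet_eq_on (GammaD P) v (fun=> 0)).
Local Notation "'\sumint_' K f" :=
  (\sum_(K in elements T) vint (open_simplex K) f)
  (at level 36, K ident, f at level 36).
Local Notation "'\sumfacet[' A ']_(' K ',' F ')' f" :=
  (\sum_(K in elements T) \sum_(F in facets K) fint A F f)
  (at level 36, K ident, F ident, f at level 36).

Definition large_penalty : Prop :=
  forall t (v w : vset -> E -> E), 0 < t -> Vh v -> Vh w ->
  (\sumfacet[setT]_(K, F) (fun x => 2 * (h K / Cpen) * rho * nu x t *
       enorm (mvmul (sgrad (v K) x) (n K F)) ^+ 2)
   <= \sumint_K (fun x => 2 * rho * nu x t * fnorm (sgrad (v K) x) ^+ 2)) /\
  (\sumfacet[setT]_(K, F) (fun x => 2 * (h K / Cpen) * (eta x t / mu0 ^+ 2) *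
       enorm (mvmul (agrad (w K) x) (n K F)) ^+ 2)
   <= \sumint_K (fun x => 2 * (eta x t / mu0 ^+ 2) *
                          fnorm (agrad (w K) x) ^+ 2)).

Definition maxwell (b : E) : 'M[R]_d :=
  (rho * mu0)^-1 *: (tens b b - (2^-1 * enorm b ^+ 2)%:M).

Context (S : discrete_state T).

Definition lam (t : R) (K F : vset) (x : E) : R :=
  if dot (uh S t K x) (n K F) < 0 then 1 else 0.

Definition momentum_flux (t : R) (K F : vset) (x : E) : 'M[R]_d :=
  let u := uh S t K x in let u' := uhat S t F x in
  let l := lam t K F x in
  (1 - l) *: tens u u + l *: tens u u' + (rho^-1 * phat S t F x)%:M
  - (2 * nu x t) *: sgrad (uh S t K) x
  + (2 * (Cpen / h K) * nu x t) *: tens (n K F) (u - u')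
  - maxwell (Bhat S t F x).

Definition induction_flux (t : R) (K F : vset) (x : E) : 'M[R]_d :=
  let u := uh S t K x in
  let B := Bh S t K x in let B' := Bhat S t F x in
  let l := lam t K F x in
  (1 - l) *: tens u B + l *: tens u B' + (rhat S t F x)%:M
  - (2 * (eta x t / mu0)) *: agrad (Bh S t K) x
  + (2 * (eta x t / mu0) * (Cpen / h K)) *: tens (n K F) (B - B').

Definition hdg_momentum (t : R) : Prop := forall v, Vh v ->
  \sumint_K (fun x =>
     dot (derive1 (fun s => uh S s K x) t) (v K x)
     - ddot (tens (uh S t K x) (uh S t K x)) (grad (v K) x)
     - ddot ((rho^-1 * ph S t K x)%:M) (grad (v K) x)
     + 2 * nu x t * ddot (sgrad (uh S t K) x) (sgrad (v K) x)
     + ddot (maxwell (Bh S t K x)) (grad (v K) x)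
     - dot (f_v P x t) (v K x))
  + \sumfacet[setT]_(K, F) (fun x =>
     ddot (momentum_flux t K F x) (tens (n K F) (v K x)))
  - \sumfacet[setT]_(K, F) (fun x =>
     2 * nu x t * ddot (tens (n K F) (uh S t K x - uhat S t F x))
                       (sgrad (v K) x)) = 0.

Definition hdg_momentum_facets (t : R) : Prop := forall v, Vhat0 v ->
  \sumfacet[setT]_(K, F) (fun x =>
     ddot (momentum_flux t K F x) (tens (n K F) (v F x)))
  - \sumfacet[GammaN P]_(K, F) (fun x =>
     ddot ((1 - lam t K F x) *: tens (uh S t K x) (uhat S t F x))
          (tens (n K F) (v F x)))
  + \sumfacet[GammaN P]_(K, F) (fun x => dot (h_v P x t) (v F x)) = 0.

Definition hdg_mass (t : R) : Prop := forall q, Qh q ->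
  \sumint_K (fun x => rho^-1 * divergence (uh S t K) x * q K x) = 0.

Definition hdg_mass_facets (t : R) : Prop := forall q, Qhat q ->
  \sumfacet[setT]_(K, F) (fun x =>
     rho^-1 * dot (uh S t K x - uhat S t F x) (n K F) * q F x) = 0.

Definition hdg_induction (t : R) : Prop := forall w, Vh w ->
  \sumint_K (fun x =>
     dot (derive1 (fun s => Bh S s K x) t) (w K x)
     - ddot (tens (uh S t K x) (Bh S t K x)) (grad (w K) x)
     - ddot ((rh S t K x)%:M) (grad (w K) x)
     + 2 * (eta x t / mu0) * ddot (agrad (Bh S t K) x) (agrad (w K) x)
     - ddot (tens (Bh S t K x) (w K x)) (grad (uh S t K) x)
     - dot (f_m P x t) (w K x))
  + \sumfacet[setT]_(K, F) (fun x =>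
     ddot (induction_flux t K F x) (tens (n K F) (w K x)))
  - \sumfacet[setT]_(K, F) (fun x =>
     2 * (eta x t / mu0) * ddot (tens (n K F) (Bh S t K x - Bhat S t F x))
                                (agrad (w K) x)) = 0.

Definition hdg_induction_facets (t : R) : Prop := forall w, Vhat0 w ->
  \sumfacet[setT]_(K, F) (fun x =>
     ddot (induction_flux t K F x) (tens (n K F) (w F x)))
  - \sumfacet[setT]_(K, F) (fun x =>
     ddot (tens (Bhat S t F x) (w F x)
           - (2^-1 * dot (Bhat S t F x) (w F x))%:M)
          (tens (n K F) (uh S t K x - uhat S t F x)))
  - \sumfacet[GammaN P]_(K, F) (fun x =>
     ddot ((1 - lam t K F x) *: tens (uh S t K x) (Bhat S t F x))
          (tens (n K F) (w F x)))
  + \sumfacet[GammaN P]_(K, F) (fun x => dot (h_m P x t) (w F x)) = 0.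

Definition hdg_solenoidal (t : R) : Prop := forall q, Qh q ->
  \sumint_K (fun x => q K x * divergence (Bh S t K) x) = 0.

Definition hdg_solenoidal_facets (t : R) : Prop := forall q, Qhat q ->
  \sumfacet[setT]_(K, F) (fun x =>
     dot (Bh S t K x - Bhat S t F x) (n K F) * q F x) = 0.

Definition hdg_initial_u : Prop := forall v, Vh v ->
  \sumint_K (fun x => dot (uh S 0 K x - u_0 P x) (v K x)) = 0.

Definition hdg_initial_B : Prop := forall w, Vh w ->
  \sumint_K (fun x => dot (Bh S 0 K x - B_0 P x) (w K x)) = 0.

(* Each piece being a polynomial of bounded degree, time differentiability in
   V^h is pointwise differentiability. The boundary values g_v and g_m are
   given for positive times only. *)
Record hdg_solution : Prop := HdgSolution {
  sol_uh : forall t, 0 <= t -> Vh (uh S t);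
  sol_uhat : forall t, 0 <= t -> Vhat (uhat S t);
  sol_ph : forall t, 0 <= t -> Qh (ph S t);
  sol_phat : forall t, 0 <= t -> Qhat (phat S t);
  sol_Bh : forall t, 0 <= t -> Vh (Bh S t);
  sol_Bhat : forall t, 0 <= t -> Vhat (Bhat S t);
  sol_rh : forall t, 0 <= t -> Qh (rh S t);
  sol_rhat : forall t, 0 <= t -> Qhat (rhat S t);
  sol_g_v : forall t, 0 < t ->
    facet_eq_on (GammaD P) (uhat S t) (fun x => g_v P x t);
  sol_g_m : forall t, 0 < t ->
    facet_eq_on (GammaD P) (Bhat S t) (fun x => g_m P x t);
  sol_uh_diff : forall t K x, 0 < t -> K \in elements T ->
    derivable (fun s => uh S s K x) t 1;
  sol_Bh_diff : forall t K x, 0 < t -> K \in elements T ->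
    derivable (fun s => Bh S s K x) t 1;
  sol_momentum : forall t, 0 < t -> hdg_momentum t;
  sol_momentum_facets : forall t, 0 < t -> hdg_momentum_facets t;
  sol_mass : forall t, 0 < t -> hdg_mass t;
  sol_mass_facets : forall t, 0 < t -> hdg_mass_facets t;
  sol_induction : forall t, 0 < t -> hdg_induction t;
  sol_induction_facets : forall t, 0 < t -> hdg_induction_facets t;
  sol_solenoidal : forall t, 0 < t -> hdg_solenoidal t;
  sol_solenoidal_facets : forall t, 0 < t -> hdg_solenoidal_facets t;
  sol_initial_u : hdg_initial_u;
  sol_initial_B : hdg_initial_B }.

Definition energy (t : R) : R :=
  \sumint_K (fun x => 2^-1 * (rho * enorm (uh S t K x) ^+ 2
                              + mu0^-1 * enorm (Bh S t K x) ^+ 2)).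

End hdg.

(* Main.v *)
Require Import Defs.
From mathcomp Require Import all_boot all_order all_algebra fingroup perm.
From mathcomp Require Import all_classical all_reals all_analysis measurable_realfun.
From mathcomp Require Import ring lra.
Set Implicit Arguments.
Unset Strict Implicit.
Unset Printing Implicit Defensive.
Import Order.TTheory GRing.Theory Num.Theory.
Import numFieldNormedType.Exports.
Local Open Scope classical_set_scope.
Local Open Scope ring_scope.

(* Test the momentum equations with uh and uhat, the induction equations with
   Bh and Bhat, and add them with weights rho and 1/mu0: the Maxwell terms
   cancel and the pressure terms vanish by the constraints. The volume
   convection terms are, uh being pointwise solenoidal, the divergence of half
   the energy density times uh; the divergence theorem on each simplex turns
   them into facet terms. On a facet the upwinding leaves
   |uh.n| |uh - uhat|^2 / 2 >= 0 and -(uh.n) |uhat|^2 / 2, and likewise for the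
   magnetic field. The latter terms have the good sign after the correction on
   GammaN, vanish on GammaD, and cancel on an interior facet, where testing the
   facet mass equation with the jump of uh.n shows that this jump is zero. The
   viscous facet terms are absorbed by Young's inequality and the trace
   inequalities defining a large penalty.

   The divergence theorem for polynomials on a simplex is obtained by pulling
   back to the unit simplex, where it reduces to the fundamental theorem of
   calculus in one variable: along the edge from vertex b to vertex a only the
   facets opposite to a and to b contribute. *)

(** * Affine change of variables for the iterated Lebesgue measure *)

(** The discrete constraints hold against test functions of bounded degree only, while the balance
    pairs them with products such as the energy density. Each residual is therefore first shown to
    be itself an admissible test function: the divergence of a field of degree [k] has degree
    [k.-1], and a normal jump has degree [k] on a facet because normals are constant. Its square
    then integrates to zero, and it is orthogonal to all the weights that occur. The coefficients
    [nu] and [eta] are merely integrable, so every integrand is kept as a polynomial, or on facets a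
    bounded measurable function, plus such a factor times [nu] or [eta]. Volume integrals refer to
    an iterated product measure and facet integrals to one particular order of the vertices; the
    Jacobian formula makes both independent of that order. That neighbours have opposite normals is
    not part of the data and has to be extracted from the conformity of the triangulation. *)

Section change_of_variables.
Context (R : realType).
Local Notation RR := (measurableTypeR R).
Local Notation mu := (lebesgue_tuple R).
Local Notation leb := (@lebesgue_measure R).

(** Pushed forward by the affine map and scaled by the modulus of the slope, Lebesgue measure keeps
    the length of every half-open interval, and these lengths determine it. *)
Lemma lebesgue_affine (f : RR -> \bar R) (a b : R) : a != 0 ->
  measurable_fun setT f -> (forall x, 0 <= f x)%E ->
  (\int[leb]_x f x = `|a|%:E * \int[leb]_x f (a * x + b)%R)%E.
Proof.
move=> a0 mf f0.
pose phi := (fun x : RR => a * x + b : RR).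
have mphi : measurable_fun setT phi.
  by apply: measurable_funD => //; apply: measurable_funM.
have na0 : 0 <= `|a| by [].
rewrite -[X in (_ * X)%E](@ge0_integral_pushforward _ _ _ _ _ _ mphi leb setT) //.
rewrite -[X in (X%:E * _)%E]/((NngNum na0)%:num) -ge0_integral_mscale //.
apply: eq_measure_integral => A mA _.
apply: lebesgue_measure_unique mA => X [[p q] /= _ <-].
rewrite /mscale /= /pushforward.
have [alt|alt|/eqP] := ltgtP a 0; last by rewrite (negPf a0).
- have -> : phi @^-1` [set` `]p, q]] = [set` `[(q - b) / a, (p - b) / a[].
    apply/seteqP; split => x /=; rewrite !in_itv /= /phi ler_ndivrMr // ltr_ndivlMr//.
      by move=> /andP[? ?]; apply/andP; split; lra.
    by move=> /andP[? ?]; apply/andP; split; lra.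
  rewrite !lebesgue_measure_itv /= !lte_fin ltr_ndivrMr // mulfVK ?lt_eqF //.
  rewrite ltrD2r; case: ifP => _; last by rewrite mule0.
  rewrite -!EFinB -EFinM ltr0_norm //; congr EFin; field; exact: a0.
- have -> : phi @^-1` [set` `]p, q]] = [set` `](p - b) / a, (q - b) / a]].
    apply/seteqP; split => x /=; rewrite !in_itv /= /phi ler_pdivlMr // ltr_pdivrMr//.
      by move=> /andP[? ?]; apply/andP; split; lra.
    by move=> /andP[? ?]; apply/andP; split; lra.
  rewrite !lebesgue_measure_itv /= !lte_fin ltr_pdivrMr // mulfVK ?gt_eqF //.
  rewrite ltrD2r; case: ifP => _; last by rewrite mule0.
  rewrite -!EFinB -EFinM gtr0_norm //; congr EFin; field; exact: a0.
Qed.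

Lemma tonelli_cons (n : nat) (f : n.+1.-tuple RR -> \bar R) :
  measurable_fun setT f -> (forall y, 0 <= f y)%E ->
  (\int[mu n.+1]_y f y = \int[leb]_x \int[mu n]_y f (cons_pair (x, y)))%E.
Proof.
move=> mf f0.
rewrite /= (ge0_integral_pushforward (@measurable_cons_pair R n)) //.
rewrite preimage_setT fubini_tonelli1 //; last by move=> x; exact: f0.
by apply: measurableT_comp => //; exact: measurable_cons_pair.
Qed.

Lemma tonelli_cons_sym (n : nat) (f : n.+1.-tuple RR -> \bar R) :
  measurable_fun setT f -> (forall y, 0 <= f y)%E ->
  (\int[mu n.+1]_y f y = \int[mu n]_y \int[leb]_x f (cons_pair (x, y)))%E.
Proof.
move=> mf f0.
rewrite /= (ge0_integral_pushforward (@measurable_cons_pair R n)) //.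
rewrite preimage_setT fubini_tonelli2 //; last by move=> x; exact: f0.
by apply: measurableT_comp => //; exact: measurable_cons_pair.
Qed.

Lemma row_of_tuple_cons (n : nat) (x : RR) (y : n.-tuple RR) :
  row_of_tuple (cons_pair (x, y)) = row_mx (x%:M : 'M[R]_1) (row_of_tuple y).
Proof.
apply/rowP => i; rewrite !mxE; case: splitP => j ij; rewrite !mxE.
  have -> : i = ord0 by apply/val_inj; rewrite /= ij ord1.
  by rewrite ord1 eqxx mulr1n /= (tnth_nth 0).
by rewrite !(tnth_nth 0) ij.
Qed.

Definition tuple_of_row (n : nat) (x : 'rV[R]_n) : n.-tuple RR :=
  [tuple (x 0 i : RR) | i < n].

Lemma tuple_of_rowK n : cancel (@tuple_of_row n) (@row_of_tuple R n).
Proof. by move=> x; apply/rowP => i; rewrite mxE tnth_mktuple. Qed.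

Lemma measurable_tuple_affine (m n : nat) (M : 'M[R]_(m, n)) (b : 'rV[R]_n) :
  measurable_fun setT (fun y : m.-tuple RR =>
    tuple_of_row (row_of_tuple y *m M + b)).
Proof.
apply/measurable_fun_tnthP => i.
rewrite (_ : _ \o _ = fun y : m.-tuple RR =>
    (\sum_j (tnth y j : R) * M j i + b 0 i)%R :> RR); last first.
  apply/funext => y /=; rewrite tnth_mktuple !mxE; congr (_ + _).
  by apply: eq_bigr => j _; rewrite mxE.
apply: measurable_funD => //; apply: measurable_sum => j.
apply: measurable_funM => //; exact: measurable_tnth.
Qed.

(** The product measure lives on tuples whereas affine maps act on rows, so measurability of
    functions of rows is expressed through tuples. *)
Definition mrow (n : nat) (g : 'rV[R]_n -> \bar R) :=
  measurable_fun setT (fun y : n.-tuple RR => g (row_of_tuple y)).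

Lemma mrow_affine (m n : nat) (g : 'rV[R]_n -> \bar R) (M : 'M[R]_(m, n)) b :
  mrow g -> mrow (fun x => g (x *m M + b)).
Proof.
move=> mg; rewrite /mrow.
rewrite (_ : (fun _ => _) = (fun y : n.-tuple RR => g (row_of_tuple y)) \o
   (fun y : m.-tuple RR => tuple_of_row (row_of_tuple y *m M + b))); last first.
  by apply/funext => y /=; rewrite tuple_of_rowK.
exact: (measurableT_comp mg (measurable_tuple_affine M b)).
Qed.

Lemma mrow_row_mx (n : nat) (g : 'rV[R]_(1 + n) -> \bar R) (x : R) :
  mrow g -> mrow (fun y => g (row_mx x%:M y)).
Proof.
move=> mg; rewrite (_ : (fun _ => _) = fun y : 'rV[R]_n =>
   g (y *m row_mx 0 1%:M + row_mx x%:M 0)).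
  exact: mrow_affine.
by apply/funext => y; rewrite mul_mx_row mulmx0 mulmx1 add_row_mx add0r addr0.
Qed.

Lemma mrow_row_mxl (n : nat) (g : 'rV[R]_(1 + n) -> \bar R) (y : 'rV[R]_n) :
  mrow g -> measurable_fun setT (fun x : RR => g (row_mx x%:M y)).
Proof.
move=> mg; rewrite (_ : (fun _ => _) = fun x =>
   g (row_of_tuple (cons_pair (x, tuple_of_row y)))); last first.
  by apply/funext => x; rewrite row_of_tuple_cons tuple_of_rowK.
apply: (measurableT_comp mg).
exact: (measurableT_comp (@measurable_cons_pair R n)).
Qed.

Lemma tonelli_row (n : nat) (g : 'rV[R]_(1 + n) -> \bar R) :
  mrow g -> (forall x, 0 <= g x)%E ->
  (\int[mu n.+1]_y g (row_of_tuple y) =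
   \int[leb]_x \int[mu n]_y g (row_mx x%:M (row_of_tuple y)))%E.
Proof.
move=> mg g0; rewrite tonelli_cons //.
by apply: eq_integral => x _; apply: eq_integral => y _; rewrite row_of_tuple_cons.
Qed.

Lemma tonelli_row_sym (n : nat) (g : 'rV[R]_(1 + n) -> \bar R) :
  mrow g -> (forall x, 0 <= g x)%E ->
  (\int[mu n.+1]_y g (row_of_tuple y) =
   \int[mu n]_y \int[leb]_x g (row_mx x%:M (row_of_tuple y)))%E.
Proof.
move=> mg g0; rewrite tonelli_cons_sym //.
by apply: eq_integral => x _; apply: eq_integral => y _; rewrite row_of_tuple_cons.
Qed.

Lemma measurable_tonelli_row (n : nat) (g : 'rV[R]_(1 + n) -> \bar R) :
  mrow g -> (forall x, 0 <= g x)%E ->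
  measurable_fun setT (fun x : RR =>
    \int[mu n]_y g (row_mx x%:M (row_of_tuple y)))%E.
Proof.
move=> mg g0.
have : measurable_fun setT (fubini_F (mu n)
    (fun z : RR * n.-tuple RR => g (row_of_tuple (cons_pair z)))).
  apply: measurable_fun_fubini_tonelli_F => //.
  by apply: (measurableT_comp mg); exact: measurable_cons_pair.
apply: eq_measurable_fun => x _; rewrite /fubini_F.
by apply: eq_integral => y _; rewrite row_of_tuple_cons.
Qed.

Lemma lebesgue_tuple_shift (n : nat) (g : 'rV[R]_n -> \bar R) (b : 'rV[R]_n) :
  mrow g -> (forall x, 0 <= g x)%E ->
  (\int[mu n]_y g (row_of_tuple y) = \int[mu n]_y g (row_of_tuple y + b)%R)%E.
Proof.
elim: n g b => [|n IH] g b mg g0.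
  by apply: eq_integral => y _; congr g; apply/rowP => -[].
have mgb : mrow (fun x => g (x + b)).
  rewrite (_ : (fun _ => _) = (fun x => g (x *m 1%:M + b))).
    exact: mrow_affine.
  by apply/funext => x; rewrite mulmx1.
have [b1 [b2 bE]] : exists (b1 : R) (b2 : 'rV[R]_n), b = row_mx b1%:M b2 :> 'rV[R]_(1 + n).
  exists (lsubmx (b : 'rV[R]_(1 + n)) 0 0), (rsubmx (b : 'rV[R]_(1 + n))).
  by rewrite -mx11_scalar hsubmxK.
have bE' (x : R) (v : 'rV[R]_n) :
    row_mx x%:M v + b = row_mx (x + b1)%:M (v + b2) :> 'rV[R]_(1 + n).
  by rewrite bE raddfD /= -[RHS]add_row_mx.
rewrite tonelli_row // (tonelli_row mgb) //.
under [RHS]eq_integral => x _.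
  rewrite (_ : (\int[_]_y _ = \int[mu n]_y g (row_mx (x + b1)%:M (row_of_tuple y)))%E).
  over.
  rewrite [RHS](IH (fun v => g (row_mx (x + b1)%:M v)) b2) //; last exact: mrow_row_mx.
  by apply: eq_integral => y _; rewrite bE'.
rewrite [LHS](@lebesgue_affine _ 1 b1) //.
- rewrite normr1 mul1e; apply: eq_integral => x _.
  by rewrite mul1r.
- exact: measurable_tonelli_row.
- by move=> x; apply: integral_ge0.
Qed.

(** Restricting to nonnegative functions lets Tonelli's theorem apply unconditionally; signed
    integrands are split into their two parts later. *)
Definition jacobian_formula (n : nat) (M : 'M[R]_n) :=
  forall g : 'rV[R]_n -> \bar R, mrow g -> (forall x, 0 <= g x)%E ->
  (\int[mu n]_y g (row_of_tuple y) =
   `|\det M|%:E * \int[mu n]_y g (row_of_tuple y *m M)%R)%E.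

Lemma mrow_mul (n : nat) (g : 'rV[R]_n -> \bar R) (M : 'M[R]_n) :
  mrow g -> mrow (fun x => g (x *m M)).
Proof.
move=> mg; rewrite (_ : (fun _ => _) = (fun x => g (x *m M + 0))).
  exact: mrow_affine.
by apply/funext => x; rewrite addr0.
Qed.

Lemma jacobian_formulaM n (M N : 'M[R]_n) :
  jacobian_formula M -> jacobian_formula N -> jacobian_formula (M *m N).
Proof.
move=> JM JN g mg g0; rewrite (JN g) // (JM (fun x => g (x *m N))) //; last first.
  exact: mrow_mul.
rewrite muleA -EFinM det_mulmx normrM mulrC; congr (_ * _)%E.
by apply: eq_integral => y _; rewrite mulmxA.
Qed.

(** For a fixed first coordinate [x] the shear translates the remaining coordinates by [x *: b], and
    translations preserve the measure. *)
Lemma jacobian_formula_upper n (b : 'rV[R]_n) :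
  jacobian_formula (block_mx 1%:M b 0 1%:M : 'M[R]_(1 + n)).
Proof.
move=> g mg g0; rewrite det_ublock !det1 mulr1 normr1 mul1e.
rewrite tonelli_row // (tonelli_row (mrow_mul _ mg)) //.
apply: eq_integral => x _.
rewrite (@lebesgue_tuple_shift _ (fun v => g (row_mx x%:M v)) (x *: b)) //; last first.
  exact: mrow_row_mx.
apply: eq_integral => y _; rewrite mul_row_block !mulmx1 mulmx0 addr0.
by rewrite mul_scalar_mx [_ + _ *: _]addrC.
Qed.

(** Here the first coordinate is translated by an amount depending on the others, so it has to be
    integrated innermost. *)
Lemma jacobian_formula_lower n (c : 'cV[R]_n) :
  jacobian_formula (block_mx 1%:M 0 c 1%:M : 'M[R]_(1 + n)).
Proof.
move=> g mg g0; rewrite det_lblock !det1 mulr1 normr1 mul1e.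
rewrite tonelli_row_sym // (tonelli_row_sym (mrow_mul _ mg)) //.
apply: eq_integral => y _.
rewrite (@lebesgue_affine _ 1 ((row_of_tuple y *m c) 0 0)) //.
- rewrite normr1 mul1e; apply: eq_integral => x _.
  rewrite mul_row_block !mulmx1 mulmx0 add0r mul1r raddfD /=.
  by rewrite -mx11_scalar.
- exact: mrow_row_mxl.
Qed.

Lemma jacobian_formula_diag n (a : R) (D : 'M[R]_n) : a != 0 ->
  jacobian_formula D -> jacobian_formula (block_mx a%:M 0 0 D : 'M[R]_(1 + n)).
Proof.
move=> a0 JD g mg g0; rewrite det_ublock det_scalar1 normrM.
rewrite tonelli_row // (tonelli_row (mrow_mul _ mg)) //.
rewrite (@lebesgue_affine _ a 0) //; last 2 first.
- exact: measurable_tonelli_row.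
- by move=> x; apply: integral_ge0.
rewrite EFinM -muleA; congr (_ * _)%E.
rewrite -ge0_integralZl//; last 2 first.
- exact: (measurable_tonelli_row (mrow_mul _ mg)).
- by move=> x _; apply: integral_ge0.
apply: eq_integral => x _; rewrite (JD _ (mrow_row_mx _ mg)) //; congr (_ * _)%E.
apply: eq_integral => y _.
by rewrite mul_row_block !mulmx0 addr0 add0r addr0 -scalar_mxM mulrC.
Qed.

(** Gaussian elimination: a nonzero pivot factors the matrix into a lower shear, a block diagonal
    matrix carrying the Schur complement, and an upper shear. The induction hypothesis handles the
    Schur complement. *)
Lemma jacobian_formula_unit n (M : 'M[R]_n) : M \in unitmx -> jacobian_formula M.
Proof.
elim: n M => [|n IH] M uM.
  move=> g mg g0; rewrite det_mx00 normr1 mul1e.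
  by apply: eq_integral => y _; congr g; apply/rowP => -[].
have pivot (a : R) (b : 'rV[R]_n) (c : 'cV[R]_n) (D : 'M[R]_n) : a != 0 ->
    (block_mx a%:M b c D : 'M[R]_(1 + n)) \in unitmx ->
    jacobian_formula (block_mx a%:M b c D : 'M[R]_(1 + n)).
  move=> a0.
  have -> : block_mx a%:M b c D = block_mx 1%:M 0 (a^-1 *: c) 1%:M *m
      (block_mx a%:M 0 0 (D - a^-1 *: (c *m b)) *m
       block_mx 1%:M (a^-1 *: b) 0 1%:M).
    rewrite !mulmx_block !mulmx1 !mul1mx !mulmx0 !mul0mx !addr0 !add0r.
    rewrite !mul_scalar_mx !mul_mx_scalar !scalerA mulfV // !scale1r.
    by rewrite -scalemxAl subrKC.
  rewrite !unitmx_mul => /and3P[_ u _].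
  apply: jacobian_formulaM; first exact: jacobian_formula_lower.
  apply: jacobian_formulaM; last exact: jacobian_formula_upper.
  apply: jacobian_formula_diag => //; apply: IH.
  by move: u; rewrite !unitmxE det_ublock !unitfE mulf_eq0 negb_or => /andP[].
pose M' : 'M[R]_(1 + n) := M.
have [z|a0] := eqVneq (ulsubmx M') 0; last first.
  rewrite -[M](submxK M') (mx11_scalar (ulsubmx M')).
  apply: pivot; last by rewrite -mx11_scalar submxK.
  by apply: contraNneq a0 => a0; rewrite (mx11_scalar (ulsubmx M')) a0 raddf0.
(* With a zero pivot, invertibility forces a nonzero entry further down the first column. An upper
   shear adds that row to the first one, and its inverse is factored out. *)
have : dlsubmx M' != 0.
  apply/eqP => dz; move: uM; rewrite unitmxE; suff -> : \det M = 0 by rewrite unitr0.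
  have : \det M' = 0 by rewrite -[M']submxK z dz det_ublock det0 mul0r.
  by [].
case/cV0Pn => i di.
pose c : 'rV[R]_n := delta_mx 0 i.
have uS (v : 'rV[R]_n) : (block_mx 1%:M v 0 1%:M : 'M[R]_(1 + n)) \in unitmx.
  by rewrite unitmxE det_ublock !det1 mulr1 unitr1.
have -> : M = (block_mx 1%:M (- c) 0 1%:M : 'M[R]_(1 + n)) *m
              ((block_mx 1%:M c 0 1%:M : 'M[R]_(1 + n)) *m M').
  rewrite mulmxA mulmx_block !mulmx1 !mul1mx !mulmx0 !mul0mx !addr0 !add0r.
  by rewrite subrr -scalar_mx_block mul1mx.
apply: jacobian_formulaM; first exact: jacobian_formula_upper.
have uN : (block_mx 1%:M c 0 1%:M : 'M[R]_(1 + n)) *m M' \in unitmx.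
  by rewrite unitmx_mul uS.
move: uN; rewrite -{1 2}[M'](submxK M') mulmx_block z !mul1mx !mul0mx !add0r.
rewrite (mx11_scalar (c *m _)) => uN; apply: pivot => //.
by rewrite -rowE mxE.
Qed.

Lemma integral_affine n (M : 'M[R]_n) (b : 'rV[R]_n) (g : 'rV[R]_n -> \bar R) :
  M \in unitmx -> mrow g -> (forall x, 0 <= g x)%E ->
  (\int[mu n]_y g (row_of_tuple y) =
   `|\det M|%:E * \int[mu n]_y g (row_of_tuple y *m M + b)%R)%E.
Proof.
move=> uM mg g0; rewrite (lebesgue_tuple_shift b mg) //.
have mgb : mrow (fun x => g (x + b)).
  rewrite (_ : (fun _ => _) = (fun x => g (x *m 1%:M + b))).
    exact: mrow_affine.
  by apply/funext => x; rewrite mulmx1.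
by rewrite (jacobian_formula_unit uM mgb).
Qed.

End change_of_variables.

(** * Polynomial functions *)

Section polynomial_functions.
Context (R : realType) (d : nat).
Local Notation RR := (measurableTypeR R).
Local Notation E := 'rV[R]_d.

(** No degree is recorded: products of discrete fields leave the discrete spaces, and integration
    only requires closure under sums, products, derivatives and affine substitution. Degrees are
    tracked by [poly_on], where a test function has to be admissible. *)
Inductive pfun : (E -> R) -> Prop :=
| pfun_cst (c : R) : pfun (fun=> c)
| pfun_coord (i : 'I_d) : pfun (fun x => x 0 i)
| pfunD f g : pfun f -> pfun g -> pfun (fun x => f x + g x)
| pfunM f g : pfun f -> pfun g -> pfun (fun x => f x * g x).

Lemma pfunN f : pfun f -> pfun (fun x => - f x).
Proof.
move=> pf; rewrite (_ : (fun _ => _) = fun x => -1 * f x).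
  by apply: pfunM => //; exact: pfun_cst.
by apply/funext => x; rewrite mulN1r.
Qed.

Lemma pfunB f g : pfun f -> pfun g -> pfun (fun x => f x - g x).
Proof. by move=> pf pg; apply: pfunD => //; exact: pfunN. Qed.

Lemma pfunX f n : pfun f -> pfun (fun x => f x ^+ n).
Proof.
move=> pf; elim: n => [|n IH]; first exact: pfun_cst.
rewrite (_ : (fun _ => _) = fun x => f x * f x ^+ n); first exact: pfunM.
by apply/funext => x; rewrite exprS.
Qed.

Lemma pfun_sum I (r : seq I) (P : pred I) (f : I -> E -> R) :
  (forall i, P i -> pfun (f i)) -> pfun (fun x => \sum_(i <- r | P i) f i x).
Proof.
move=> pf; elim: r => [|i r IH].
  rewrite (_ : (fun _ => _) = fun=> 0); first exact: pfun_cst.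
  by apply/funext => x; rewrite big_nil.
rewrite (_ : (fun _ => _) = fun x =>
    (if P i then f i x else 0) + \sum_(j <- r | P j) f j x).
  by apply: pfunD => //; case Pi : (P i); [exact: pf|exact: pfun_cst].
by apply/funext => x; rewrite big_cons; case: ifP => //; rewrite add0r.
Qed.

Lemma pfun_prod I (r : seq I) (P : pred I) (f : I -> E -> R) :
  (forall i, P i -> pfun (f i)) -> pfun (fun x => \prod_(i <- r | P i) f i x).
Proof.
move=> pf; elim: r => [|i r IH].
  rewrite (_ : (fun _ => _) = fun=> 1); first exact: pfun_cst.
  by apply/funext => x; rewrite big_nil.
rewrite (_ : (fun _ => _) = fun x =>
    (if P i then f i x else 1) * \prod_(j <- r | P j) f j x).
  by apply: pfunM => //; case Pi : (P i); [exact: pf|exact: pfun_cst].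
by apply/funext => x; rewrite big_cons; case: ifP => //; rewrite mul1r.
Qed.

Lemma measurable_pfun f : pfun f ->
  measurable_fun setT (fun y : d.-tuple RR => f (row_of_tuple y)).
Proof.
elim=> [c|i|{}f g _ mf _ mg|{}f g _ mf _ mg] //.
- rewrite (_ : (fun _ => _) = fun y : d.-tuple RR => (tnth y i : R)).
    exact: measurable_tnth.
  by apply/funext => y; rewrite mxE.
- exact: measurable_funD.
- exact: measurable_funM.
Qed.

Lemma bounded_pfun f (C : R) : pfun f ->
  exists M, forall x : E, (forall i, `|x 0 i| <= C) -> `|f x| <= M.
Proof.
elim=> [c|i|{}f g _ [M fM] _ [N gN]|{}f g _ [M fM] _ [N gN]].
- by exists `|c|.
- by exists C.
- exists (M + N) => x xC; rewrite (le_trans (ler_normD _ _))//.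
  by rewrite lerD ?fM ?gN.
- by exists (M * N) => x xC; rewrite normrM ler_pM ?fM ?gN.
Qed.

Lemma is_derive_coord (x v : E) (i : 'I_d) :
  is_derive x v (fun y : E => y 0 i) (v 0 i).
Proof.
have cv : (fun h : R => h^-1 *: (((h *: v + x) 0 i - x 0 i) : R)) @ 0^'
    --> v 0 i.
  apply: (@cvg_trans _ ((fun=> v 0 i) @ 0^')); last exact: cvg_cst.
  apply: near_eq_cvg; near=> h.
  rewrite !mxE addrK scalerA mulVf ?scale1r //.
  by near: h; exact: nbhs_dnbhs_neq.
by split; [apply/cvg_ex; exists (v 0 i)|exact: cvg_lim].
Unshelve. all: by end_near. Qed.

(** One family [g] serving all directions [v] yields, by induction on the polynomial, the linearity
    of ['D_v f] in [v]. *)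
Lemma pfun_grad f : pfun f -> exists2 g : 'I_d -> E -> R,
  forall i, pfun (g i) & forall x v, is_derive x v f (\sum_i v 0 i * g i x).
Proof.
elim=> [c|i|{}f f' pf [g pg fg] pf' [g' pg' fg']|{}f f' pf [g pg fg] pf' [g' pg' fg']].
- exists (fun _ => fun=> 0) => [i|x v]; first exact: pfun_cst.
  by rewrite big1 => [|i _]; [exact: is_derive_cst|rewrite mulr0].
- exists (fun j => fun=> (j == i)%:R) => [j|x v]; first exact: pfun_cst.
  rewrite (bigD1 i) //= eqxx mulr1 big1 ?addr0 => [|j /negPf ->].
    exact: is_derive_coord.
  by rewrite mulr0.
- exists (fun i x => g i x + g' i x) => [i|x v]; first exact: pfunD.
  have := is_deriveD (fg x v) (fg' x v); rewrite -big_split /=.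
  by under eq_bigr do rewrite -mulrDr.
- exists (fun i x => f x * g' i x + f' x * g i x) => [i|x v].
    by apply: pfunD; exact: pfunM.
  apply: (is_derive_eq (is_deriveM (fg x v) (fg' x v))).
  rewrite !scaler_sumr -big_split /=.
  by apply: eq_bigr => i _; rewrite /GRing.scale /=; ring.
Qed.

Lemma pfun_derive f v : pfun f -> pfun ('D_v f).
Proof.
move=> /pfun_grad [g pg fg].
rewrite (_ : 'D_v f = fun x => \sum_i v 0 i * g i x).
  by apply: pfun_sum => i _; apply: pfunM => //; exact: pfun_cst.
by apply/funext => x; have := fg x v; case.
Qed.

Lemma pfun_derivable f x v : pfun f -> derivable f x v.
Proof. by move=> /pfun_grad [g _ fg]; have [] := fg x v. Qed.

Lemma pfun_derive_sum f x v : pfun f ->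
  'D_v f x = \sum_i v 0 i * 'D_(delta_mx 0 i) f x.
Proof.
move=> /pfun_grad [g _ fg]; have [_ ->] := fg x v.
apply: eq_bigr => i _; have [_ ->] := fg x (delta_mx 0 i).
rewrite (bigD1 i) //= mxE !eqxx mul1r big1 ?addr0 // => j /negPf ji.
by rewrite mxE eqxx ji mul0r.
Qed.

Lemma is_derive_line (f : E -> R) (p v : E) (t : R) : pfun f ->
  is_derive t 1 (fun s : R => f (p + s *: v)) ('D_v f (p + t *: v)).
Proof.
move=> pf; have := @pfun_derivable f (p + t *: v) v pf.
rewrite /derivable => df.
have E : (fun h : R => h^-1 *: (f (h *: v + (p + t *: v)) - f (p + t *: v))) =
  (fun h : R => h^-1 *: (f (p + (h *: (1 : R) + t) *: v) - f (p + t *: v))).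
  apply/funext => h; congr (_ *: (f _ - _)).
  by rewrite scalerDl addrCA /GRing.scale /= mulr1.
by split; rewrite /derivable /derive -E.
Qed.

End polynomial_functions.

Lemma pfun_comp (R : realType) (m n : nat) (f : 'rV[R]_n -> R)
    (A : 'rV[R]_m -> 'rV[R]_n) :
  (forall i, pfun (fun x => A x 0 i)) -> pfun f -> pfun (fun x => f (A x)).
Proof.
move=> pA; elim=> [c|i|g h _ IHg _ IHh|g h _ IHg _ IHh].
- exact: pfun_cst.
- exact: pA.
- exact: pfunD.
- exact: pfunM.
Qed.

Lemma pfun_affine (R : realType) (m n : nat) (f : 'rV[R]_n -> R)
    (M : 'M[R]_(m, n)) (b : 'rV[R]_n) :
  pfun f -> pfun (fun x : 'rV[R]_m => f (x *m M + b)).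
Proof.
apply: pfun_comp => i.
rewrite (_ : (fun _ => _) = fun x : 'rV[R]_m => \sum_j x 0 j * M j i + b 0 i).
  apply: pfunD; last exact: pfun_cst.
  by apply: pfun_sum => j _; apply: pfunM; [exact: pfun_coord|exact: pfun_cst].
by apply/funext => x; rewrite !mxE.
Qed.

(** * Polynomials of bounded degree and interpolation *)

Section poly_on.
Context (R : realType) (d : nat).
Local Notation E := 'rV[R]_d.

Lemma poly_on_pfun k (D : set E) f : poly_on k D f ->
  exists2 g, pfun g & forall x, D x -> f x = g x.
Proof.
move=> [c fE]; eexists; last exact: fE.
apply: pfun_sum => a _; apply: pfunM; first exact: pfun_cst.
by apply: pfun_prod => i _; apply: pfunX; exact: pfun_coord.
Qed.

Lemma poly_onT_pfun k (f : E -> R) : poly_on k setT f -> pfun f.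
Proof.
by move=> /poly_on_pfun [g pg fg]; rewrite (_ : f = g) //; apply/funext => x; exact: fg.
Qed.

Lemma poly_on0 k (D : set E) : poly_on k D (fun=> 0).
Proof. by exists (fun=> 0) => x _; rewrite big1 // => a _; rewrite mul0r. Qed.

Lemma poly_onD k (D : set E) f g :
  poly_on k D f -> poly_on k D g -> poly_on k D (fun x => f x + g x).
Proof.
move=> [c fc] [e ge]; exists (fun a => c a + e a) => x Dx.
by rewrite fc // ge // -big_split /=; apply: eq_bigr => a _; rewrite mulrDl.
Qed.

Lemma poly_onZ k (D : set E) f (b : R) :
  poly_on k D f -> poly_on k D (fun x => b * f x).
Proof.
move=> [c fc]; exists (fun a => b * c a) => x Dx.
by rewrite fc // mulr_sumr; apply: eq_bigr => a _; rewrite mulrA.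
Qed.

Lemma poly_on_sum k (D : set E) I (r : seq I) (P : pred I) (f : I -> E -> R) :
  (forall i, P i -> poly_on k D (f i)) ->
  poly_on k D (fun x => \sum_(i <- r | P i) f i x).
Proof.
move=> pf; elim: r => [|i r IH].
  rewrite (_ : (fun _ => _) = fun=> 0); first exact: poly_on0.
  by apply/funext => x; rewrite big_nil.
rewrite (_ : (fun _ => _) = fun x =>
    (if P i then f i x else 0) + \sum_(j <- r | P j) f j x).
  by apply: poly_onD => //; case Pi : (P i); [exact: pf|exact: poly_on0].
by apply/funext => x; rewrite big_cons; case: ifP => //; rewrite add0r.
Qed.

Lemma poly_on_subset k (D D' : set E) f :
  D' `<=` D -> poly_on k D f -> poly_on k D' f.
Proof. by move=> DD [c fc]; exists c => x /DD; exact: fc. Qed.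

Lemma poly_on_monomial k (D : set E) (b : 'I_d -> nat) :
  (\sum_i b i <= k)%N -> poly_on k D (fun x => \prod_i x 0 i ^+ b i).
Proof.
move=> bk; have bi i : (b i <= k)%N.
  by apply: leq_trans bk; rewrite (bigD1 i) //= leq_addr.
pose a0 : {ffun 'I_d -> 'I_k.+1} := [ffun i => inord (b i)].
have a0E i : a0 i = b i :> nat by rewrite ffunE inordK // ltnS.
exists (fun a => (a == a0)%:R) => x _.
rewrite (bigD1 a0) /=; last by rewrite (eq_bigr b) // => i _; rewrite a0E.
rewrite eqxx mul1r [X in _ + X]big1 ?addr0 => [|a /andP[_ /negPf ->]]; last by rewrite mul0r.
by apply: eq_bigr => i _; rewrite a0E.
Qed.

Lemma is_derive_monomial (b : 'I_d -> nat) (i : 'I_d) (x : E) :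
  is_derive x (delta_mx 0 i) (fun x : E => \prod_j x 0 j ^+ b j)
    ((b i)%:R * \prod_j x 0 j ^+ (b j - (j == i))).
Proof.
have dj j n : is_derive x (delta_mx 0 i : E) (fun x : E => x 0 j ^+ n)
    ((j == i)%:R * (n%:R * x 0 j ^+ n.-1)).
  have := is_deriveX n (is_derive_coord x (delta_mx 0 i) j).
  by rewrite mxE eqxx /= /GRing.scale /= mulrC exprfctE.
rewrite (_ : (fun x : E => _) = (fun x : E => x 0 i ^+ b i) *
    (fun x : E => \prod_(j | j != i) x 0 j ^+ b j)); last first.
  by apply/funext => y; rewrite (bigD1 i).
have d0 : is_derive x (delta_mx 0 i : E)
    (fun x : E => \prod_(j | j != i) x 0 j ^+ b j) 0.
  rewrite -fct_prodE; elim/big_ind: _ => //.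
  - exact: is_derive_cst.
  - move=> f g df dg; apply: (is_derive_eq (is_deriveM df dg)).
    by rewrite !scaler0 addr0.
  - by move=> j /negPf ji; have := dj j (b j); rewrite ji mul0r.
apply: (is_derive_eq (is_deriveM (dj i (b i)) d0)).
rewrite scaler0 add0r eqxx mul1r /GRing.scale /= [in RHS](bigD1 i) //= eqxx subn1 mulrC mulrA.
congr (_ * _); apply: eq_bigr => j /negPf ->; by rewrite subn0.
Qed.

Lemma poly_on_derive k (f : E -> R) (i : 'I_d) :
  poly_on k setT f -> poly_on k.-1 setT ('D_(delta_mx 0 i) f).
Proof.
move=> [c fc].
rewrite (_ : 'D_(delta_mx 0 i) f = fun x =>
  \sum_(a : {ffun 'I_d -> 'I_k.+1} | (\sum_i a i <= k)%N)
    c a * ((a i)%:R * \prod_j x 0 j ^+ (a j - (j == i)))); last first.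
  apply/funext => x.
  rewrite (_ : f = \sum_(a : {ffun 'I_d -> 'I_k.+1} | (\sum_i a i <= k)%N)
     c a *: (fun x : E => \prod_j x 0 j ^+ a j)); last first.
    by apply/funext => y; rewrite fc // fct_sumE.
  apply: (@derive_val _ _ _ x (delta_mx 0 i) _ _); elim/big_ind2 : _.
  - exact: is_derive_cst.
  - by move=> f1 d1 f2 d2 h1 h2; exact: is_deriveD.
  - by move=> a _; apply: is_deriveZ; exact: is_derive_monomial.
apply: poly_on_sum => a ak; apply: poly_onZ.
(* When [a i] is zero the truncated subtraction does not lower the degree, but the factor [(a i)%:R]
   kills the term; otherwise the total degree drops by one. *)
have [->|ai0] := eqVneq (a i : nat) 0%N.
  by rewrite (_ : (fun _ => _) = fun=> 0); [exact: poly_on0|apply/funext => x; rewrite mul0r].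
apply/poly_onZ/poly_on_monomial.
have lt_sum : (\sum_j (a j - (j == i)) < \sum_j a j)%N.
  rewrite (bigD1 i) //= [X in (_ < X)%N](bigD1 i) //= eqxx subn1.
  rewrite -addSn prednK ?lt0n // leq_add2l; apply/eq_leq/eq_bigr => j /negPf ->.
  by rewrite subn0.
have lt_k := leq_trans lt_sum ak.
by rewrite -ltnS prednK // (leq_ltn_trans _ lt_k).
Qed.

(** Tensor products of Lagrange polynomials on the grid of integer points with coordinates up to [k]
    reproduce every monomial, since each exponent is at most [k]. As [phi] does not depend on [f], a
    time-dependent polynomial reduces to finitely many scalar functions of time, its nodal
    values. *)
Lemma interpolation k : exists phi : {ffun 'I_d -> 'I_k.+1} -> E -> R,
  (forall m, pfun (phi m)) /\
  forall f, poly_on k setT f ->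
    forall x, f x = \sum_(m : {ffun 'I_d -> 'I_k.+1})
      f (\row_i (m i)%:R) * phi m x.
Proof.
pose node (i : nat) : R := i%:R.
have node_inj : injective node by exact: mulrIn (oner_neq0 R).
pose l (i : 'I_k.+1) : {poly R} := tnth (k.+1.-lagrange node) i.
have lE (a : 'I_k.+1) (x : R) : x ^+ a = \sum_(i < k.+1) (i%:R ^+ a) * (l i).[x].
  have : (size ('X^a : {poly R}) <= k.+1)%N by rewrite size_polyXn.
  move=> /(lagrange_gen (ltn0Sn k) node_inj) /(congr1 (horner^~ x)).
  rewrite hornerXn horner_sum => ->; apply: eq_bigr => i _.
  by rewrite hornerM hornerC hornerXn.
exists (fun m x => \prod_i (l (m i)).[x 0 i]); split.
  move=> m; apply: pfun_prod => i _.
  rewrite (_ : (fun _ => _) = fun x : E =>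
      \sum_(j < size (l (m i))) (l (m i))`_j * x 0 i ^+ j).
    apply: pfun_sum => j _; apply: pfunM; first exact: pfun_cst.
    by apply: pfunX; exact: pfun_coord.
  by apply/funext => x; rewrite horner_coef.
move=> f [c fc] x; rewrite fc //.
under [RHS]eq_bigr do rewrite fc // mulr_suml.
rewrite exchange_big /=; apply: eq_bigr => a _.
under [RHS]eq_bigr do rewrite -mulrA; rewrite -mulr_sumr; congr (_ * _).
under eq_bigr do rewrite lE.
rewrite bigA_distr_bigA /=; apply: eq_bigr => m _.
by rewrite -big_split /=; apply: eq_bigr => i _; rewrite mxE.
Qed.

End poly_on.

(** * Barycentric coordinates and integration over the unit simplex *)

Section simplex_map.
Context (R : realType) (n : nat).

Definition edges d (w : 'I_n.+1 -> 'rV[R]_d) : 'M[R]_(n, d) :=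
  \matrix_(i < n) (w (lift ord0 i) - w ord0).

Definition simplex_map d (w : 'I_n.+1 -> 'rV[R]_d) (y : 'rV[R]_n) : 'rV[R]_d :=
  w ord0 + y *m edges w.

(** Barycentric coordinates relative to the origin, which has index [ord0], and the standard basis
    vectors. *)
Definition bary (y : 'rV[R]_n) (i : 'I_n.+1) : R :=
  if unlift ord0 i is Some j then y 0 j else 1 - \sum_j y 0 j.

Definition std_vertex (i : 'I_n.+1) : 'rV[R]_n :=
  \row_j (i == lift ord0 j)%:R.

Lemma bary0 y : bary y ord0 = 1 - \sum_j y 0 j.
Proof. by rewrite /bary unlift_none. Qed.

Lemma bary_lift y j : bary y (lift ord0 j) = y 0 j.
Proof. by rewrite /bary liftK. Qed.

Lemma sum_bary y : \sum_i bary y i = 1.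
Proof.
rewrite big_ord_recl bary0; under [X in _ + X]eq_bigr do rewrite bary_lift.
by rewrite subrK.
Qed.

Lemma simplex_mapE d (w : 'I_n.+1 -> 'rV[R]_d) y :
  simplex_map w y = \sum_i bary y i *: w i.
Proof.
rewrite big_ord_recl bary0; under [X in _ = _ + X]eq_bigr do rewrite bary_lift.
rewrite /simplex_map mulmx_sum_row scalerBl scale1r -addrA; congr (_ + _).
rewrite scaler_suml -sumrN -big_split /=; apply: eq_bigr => i _.
by rewrite rowK scalerBr addrC.
Qed.

Lemma std_vertex_edges d (w : 'I_n.+1 -> 'rV[R]_d) k :
  std_vertex k *m edges w = w k - w ord0.
Proof.
rewrite mulmx_sum_row; case: (unliftP ord0 k) => [j|] ->.
  rewrite (bigD1 j) //= mxE eqxx scale1r rowK big1 ?addr0 // => i /negPf ij.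
  by rewrite mxE (inj_eq lift_inj) eq_sym ij scale0r.
by rewrite subrr big1 // => i _; rewrite mxE scale0r.
Qed.

(** Relabelling the vertices factors through the affine map of the reference simplex that sends
    vertex [i] to vertex [p i]; [edges] is the linear part of such a map. *)
Lemma edges_perm d (w : 'I_n.+1 -> 'rV[R]_d) (p : 'I_n.+1 -> 'I_n.+1) :
  edges (w \o p) = edges (std_vertex \o p) *m edges w.
Proof.
apply/row_matrixP => i; rewrite row_mul !rowK /= mulmxBl !std_vertex_edges.
by rewrite opprB addrA subrK.
Qed.

Lemma simplex_map_perm d (w : 'I_n.+1 -> 'rV[R]_d) (p : 'I_n.+1 -> 'I_n.+1) y :
  simplex_map (w \o p) y = simplex_map w (simplex_map (std_vertex \o p) y).
Proof.
rewrite /simplex_map edges_perm mulmxDl std_vertex_edges mulmxA /= addrA.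
by rewrite subrKC.
Qed.

Lemma bary_perm (p : 'S_n.+1) y i :
  bary (simplex_map (std_vertex \o p) y) i = bary y (p^-1%g i).
Proof.
have H j : bary (simplex_map (std_vertex \o p) y) (lift ord0 j) =
    bary y (p^-1%g (lift ord0 j)).
  rewrite bary_lift simplex_mapE summxE (bigD1 (p^-1%g (lift ord0 j))) //=.
  rewrite !mxE permKV eqxx mulr1 big1 ?addr0 // => k kp.
  rewrite !mxE -[k](permK p) in kp *; rewrite permK.
  by rewrite (negPf (contraNneq _ kp)) ?mulr0 // => ->.
case: (unliftP ord0 i) => [j|] -> //.
apply: (addIr (\sum_j bary (simplex_map (std_vertex \o p) y) (lift ord0 j))).
rewrite -big_ord_recl sum_bary; under eq_bigr do rewrite H.
rewrite -(big_ord_recl n (fun i => bary y (p^-1%g i))).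
by rewrite (reindex_inj (@perm_inj _ p)) /=; under eq_bigr do rewrite permK; rewrite sum_bary.
Qed.

Lemma edges_std : edges std_vertex = 1%:M.
Proof.
apply/matrixP => i j; rewrite !mxE (inj_eq lift_inj).
by rewrite (negPf (neq_lift _ _)) subr0.
Qed.

(** The modulus of the determinant is multiplicative on the symmetric group, a finite group, so it
    is a nonnegative real having a power equal to one. *)
Lemma norm_det_std_perm (p : 'S_n.+1) : `|\det (edges (std_vertex \o p))| = 1.
Proof.
pose D (q : 'S_n.+1) := `|\det (edges (std_vertex \o q))|.
have DM q q' : D (q * q')%g = D q * D q'.
  rewrite /D -normrM -det_mulmx -edges_perm; congr (`|\det (edges _)|).
  by apply/funext => i /=; rewrite permM.
have D1 : D 1%g = 1.
  rewrite /D (_ : std_vertex \o _ = std_vertex) ?edges_std ?det1 ?normr1 //.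
  by apply/funext => i /=; rewrite perm1.
have DX k : D (p ^+ k)%g = D p ^+ k.
  by elim: k => [|k IH]; rewrite ?expg0 ?expr0 // expgS exprS DM IH.
have := DX #[p]%g; rewrite expg_order D1 => /esym/eqP.
by rewrite pexpr_eq1 ?order_gt0 ?/D ?normr_ge0 // => /eqP.
Qed.

Lemma norm_det_edges_perm (w : 'I_n.+1 -> 'rV[R]_n) (p : 'S_n.+1) :
  `|\det (edges (w \o p))| = `|\det (edges w)|.
Proof. by rewrite edges_perm det_mulmx normrM norm_det_std_perm mul1r. Qed.

Lemma det_gram_perm d (w : 'I_n.+1 -> 'rV[R]_d) (p : 'S_n.+1) :
  \det (edges (w \o p) *m (edges (w \o p))^T) = \det (edges w *m (edges w)^T).
Proof.
rewrite edges_perm trmx_mul mulmxA -(mulmxA _ (edges w)) !det_mulmx det_tr.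
rewrite mulrAC -expr2 -real_normK ?num_real // norm_det_std_perm.
by rewrite expr1n mul1r.
Qed.

End simplex_map.

Section simplex_integral.
Context (R : realType).
Local Notation RR := (measurableTypeR R).
Local Notation mu := (lebesgue_tuple R).
Local Notation leb := (@lebesgue_measure R).

(** The positive and negative parts are transformed separately. The Jacobian being finite and
    nonzero, infinite values occur on both sides together, and [fine] treats them alike. *)
Lemma Rintegral_affine n (M : 'M[R]_n) (b : 'rV[R]_n) (D : set 'rV[R]_n)
    (h : 'rV[R]_n -> R) : M \in unitmx ->
  measurable_fun setT (fun y : n.-tuple RR => h (row_of_tuple y)) ->
  measurable (@row_of_tuple R n @^-1` D) ->
  \int[mu n]_(y in @row_of_tuple R n @^-1` D) h (row_of_tuple y) =
  `|\det M| * \int[mu n]_(y in @row_of_tuple R n @^-1`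
       ((fun x => x *m M + b) @^-1` D)) h (row_of_tuple y *m M + b).
Proof.
move=> uM mh mD; rewrite /Rintegral.
pose f : 'rV[R]_n -> \bar R := (EFin \o h) \_ D.
have fE (A : n.-tuple RR -> 'rV[R]_n) :
    (\int[mu n]_(y in A @^-1` D) (h (A y))%:E = \int[mu n]_y f (A y))%E.
  by rewrite integral_mkcond; apply: eq_integral => y _; rewrite /f !patchE.
rewrite (fE (fun y => row_of_tuple y)) (fE (fun y => row_of_tuple y *m M + b)).
have mf : mrow f.
  rewrite /mrow (_ : (fun _ => _) = (fun y : n.-tuple RR => (h (row_of_tuple y))%:E)
      \_ (@row_of_tuple R n @^-1` D)); last first.
    by apply/funext => y; rewrite /f !patchE.
  apply/(measurable_restrictT _ mD); apply/measurable_EFinP.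
  exact: measurable_funTS.
have d0 : 0 < `|\det M| by rewrite normr_gt0 -unitfE -unitmxE.
rewrite integralE [in RHS]integralE.
under eq_integral do rewrite funeposE.
under [X in fine (_ - X)]eq_integral do rewrite funenegE.
under [in RHS]eq_integral do rewrite funeposE.
under [X in _ = _ * fine (_ - X)]eq_integral do rewrite funenegE.
have mfp : mrow (fun x => maxe (f x) 0) by exact: measurable_maxe.
have mfn : mrow (fun x => maxe (- f x)%E 0).
  by apply: measurable_maxe => //; exact: measurableT_comp.
have fp0 x : (0 <= maxe (f x) 0)%E by rewrite le_max lexx orbT.
have fn0 x : (0 <= maxe (- f x) 0)%E by rewrite le_max lexx orbT.
rewrite (integral_affine b uM mfp) // (integral_affine b uM mfn) //.
have : (0 <= \int[mu n]_x maxe (f (row_of_tuple x *m M + b)%R) 0)%E.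
  by apply: integral_ge0.
have : (0 <= \int[mu n]_x maxe (- f (row_of_tuple x *m M + b)%R) 0)%E.
  by apply: integral_ge0.
move: (integral _ _ _) (integral _ _ _) => u v.
by case: u v => [u| |] [v| |] //= _ _;
  rewrite ?gt0_muley ?lte_fin //= ?mulr0 // mulrBr.
Qed.

Lemma measurable_forall_le (d : measure_display) (T : measurableType d)
    (I : finType) (f : I -> T -> R) :
  (forall i, measurable_fun setT (f i)) ->
  measurable [set y | forall i, 0 <= f i y].
Proof.
move=> mf; rewrite (_ : [set _ | _] = \bigcap_(i in setT) (f i @^-1` `[0, +oo[)).
  apply: fin_bigcap_measurable => [|i _]; first exact: finite_finset.
  by rewrite -[X in measurable X]setTI; exact: mf.
by apply/seteqP; split => y /= H i => [_|]; have := H i; rewrite /= in_itv /= andbT; exact.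
Qed.

Lemma measurable_forall_lt (d : measure_display) (T : measurableType d)
    (I : finType) (f : I -> T -> R) :
  (forall i, measurable_fun setT (f i)) ->
  measurable [set y | forall i, 0 < f i y].
Proof.
move=> mf; rewrite (_ : [set _ | _] = \bigcap_(i in setT) (f i @^-1` `]0, +oo[)).
  apply: fin_bigcap_measurable => [|i _]; first exact: finite_finset.
  by rewrite -[X in measurable X]setTI; exact: mf.
by apply/seteqP; split => y /= H i => [_|]; have := H i; rewrite /= in_itv /= andbT; exact.
Qed.

Definition csimplex n : set 'rV[R]_n := [set x | forall i, 0 <= bary x i].
Definition osimplex n : set 'rV[R]_n := [set x | forall i, 0 < bary x i].

Lemma unit_simplexE n : @unit_simplex R n = @row_of_tuple R n @^-1` @csimplex n.
Proof.
have sE y : \sum_j (row_of_tuple y : 'rV[R]_n) 0 j = \sum_j tnth y j.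
  by apply: eq_bigr => j _; rewrite mxE.
apply/seteqP; split => y /=.
  move=> [y0 y1] i; case: (unliftP ord0 i) => [j|] ->.
    by rewrite bary_lift mxE.
  by rewrite bary0 sE subr_ge0.
move=> H; split => [i|]; first by have := H (lift ord0 i); rewrite bary_lift mxE.
by have := H ord0; rewrite bary0 sE subr_ge0.
Qed.

Lemma pfun_bary n (i : 'I_n.+1) : pfun (fun x : 'rV[R]_n => bary x i).
Proof.
case: (unliftP ord0 i) => [j|] ->.
  rewrite (_ : (fun _ => _) = fun x : 'rV[R]_n => x 0 j); first exact: pfun_coord.
  by apply/funext => x; rewrite bary_lift.
rewrite (_ : (fun _ => _) = fun x : 'rV[R]_n => 1 - \sum_j x 0 j).
  by apply: pfunB; [exact: pfun_cst|apply: pfun_sum => j _; exact: pfun_coord].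
by apply/funext => x; rewrite bary0.
Qed.

Lemma measurable_csimplex n : measurable (@row_of_tuple R n @^-1` @csimplex n).
Proof.
apply: (measurable_forall_le (f := fun i y => bary (row_of_tuple y) i)) => i.
exact: (measurable_pfun (pfun_bary i)).
Qed.

Lemma measurable_osimplex n : measurable (@row_of_tuple R n @^-1` @osimplex n).
Proof.
apply: (measurable_forall_lt (f := fun i y => bary (row_of_tuple y) i)) => i.
exact: (measurable_pfun (pfun_bary i)).
Qed.

Lemma measurable_unit_simplex n : measurable (@unit_simplex R n).
Proof. rewrite unit_simplexE; exact: measurable_csimplex. Qed.

Lemma bary_row_mx n (x : R) (y : 'rV[R]_n) :
  [/\ bary (row_mx x%:M y : 'rV[R]_(1 + n)) ord0 = 1 - x - \sum_j y 0 j,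
      bary (row_mx x%:M y : 'rV[R]_(1 + n)) (lift ord0 ord0) = x &
      forall j, bary (row_mx x%:M y : 'rV[R]_(1 + n)) (lift ord0 (lift ord0 j)) = y 0 j].
Proof.
have c0 : (row_mx x%:M y : 'rV[R]_(1 + n)) 0 ord0 = x.
  transitivity (row_mx (x%:M : 'M[R]_1) y 0 (lshift n ord0)).
    by congr (row_mx _ _ _ _); exact: val_inj.
  by rewrite row_mxEl mxE eqxx.
have cl j : (row_mx x%:M y : 'rV[R]_(1 + n)) 0 (lift ord0 j) = y 0 j.
  rewrite -(row_mxEr (x%:M : 'M[R]_1) y 0 j).
  by congr (row_mx _ _ _ _); exact: val_inj.
split=> [||j]; rewrite ?bary_lift //.
by rewrite bary0 big_ord_recl c0 opprD addrA; under eq_bigr do rewrite cl.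
Qed.

Lemma csimplex_row_mx n (x : R) (y : 'rV[R]_n) :
  csimplex (row_mx x%:M y : 'rV[R]_(1 + n)) <->
  csimplex y /\ 0 <= x <= 1 - \sum_j y 0 j.
Proof.
have [b0 bx bl] := bary_row_mx x y.
split=> [H|[H /andP[x0 x1]] i].
  have h0 := H ord0; have hx := H (lift ord0 ord0); rewrite b0 bx in h0 hx.
  split; last by lra.
  move=> i; case: (unliftP ord0 i) => [j|] ->.
    by rewrite bary_lift -bl.
  by rewrite bary0; lra.
case: (unliftP ord0 i) => [j|] ->; last by rewrite b0; lra.
case: (unliftP ord0 j) => [k|] ->; last by rewrite bx.
by rewrite bl -bary_lift.
Qed.

Lemma csimplex_le1 n (x : 'rV[R]_n) i : csimplex x -> `|x 0 i| <= 1.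
Proof.
move=> H; have xi j : 0 <= x 0 j by have := H (lift ord0 j); rewrite bary_lift.
rewrite ger0_norm //; have := H ord0; rewrite bary0 subr_ge0; apply: le_trans.
by rewrite (bigD1 i) //= lerDl sumr_ge0.
Qed.

Lemma unit_simplex_fin n : (mu n (@unit_simplex R n) < +oo)%E.
Proof.
elim: n => [|n IH].
  by rewrite /= diracE; case: (_ \in _); rewrite ltry.
apply: (@le_lt_trans _ _ ((leb \x mu n)%E (`[0, 1] `*` @unit_simplex R n))).
  rewrite /= /cons_measure /pushforward; apply: le_measure; rewrite ?inE.
  - rewrite -[X in measurable X]setTI; apply: measurable_cons_pair => //.
    exact: measurable_unit_simplex.
  - apply: measurableX; [exact: measurable_itv|exact: measurable_unit_simplex].
  - move=> [x y] /=; rewrite !unit_simplexE /= row_of_tuple_cons.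
    move=> /csimplex_row_mx [Hy /andP[x0 x1]]; split => //.
    rewrite /= in_itv /= x0 (le_trans x1) // gerBl.
    apply: sumr_ge0 => j _; have := Hy (lift ord0 j); by rewrite bary_lift.
rewrite product_measure1E//; last exact: measurable_unit_simplex.
rewrite [X in (X * _)%E](_ : _ = lebesgue_measure [set` `[0%R, 1%R]]) //.
by rewrite lebesgue_measure_itv /= lte01 oppr0 adde0 mul1e.
Qed.

Lemma integrable_pfun_simplex n (h : 'rV[R]_n -> R) (D : set (n.-tuple RR)) :
  measurable D -> D `<=` @unit_simplex R n -> pfun h ->
  (mu n).-integrable D (fun y => (h (row_of_tuple y))%:E).
Proof.
move=> mD DS ph; apply: measurable_bounded_integrable => //.
- apply: le_lt_trans (unit_simplex_fin n); apply: le_measure; rewrite ?inE //.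
  exact: measurable_unit_simplex.
- apply: measurable_funTS; exact: measurable_pfun.
- have [M HM] := bounded_pfun 1 ph.
  exists M; split; first by rewrite num_real.
  move=> N MN y Dy; apply/ltW; rewrite (le_lt_trans _ MN) //; apply: HM => i.
  apply: csimplex_le1; have := DS _ Dy; by rewrite unit_simplexE.
Qed.

Definition simplex_int n d (w : 'I_n.+1 -> 'rV[R]_d) (g : 'rV[R]_d -> R) : R :=
  \int[mu n]_(y in @unit_simplex R n) g (simplex_map w (row_of_tuple y)).

Lemma pfun_simplex_map n d (w : 'I_n.+1 -> 'rV[R]_d) g :
  pfun g -> pfun (fun y => g (simplex_map w y)).
Proof.
move=> pg; rewrite (_ : (fun _ => _) = fun y => g (y *m edges w + w ord0)).
  exact: pfun_affine.
by apply/funext => y; rewrite /simplex_map addrC.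
Qed.

Lemma unit_std_perm n (p : 'S_n.+1) : edges (@std_vertex R n \o p) \in unitmx.
Proof. by rewrite unitmxE unitfE -normr_gt0 norm_det_std_perm. Qed.

(** A vertex permutation maps the unit simplex onto itself with Jacobian of modulus one, so
    integrals may be computed in whichever vertex order suits the argument. *)
Lemma simplex_int_perm n d (w : 'I_n.+1 -> 'rV[R]_d) (p : 'S_n.+1) g :
  pfun g -> simplex_int (w \o p) g = simplex_int w g.
Proof.
move=> pg; rewrite /simplex_int !unit_simplexE.
rewrite [RHS](@Rintegral_affine _ _ (std_vertex R (p ord0)) _ (fun y => g (simplex_map w y))
  (unit_std_perm p)).
- rewrite norm_det_std_perm mul1r.
  have sE (x : 'rV[R]_n) : x *m edges (@std_vertex R n \o p) + std_vertex R (p ord0)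
      = simplex_map (@std_vertex R n \o p) x by rewrite addrC.
  rewrite (_ : (fun x => x *m _ + _) @^-1` @csimplex n = @csimplex n).
    by apply: eq_Rintegral => y _; rewrite simplex_map_perm sE.
  apply/seteqP; split => x /= H i; last by rewrite sE bary_perm.
  by have := H (p i); rewrite sE bary_perm permK.
- exact: (measurable_pfun (pfun_simplex_map w pg)).
- exact: measurable_csimplex.
Qed.

End simplex_integral.

(** * Null faces and the fundamental theorem of calculus on the reference simplex *)

Section reference_simplex.
Context (R : realType).
Local Notation RR := (measurableTypeR R).
Local Notation mu := (lebesgue_tuple R).
Local Notation leb := (@lebesgue_measure R).

Lemma measurable_pfun_eq0 n (f : 'rV[R]_n -> R) : pfun f ->
  measurable (@row_of_tuple R n @^-1` [set x | f x = 0]).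
Proof.
move=> pf.
have := measurable_pfun pf measurableT (measurable_set1 (0 : R)).
by rewrite setTI.
Qed.

Lemma mrow_indic n (A : set 'rV[R]_n) : measurable (@row_of_tuple R n @^-1` A) ->
  mrow (fun x => (\1_A x)%:E).
Proof.
move=> mA; apply/measurable_EFinP.
rewrite (_ : (fun _ => _) = \1_(@row_of_tuple R n @^-1` A)) //.
Qed.

Lemma integral_indic_row n (A : set 'rV[R]_n) : measurable (@row_of_tuple R n @^-1` A) ->
  (\int[mu n]_y (\1_A (row_of_tuple y))%:E = mu n (@row_of_tuple R n @^-1` A))%E.
Proof.
by move=> mA; have := integral_indic (mu n) measurableT mA; rewrite setIT.
Qed.

Lemma eq_indic (T T' : Type) (A : set T) (B : set T') x y :
  (A x <-> B y) -> \1_A x = \1_B y :> R.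
Proof.
move=> AB; rewrite !indicE; congr (nat_of_bool _)%:R.
by apply/idP/idP; rewrite !inE => /AB.
Qed.

(** A vertex permutation turns the face into the hyperplane where the first coordinate vanishes,
    whose slices along that coordinate are single points. *)
Lemma bary_null n (i : 'I_n.+1) :
  mu n (@row_of_tuple R n @^-1` [set x | bary x i = 0]) = 0%E.
Proof.
case: n i => [|n] i.
  (* In dimension zero the measure is a Dirac mass, but the only barycentric coordinate equals 1 and
     the face is empty. *)
  rewrite (_ : _ @^-1` _ = set0) ?measure0 //; apply/seteqP; split => // y /=.
  by rewrite (ord1 i) bary0 big_ord0 subr0 => /eqP; rewrite oner_eq0.
have mN j : measurable (@row_of_tuple R n.+1 @^-1` [set x | bary x j = 0]).
  by apply: measurable_pfun_eq0; exact: pfun_bary.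
pose j0 : 'I_n.+2 := lift ord0 ord0.
pose p := tperm i j0.
rewrite -integral_indic_row //.
rewrite (@integral_affine R n.+1 _ (std_vertex R (p ord0))
  (fun x => (\1_[set x : 'rV[R]_n.+1 | bary x i = 0] x)%:E) (unit_std_perm R p)) //; last first.
  exact: mrow_indic.
rewrite norm_det_std_perm mul1e.
transitivity (\int[mu n.+1]_y (\1_[set x : 'rV[R]_n.+1 | bary x j0 = 0] (row_of_tuple y))%:E)%E.
  apply: eq_integral => y _; congr EFin.
  rewrite [_ + _](_ : _ = simplex_map (@std_vertex R n.+1 \o p) (row_of_tuple y)); last first.
    by rewrite addrC.
  by apply: eq_indic; rewrite /= bary_perm tpermV tpermL.
rewrite (@tonelli_row_sym R n (fun x => (\1_[set x : 'rV[R]_n.+1 | bary x j0 = 0] x)%:E)); last 2 first.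
- exact: mrow_indic.
- by move=> x; rewrite lee_fin.
rewrite integral0_eq // => y _.
transitivity (\int[leb]_x (\1_[set 0 : R] x)%:E)%E.
  apply: eq_integral => x _; congr EFin.
  apply: eq_indic; rewrite /= /j0 bary_lift.
  have -> : (row_mx x%:M (row_of_tuple y) : 'rV[R]_(1 + n)) 0 ord0 = x.
    transitivity (row_mx (x%:M : 'M[R]_1) (row_of_tuple y) 0 (lshift n ord0)).
      by congr (row_mx _ _ _ _); exact: val_inj.
    by rewrite row_mxEl mxE eqxx.
  by [].
rewrite integral_indic // setIT; exact: lebesgue_measure_set1.
Qed.

Lemma osimplexE n : @osimplex R n = @csimplex R n `\`
  \bigcup_(i in [set` enum 'I_n.+1]) [set x | bary x i = 0].
Proof.
apply/seteqP; split => x /=.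
  move=> H; split => [i|[i _]] /=; first by rewrite ltW.
  by have := H i; rewrite lt0r => /andP[/eqP].
move=> [H N] i; rewrite lt0r H andbT; apply/eqP => b0; apply: N.
by exists i => //=; rewrite mem_enum.
Qed.

(** Elements are open simplices while facets are parametrised by the closed unit simplex; both kinds
    of integral have to refer to the same reference domain. *)
Lemma Rintegral_osimplex n (h : 'rV[R]_n -> R) : pfun h ->
  \int[mu n]_(y in @row_of_tuple R n @^-1` @osimplex R n) h (row_of_tuple y) =
  \int[mu n]_(y in @unit_simplex R n) h (row_of_tuple y).
Proof.
move=> ph; rewrite unit_simplexE osimplexE /Rintegral; congr fine.
have [mN N0] : measurable (@row_of_tuple R n @^-1`
      \bigcup_(i in [set` enum 'I_n.+1]) [set x | bary x i = 0]) /\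
    mu n (@row_of_tuple R n @^-1`
      \bigcup_(i in [set` enum 'I_n.+1]) [set x | bary x i = 0]) = 0%E.
  rewrite bigcup_seq; elim: (enum _) => [|i r [mr IH]].
    by rewrite big_nil preimage_set0.
  have mi : measurable (@row_of_tuple R n @^-1` [set x | bary x i = 0]).
    by apply: measurable_pfun_eq0; exact: pfun_bary.
  rewrite big_cons preimage_setU; split; first exact: measurableU.
  by apply: null_set_setU => //; exact: bary_null.
apply/esym/negligible_integral => //.
- exact: measurable_csimplex.
- by apply: integrable_pfun_simplex => //; rewrite ?unit_simplexE //; exact: measurable_csimplex.
Qed.

Lemma fubini_row n (g : 'rV[R]_(1 + n) -> \bar R) : mrow g ->
  (mu n.+1).-integrable setT (fun y => g (row_of_tuple y)) ->
  (\int[mu n.+1]_y g (row_of_tuple y) =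
   \int[mu n]_y \int[leb]_x g (row_mx x%:M (row_of_tuple y)))%E.
Proof.
move=> mg /integrableP[_ ig].
have mgc : measurable_fun setT (fun z : RR * n.-tuple RR =>
    g (row_of_tuple (cons_pair z))).
  by apply: (measurableT_comp mg); exact: measurable_cons_pair.
have igc : (leb \x mu n)%E.-integrable setT (fun z : RR * n.-tuple RR =>
    g (row_of_tuple (cons_pair z))).
  apply/integrableP; split => //; move: ig.
  rewrite /= (ge0_integral_pushforward (@measurable_cons_pair R n)) //.
  exact: measurableT_comp.
rewrite /= (integral_pushforward (@measurable_cons_pair R n)) //.
rewrite preimage_setT /comp -(fubini2 igc).
by apply: eq_integral => y _; apply: eq_integral => x _; rewrite row_of_tuple_cons.
Qed.

Lemma pfun_FTC d (G : 'rV[R]_d -> R) (p v : 'rV[R]_d) (s : R) : pfun G -> 0 <= s ->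
  (\int[leb]_(x in `[0%R, s]) ('D_v G (p + x *: v)%R)%:E =
   (G (p + s *: v) - G p)%:E)%E.
Proof.
(* The degenerate interval, which occurs for slices over the face opposite to the origin, is set
   apart because the fundamental theorem is applied on a nontrivial interval. *)
move=> pG; rewrite le_eqVlt => /orP[/eqP <-|s0].
  by rewrite set_itv1 integral_set1 scale0r addr0 subrr.
have cl (H : 'rV[R]_d -> R) : pfun H -> continuous (fun x : R => H (p + x *: v)).
  move=> pH x; apply/differentiable_continuous/derivable1_diffP.
  by have [] := is_derive_line p v x pH.
have := @continuous_FTC2 R (fun x => 'D_v G (p + x *: v)) (fun x => G (p + x *: v)) 0 s s0.
rewrite scale0r addr0 -EFinB; apply.
- apply: continuous_subspaceT; exact: (cl _ (pfun_derive v pG)).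
- split.
  + by move=> x _; have [] := is_derive_line p v x pG.
  + have := cl _ pG 0; exact: cvg_at_right_filter.
  + have := cl _ pG s; exact: cvg_at_left_filter.
- by move=> x _; rewrite derive1E; have [_ ->] := is_derive_line p v x pG.
Qed.

(** Over a point [y] the first coordinate runs from 0, on the face where that coordinate vanishes,
    up to the face where the barycentric coordinate of the origin vanishes. *)
Lemma simplex_FTC n (G : 'rV[R]_(1 + n) -> R) : pfun G ->
  \int[mu n.+1]_(y in @unit_simplex R n.+1) 'D_(row_mx 1%:M 0) G (row_of_tuple y) =
  \int[mu n]_(y in @unit_simplex R n)
    (G (row_mx (1 - \sum_j row_of_tuple y 0 j)%:M (row_of_tuple y)) -
     G (row_mx 0%:M (row_of_tuple y))).
Proof.
move=> pG; rewrite /Rintegral; congr fine.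
pose D := 'D_(row_mx 1%:M 0) G.
have pD : pfun D by exact: pfun_derive.
pose g : 'rV[R]_(1 + n) -> \bar R := (EFin \o D) \_ (@csimplex R n.+1).
rewrite integral_mkcond.
have gE (y : n.+1.-tuple RR) : ((fun y => (D (row_of_tuple y))%:E) \_ (@unit_simplex R n.+1)) y =
    g (row_of_tuple y).
  by rewrite /g !patchE unit_simplexE.
rewrite (eq_integral (fun y => g (row_of_tuple y))); last by move=> y _; rewrite -gE.
have ig : (mu n.+1).-integrable setT (fun y => g (row_of_tuple y)).
  rewrite (_ : (fun _ => _) = ((fun y => (D (row_of_tuple y))%:E) \_ (@unit_simplex R n.+1))).
    apply/(integrable_mkcond _ _).1; first exact: measurable_unit_simplex.
    by apply: integrable_pfun_simplex => //; exact: measurable_unit_simplex.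
  by apply/funext => y; rewrite gE.
rewrite (fubini_row _ ig); last by case/integrableP: ig.
rewrite [RHS]integral_mkcond; apply: eq_integral => y _.
rewrite patchE unit_simplexE.
have rowE (x : R) : row_mx x%:M (row_of_tuple y) =
    row_mx 0 (row_of_tuple y) + x *: row_mx 1%:M 0 :> 'rV[R]_(1 + n).
  by rewrite scale_row_mx scaler0 add_row_mx add0r addr0 scale_scalar_mx mulr1.
case: ifPn => [|yS].
  rewrite inE /= => yS.
  have s0 : 0 <= 1 - \sum_j row_of_tuple y 0 j by rewrite -bary0; exact: yS.
  rewrite !rowE scale0r addr0 -pfun_FTC // [RHS]integral_mkcond.
  apply: eq_integral => x _; rewrite /g !patchE /= -rowE.
  suff -> : (row_mx x%:M (row_of_tuple y) \in @csimplex R n.+1) =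
      (x \in [set` `[0, 1 - \sum_j row_of_tuple y 0 j]]) by [].
  apply/idP/idP; rewrite !inE /= in_itv /=.
    by move=> /csimplex_row_mx[].
  by move=> H; apply/csimplex_row_mx.
apply: integral0_eq => x _; rewrite /g patchE ifF //.
apply/negbTE; apply: contra yS; rewrite !inE /=.
by move=> /csimplex_row_mx[].
Qed.

End reference_simplex.

(** * The divergence theorem on a simplex *)

Lemma pfun_derive_affine (R : realType) m d (g : 'rV[R]_d -> R) (E : 'M[R]_(m, d))
    (p : 'rV[R]_d) (v y : 'rV[R]_m) :
  'D_v (fun y => g (p + y *m E)) y = 'D_(v *m E) g (p + y *m E).
Proof.
rewrite /derive.
rewrite (_ : (fun h : R => h^-1 *: (g (p + (h *: v + y) *m E) - g (p + y *m E))) =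
  (fun h : R => h^-1 *: (g (h *: (v *m E) + (p + y *m E)) - g (p + y *m E)))) //.
by apply/funext => h; rewrite mulmxDl -scalemxAl addrCA.
Qed.

Lemma Rintegral_sum (disp : measure_display) (U : measurableType disp) (R : realType)
    (mu : {measure set U -> \bar R}) (D : set U) I (r : seq I) (P : pred I)
    (f : I -> U -> R) : measurable D ->
  (forall i, P i -> mu.-integrable D (EFin \o f i)) ->
  mu.-integrable D (EFin \o (fun x => \sum_(i <- r | P i) f i x)) /\
  \int[mu]_(x in D) (\sum_(i <- r | P i) f i x) =
  \sum_(i <- r | P i) \int[mu]_(x in D) f i x.
Proof.
move=> mD fi; elim: r => [|i r [IHi IH]].
  rewrite big_nil (_ : (fun _ => _) = cst 0); last first.
    by apply/funext => x; rewrite big_nil.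
  split; first by rewrite (_ : _ \o _ = cst 0%E) //; exact: integrable0.
  by rewrite Rintegral_cst // mul0r.
rewrite big_cons; case: ifPn => Pi; last first.
  by rewrite (_ : (fun _ => _) = (fun x => \sum_(i <- r | P i) f i x)) //;
    apply/funext => x; rewrite big_cons (negPf Pi).
rewrite (_ : (fun _ => _) = (fun x => f i x + \sum_(i <- r | P i) f i x)); last first.
  by apply/funext => x; rewrite big_cons Pi.
split; last by rewrite RintegralD // ?IH //; exact: fi.
rewrite (_ : _ \o _ = (EFin \o f i) \+ (EFin \o (fun x => (\sum_(i <- r | P i) f i x)%R)))%E //.
by apply: integrableD => //; exact: fi.
Qed.

(** * The Euclidean inner product *)

Section dot_product.
Context (R : realType) (d : nat).
Local Notation E := 'rV[R]_d.

Lemma dotC (a b : E) : dot a b = dot b a.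
Proof. by apply: eq_bigr => i _; rewrite mulrC. Qed.

Lemma dotDr (a b c : E) : dot a (b + c) = dot a b + dot a c.
Proof. by rewrite -big_split /=; apply: eq_bigr => i _; rewrite mxE mulrDr. Qed.

Lemma dotZr (a b : E) k : dot a (k *: b) = k * dot a b.
Proof. by rewrite mulr_sumr; apply: eq_bigr => i _; rewrite mxE mulrCA. Qed.

Lemma dotNr (a b : E) : dot a (- b) = - dot a b.
Proof. by rewrite -scaleN1r dotZr mulN1r. Qed.

Lemma dotBr (a b c : E) : dot a (b - c) = dot a b - dot a c.
Proof. by rewrite dotDr dotNr. Qed.

Lemma dot0r (a : E) : dot a 0 = 0.
Proof. by rewrite -(scale0r (0 : E)) dotZr mul0r. Qed.

Lemma dot_sumr I (r : seq I) (P : pred I) (a : E) (f : I -> E) :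
  dot a (\sum_(i <- r | P i) f i) = \sum_(i <- r | P i) dot a (f i).
Proof.
elim: r => [|i r IH]; first by rewrite !big_nil dot0r.
by rewrite !big_cons; case: ifP => // _; rewrite dotDr IH.
Qed.

Lemma dot_mulmx (a b : E) : dot a b = (a *m b^T) 0 0.
Proof. by rewrite mxE; apply: eq_bigr => i _; rewrite mxE. Qed.

Lemma dot_ge0 (a : E) : 0 <= dot a a.
Proof. by apply: sumr_ge0 => i _; rewrite -expr2 sqr_ge0. Qed.

Lemma enorm_sqr (a : E) : enorm a ^+ 2 = dot a a.
Proof. by rewrite sqr_sqrtr // dot_ge0. Qed.

Lemma dot_eq0 (a : E) : dot a a = 0 -> a = 0.
Proof.
move=> /eqP; rewrite psumr_eq0 => [|i _]; last by rewrite -expr2 sqr_ge0.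
move=> /allP a0; apply/rowP => i; rewrite mxE; apply/eqP.
by have := a0 i (mem_index_enum i); rewrite mulf_eq0 orbb.
Qed.

End dot_product.

Lemma row_col_mx0 (R : Type) m q (A : 'rV[R]_q) (B : 'M[R]_(m, q)) :
  row (ord0 : 'I_m.+1) (col_mx A B : 'M[R]_(1 + m, q)) = A.
Proof.
rewrite -[RHS](row_id 0) -[RHS](rowKu 0 A B); congr row; exact: val_inj.
Qed.

Lemma row_col_mx_lift (R : Type) m q (A : 'rV[R]_q) (B : 'M[R]_(m, q)) j :
  row (lift (ord0 : 'I_m.+1) j) (col_mx A B : 'M[R]_(1 + m, q)) = row j B.
Proof. by rewrite -(rowKd j A B); congr row; exact: val_inj. Qed.

(** * Simplices of the mesh and enumerations of their vertices *)

Section mesh_geometry.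
Context (R : realType) (d : nat) (T : mesh R d).
Local Notation E := 'rV[R]_d.
Local Notation vset := {set 'I_(nvert T)}.

Definition pts n (t : n.-tuple 'I_(nvert T)) (i : 'I_n) : E := vtx T (tnth t i).

Lemma pts_cons n k (t : n.-tuple 'I_(nvert T)) (i : 'I_n) :
  pts [tuple of k :: t] (lift ord0 i) = pts t i.
Proof. by rewrite /pts tnthS. Qed.

Lemma perm_pts n (t t' : n.-tuple 'I_(nvert T)) : perm_eq t t' ->
  exists p : 'S_n, pts t = pts t' \o p.
Proof.
move=> /tuple_permP [p tE]; exists p; apply/funext => i; congr (vtx T _).
by rewrite (tnth_nth (tnth t i)) tE -tnth_nth tnth_mktuple.
Qed.

Lemma card_enum_tuple n (F : vset) : #|F| = n ->
  exists t : n.-tuple 'I_(nvert T), tval t = enum F.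
Proof. by move=> /eqP Fn; rewrite cardE in Fn; exists (Tuple Fn). Qed.

Lemma facet_vertexE n (t : n.-tuple 'I_(nvert T)) (F : vset) (i : 'I_n) :
  tval t = enum F -> facet_vertex F i = pts t i.
Proof.
move=> tF; rewrite /facet_vertex /pts -tF (nth_map (tnth t i)) ?size_tuple //.
by rewrite -tnth_nth.
Qed.

Lemma sum_weights n (t : n.-tuple 'I_(nvert T)) (V : zmodType) (f : 'I_(nvert T) -> V) :
  uniq t -> (forall k, k \notin t -> f k = 0) ->
  \sum_k f k = \sum_i f (tnth t i).
Proof.
move=> ut f0; rewrite (bigID (mem t)) /= [X in _ + X]big1 ?addr0; last by move=> k /f0.
by rewrite -(big_uniq _ ut) big_tuple.
Qed.

Lemma weightsP n (t : n.-tuple 'I_(nvert T)) (c : 'I_n -> R) : uniq t ->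
  exists w : 'I_(nvert T) -> R,
    (forall i, w (tnth t i) = c i) /\ (forall k, k \notin t -> w k = 0).
Proof.
move=> ut; exists (fun k => \sum_(i | tnth t i == k) c i); split => [i|k kt].
  rewrite (bigD1 i) //= big1 ?addr0 // => j /andP[/eqP ij /eqP[]].
  by move/tuple_uniqP : ut; apply.
by rewrite big1 // => i /eqP ik; move: kt; rewrite -ik mem_tnth.
Qed.

Lemma sum_lift_bary n (c : 'I_n.+1 -> R) : \sum_i c i = 1 ->
  bary (\row_j c (lift ord0 j)) = c.
Proof.
rewrite big_ord_recl => c1; apply/funext => i; case: (unliftP ord0 i) => [j|] ->.
  by rewrite bary_lift mxE.
rewrite bary0 -c1; under [X in _ - X]eq_bigr do rewrite mxE.
by rewrite addrK.
Qed.

Section enumeration.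
Context n (t : n.+1.-tuple 'I_(nvert T)) (K : vset).
Context (ut : uniq t) (tK : t =i K).

Lemma hullP x : hull K x <-> exists2 y, @csimplex R n y & x = simplex_map (pts t) y.
Proof.
split=> [[w [w0 wK w1 ->]]|[y y0 ->]].
  have wt k : k \notin t -> w k = 0 by rewrite tK; exact: wK.
  have s1 : \sum_i w (tnth t i) = 1 by rewrite -w1 [RHS](sum_weights ut).
  exists (\row_j w (tnth t (lift ord0 j))).
    by move=> i; rewrite (sum_lift_bary s1).
  rewrite simplex_mapE (sum_lift_bary s1) (sum_weights ut) // => k kt.
  by rewrite wt // scale0r.
have [w [wi w0]] := weightsP (bary y) ut.
exists w; split.
- move=> k; case: (boolP (k \in t)) => [/tnthP[i ->]|/w0 ->] //.
  by rewrite wi; exact: y0.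
- by move=> k; rewrite -tK; exact: w0.
- by rewrite (sum_weights ut) //; under eq_bigr do rewrite wi; rewrite sum_bary.
- rewrite simplex_mapE [RHS](sum_weights ut) => [|k /w0 ->]; last by rewrite scale0r.
  by apply: eq_bigr => i _; rewrite wi.
Qed.

Lemma open_simplexP x :
  open_simplex K x <-> exists2 y, @osimplex R n y & x = simplex_map (pts t) y.
Proof.
split=> [[w [w0 wK w1 ->]]|[y y0 ->]].
  have wt k : k \notin t -> w k = 0 by rewrite tK; exact: wK.
  have s1 : \sum_i w (tnth t i) = 1 by rewrite -w1 [RHS](sum_weights ut).
  exists (\row_j w (tnth t (lift ord0 j))).
    by move=> i; rewrite (sum_lift_bary s1); apply: w0; rewrite -tK mem_tnth.
  rewrite simplex_mapE (sum_lift_bary s1) (sum_weights ut) // => k kt.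
  by rewrite wt // scale0r.
have [w [wi w0]] := weightsP (bary y) ut.
exists w; split.
- by move=> k; rewrite -tK => /tnthP[i ->]; rewrite wi; exact: y0.
- by move=> k; rewrite -tK; exact: w0.
- by rewrite (sum_weights ut) //; under eq_bigr do rewrite wi; rewrite sum_bary.
- rewrite simplex_mapE [RHS](sum_weights ut) => [|k /w0 ->]; last by rewrite scale0r.
  by apply: eq_bigr => i _; rewrite wi.
Qed.

(** Giving the base vertex the coefficient [- \sum_j v 0 j] makes the weights sum to zero, which
    turns a linear dependence of the edges into an affine dependence of the vertices. *)
Lemma edges_inj (v : 'rV[R]_n) : affinely_independent K -> v *m edges (pts t) = 0 -> v = 0.
Proof.
move=> aK v0.
pose c (i : 'I_n.+1) := if unlift ord0 i is Some j then v 0 j else - \sum_j v 0 j.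
have c0 : c ord0 = - \sum_j v 0 j by rewrite /c unlift_none.
have cl j : c (lift ord0 j) = v 0 j by rewrite /c liftK.
have [w [wi w0]] := weightsP c ut.
have wz : forall k, w k = 0.
  apply: aK.
  - by move=> k; rewrite -tK; exact: w0.
  - rewrite (sum_weights ut) //; under eq_bigr do rewrite wi.
    by rewrite big_ord_recl c0; under [X in _ + X]eq_bigr do rewrite cl; rewrite addNr.
  - rewrite (sum_weights ut) => [|k /w0 ->]; last by rewrite scale0r.
    under eq_bigr do rewrite wi.
    rewrite -[RHS]v0 mulmx_sum_row big_ord_recl c0 scaleNr scaler_suml -sumrN -big_split /=.
    by apply: eq_bigr => j _; rewrite cl rowK scalerBr addrC.
by apply/rowP => j; rewrite mxE -cl -wi wz.
Qed.

End enumeration.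

Lemma enumeration_perm n (t t' : n.-tuple 'I_(nvert T)) :
  uniq t -> t =i t' -> perm_eq t t'.
Proof.
move=> ut tt; rewrite uniq_perm //.
by rewrite -(eq_uniq _ tt) // !size_tuple.
Qed.

End mesh_geometry.

(** * Volumes, heights and the divergence theorem on one element *)

Section simplex_geometry.
Context (R : realType) (m : nat) (T : mesh R m.+1).
Local Notation E := 'rV[R]_m.+1.
Local Notation vset := {set 'I_(nvert T)}.

(** [fint] takes the vertices in the order of [enum F]; the Gram determinant and the parametrised
    integral are both invariant under reordering, so any enumeration will do. *)
Lemma fint_simplex (t : m.+1.-tuple 'I_(nvert T)) (F : vset) (g : E -> R) :
  uniq t -> t =i F -> pfun g ->
  fint setT F g = Num.sqrt (\det (edges (pts t) *m (edges (pts t))^T)) *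
                  simplex_int (pts t) g.
Proof.
move=> ut tF pg.
have [t' t'F] : exists t' : m.+1.-tuple 'I_(nvert T), tval t' = enum F.
  by apply: card_enum_tuple; rewrite -(eq_card tF) (card_uniqP ut) size_tuple.
have /(enumeration_perm ut) /perm_pts [p ->] : t =i t'.
  by move=> k; rewrite tF (_ : (k \in t') = (k \in tval t')) // t'F mem_enum.
rewrite det_gram_perm simplex_int_perm // /fint.
have eF : facet_edges F = edges (pts t').
  by apply/row_matrixP => i; rewrite !rowK -!(facet_vertexE _ t'F).
rewrite eF /= preimage_setT setIT; congr (_ * _).
apply: eq_Rintegral => y _.
by rewrite /facet_map eF /simplex_map -(facet_vertexE ord0 t'F).
Qed.

Section one_simplex.
Context (K : vset).
Context (cK : #|K| = m.+2) (aK : affinely_independent K).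

Lemma edges_unit (t : m.+2.-tuple 'I_(nvert T)) :
  uniq t -> t =i K -> edges (pts t) \in unitmx.
Proof.
move=> ut tK; rewrite -row_free_unit; apply: inj_row_free => v.
exact: (edges_inj ut tK).
Qed.

Lemma preimage_open_simplex (t : m.+2.-tuple 'I_(nvert T)) : uniq t -> t =i K ->
  open_simplex K = [set x | @osimplex R m.+1 ((x - pts t ord0) *m invmx (edges (pts t)))].
Proof.
move=> ut tK; have uE := edges_unit ut tK; apply/seteqP; split => x /=.
  move=> /(open_simplexP ut tK)[y oy ->].
  by rewrite /simplex_map addrC addKr mulmxK.
move=> ox; apply/(open_simplexP ut tK); eexists; first exact: ox.
by rewrite /simplex_map mulmxKV // addrC subrK.
Qed.

Lemma measurable_open_simplex : measurable (@row_of_tuple R m.+1 @^-1` open_simplex K).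
Proof.
have [t tK] := card_enum_tuple cK.
have ut : uniq t by rewrite tK enum_uniq.
have tK' : t =i K by move=> k; rewrite (_ : (k \in t) = (k \in tval t)) // tK mem_enum.
rewrite (preimage_open_simplex ut tK').
apply: (measurable_forall_lt (f := fun i y => bary
   ((row_of_tuple y - pts t ord0) *m invmx (edges (pts t))) i)) => i.
have pf : pfun (fun x : E => bary (x *m invmx (edges (pts t)) +
    - pts t ord0 *m invmx (edges (pts t))) i).
  exact: (pfun_affine _ _ (pfun_bary R i)).
have := measurable_pfun pf; apply: eq_measurable_fun => y _.
by rewrite mulmxBl mulNmx.
Qed.

Lemma vint_simplex (t : m.+2.-tuple 'I_(nvert T)) (h : E -> R) :
  uniq t -> t =i K -> pfun h ->
  vint (open_simplex K) h = `|\det (edges (pts t))| * simplex_int (pts t) h.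
Proof.
move=> ut tK ph; rewrite /vint (Rintegral_affine (pts t ord0) (edges_unit ut tK)) //.
- congr (_ * _); rewrite /simplex_int.
  have sE x : x *m edges (pts t) + pts t ord0 = simplex_map (pts t) x by rewrite addrC.
  rewrite -[RHS](Rintegral_osimplex (pfun_simplex_map (pts t) ph)).
  rewrite (_ : (fun x => x *m _ + _) @^-1` _ = @osimplex R m.+1).
    by apply: eq_Rintegral => y _; rewrite sE.
  rewrite (preimage_open_simplex ut tK); apply/seteqP.
  by split => x /=; rewrite addrK mulmxK // edges_unit.
- exact: measurable_pfun.
- exact: measurable_open_simplex.
Qed.

Lemma open_simplex_fin :
  (lebesgue_tuple R m.+1 (@row_of_tuple R m.+1 @^-1` open_simplex K) < +oo)%E.
Proof.
have [t tK] := card_enum_tuple cK.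
have ut : uniq t by rewrite tK enum_uniq.
have tK' : t =i K by move=> k; rewrite (_ : (k \in t) = (k \in tval t)) // tK mem_enum.
rewrite -integral_indic_row; last exact: measurable_open_simplex.
rewrite (@integral_affine R m.+1 _ (pts t ord0) (fun x => (\1_(open_simplex K) x)%:E)
  (edges_unit ut tK')) //; last first.
  by apply: mrow_indic; exact: measurable_open_simplex.
under eq_integral => y _.
  rewrite (@eq_indic R _ _ _ (@osimplex R m.+1) _ (row_of_tuple y)); first over.
  by rewrite (preimage_open_simplex ut tK') /= addrK mulmxK // edges_unit.
rewrite integral_indic_row; last exact: measurable_osimplex.
rewrite lte_mul_pinfty ?ltry //.
apply: le_lt_trans (unit_simplex_fin R m.+1); apply: le_measure; rewrite ?inE.
- exact: measurable_osimplex.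
- exact: measurable_unit_simplex.
- by rewrite unit_simplexE => y /= oy i; apply/ltW.
Qed.

Lemma open_simplex_bounded : exists C : R, forall x i, hull K x -> `|x 0 i| <= C.
Proof.
exists (\sum_k \sum_i `|vtx T k 0 i|) => x i [w [w0 wK w1 ->]].
rewrite summxE (le_trans (ler_norm_sum _ _ _)) // ler_sum // => k _.
rewrite mxE normrM (bigD1 i) //= -[X in X <= _]addr0 lerD ?sumr_ge0 //.
rewrite ler_piMl // ger0_norm // -w1 (bigD1 k) //= lerDl sumr_ge0 //.
Qed.

Lemma open_simplex_hull : open_simplex K `<=` hull K.
Proof.
move=> x [w [w0 wK w1 ->]]; exists w; split => // k.
by have [/w0/ltW|/wK ->] := boolP (k \in K).
Qed.

Lemma bounded_pfun_hull (h : E -> R) : pfun h ->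
  exists M, forall x, hull K x -> `|h x| <= M.
Proof.
move=> ph; have [C HC] := open_simplex_bounded; have [M HM] := bounded_pfun C ph.
by exists M => x Kx; apply: HM => i; exact: HC.
Qed.

Lemma vintegrable_pfun (h : E -> R) : pfun h -> vintegrable (open_simplex K) h.
Proof.
move=> ph; apply: measurable_bounded_integrable.
- exact: measurable_open_simplex.
- exact: open_simplex_fin.
- apply: measurable_funTS; exact: measurable_pfun.
- have [M HM] := bounded_pfun_hull ph.
  exists M; split; first by rewrite num_real.
  move=> N MN y Dy; apply/ltW; rewrite (le_lt_trans _ MN) //; apply: HM.
  exact: open_simplex_hull.
Qed.

Lemma vintD (f g : E -> R) :
  vintegrable (open_simplex K) f -> vintegrable (open_simplex K) g ->
  vint (open_simplex K) (fun x => f x + g x) =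
  vint (open_simplex K) f + vint (open_simplex K) g.
Proof. by move=> vf vg; apply: RintegralD => //; exact: measurable_open_simplex. Qed.

Lemma vintZ (c : R) (f : E -> R) : vintegrable (open_simplex K) f ->
  vint (open_simplex K) (fun x => c * f x) = c * vint (open_simplex K) f.
Proof. by move=> vf; apply: RintegralZl => //; exact: measurable_open_simplex. Qed.

Lemma vtx_hull (S : vset) k : k \in S -> hull S (vtx T k).
Proof.
move=> kS; exists (fun i => (i == k)%:R); split.
- by move=> i; rewrite ler0n.
- by move=> i iS; rewrite (negPf (contraNneq _ iS)) // => ->.
- by rewrite (bigD1 k) //= eqxx big1 ?addr0 // => i /negPf ->.
- rewrite (bigD1 k) //= eqxx scale1r big1 ?addr0 // => i /negPf ->.
  by rewrite scale0r.
Qed.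

(** The normal is tested at the barycentre of [K]: seen from [a], every vertex other than [b] is
    tangential to the facet, so [b] alone decides the sign. *)
Lemma facet_normal_gt0 (a b : 'I_(nvert T)) (n : E) : b \in K -> a \in K :\ b ->
  outward_unit_normal K (K :\ b) n -> 0 < dot n (vtx T a - vtx T b).
Proof.
move=> bK aF [_ nF nK].
pose c : R := (m.+2%:R)^-1.
have c0 : 0 < c by rewrite invr_gt0 ltr0n.
have oK : open_simplex K (\sum_k (if k \in K then c else 0) *: vtx T k).
  exists (fun k => if k \in K then c else 0); split => //.
  - by move=> i ->.
  - by move=> i /negPf ->.
  - by rewrite -big_mkcond /= sumr_const cK -[c *+ _]mulr_natr mulVf // pnatr_eq0.
have := nK _ _ oK (vtx_hull aF).
have -> : \sum_k (if k \in K then c else 0) *: vtx T k - vtx T a =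
    \sum_(k in K) c *: (vtx T k - vtx T a).
  rewrite [in RHS]big_mkcond -[X in _ - X]scale1r.
  have -> : 1 = \sum_k (if k \in K then c else 0).
    by rewrite -big_mkcond /= sumr_const cK -[c *+ _]mulr_natr mulVf // pnatr_eq0.
  rewrite scaler_suml -sumrB; apply: eq_bigr => k _.
  by case: ifP => _; rewrite ?scale0r ?subrr // scalerBr.
rewrite dot_sumr (bigD1 b) //= big1 => [|k /andP[kK kb]].
  by rewrite addr0 dotZr pmulr_rlt0 // -opprB dotNr oppr_lt0.
by rewrite dotZr (nF _ _ (vtx_hull _) (vtx_hull aF)) ?mulr0 // !inE kb.
Qed.

(* The tangential part of [va - vb] does not contribute to the determinant. *)
Lemma facet_height (a b : 'I_(nvert T)) (n : E) (t : m.+2.-tuple 'I_(nvert T))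
    (t' : m.+1.-tuple 'I_(nvert T)) :
  uniq t -> t =i K -> uniq t' -> t' =i K :\ b -> b \in K -> a \in K :\ b ->
  outward_unit_normal K (K :\ b) n ->
  `|\det (edges (pts t))| = dot n (vtx T a - vtx T b) *
     Num.sqrt (\det (edges (pts t') *m (edges (pts t'))^T)).
Proof.
move=> ut tK ut' t'F bK aF nn.
have h0 := facet_normal_gt0 bK aF nn.
have [n1 nF _] := nn.
have tbK : [tuple of b :: t'] =i K.
  move=> k; rewrite inE; have := t'F k; rewrite !inE => ->.
  by case: eqVneq => [->|].
have utb : uniq [tuple of b :: t'].
  by rewrite /= ut' andbT; have := t'F b; rewrite !inE eqxx /= => ->.
have /(enumeration_perm ut) /perm_pts [p ->] : t =i [tuple of b :: t'].
  by move=> k; rewrite tK tbK.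
rewrite norm_det_edges_perm.
pose Fe := edges (pts t'); pose v0 := pts t' ord0; pose r := v0 - vtx T b.
have v0F : hull (K :\ b) v0 by apply: vtx_hull; rewrite -t'F mem_tnth.
have hE : dot n (vtx T a - vtx T b) = dot n r.
  by have := nF _ _ (vtx_hull aF) v0F; rewrite /r !dotBr => ?; lra.
have FeN i : dot n (row i Fe) = 0.
  by rewrite rowK; apply: nF => //; apply: vtx_hull; rewrite -t'F mem_tnth.
pose cM (x : E) : 'M[R]_(1 + m) := col_mx x Fe.
(* Measured from [b], each edge after the first is [r] plus an edge of the facet; a shear of
   determinant one removes the added [r]. *)
have EE : edges (pts [tuple of b :: t']) =
    (block_mx 1%:M 0 (const_mx 1) 1%:M : 'M[R]_(1 + m)) *m cM r.
  rewrite /cM mul_block_col !mul1mx mul0mx addr0.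
  apply/row_matrixP => i; rewrite rowK.
  have -> : pts [tuple of b :: t'] ord0 = vtx T b by [].
  have -> : pts [tuple of b :: t'] (lift ord0 i) = pts t' i.
    by rewrite /pts tnthS.
  case: (unliftP ord0 i) => [j|] ->; last by rewrite row_col_mx0.
  rewrite row_col_mx_lift linearD /= row_mul rowK.
  rewrite (_ : row j (const_mx 1) = 1%:M); last by apply/matrixP => x y; rewrite !mxE !ord1 eqxx.
  by rewrite mul1mx /r [RHS]addrC [RHS]addrA subrK.
have -> : \det (edges (pts [tuple of b :: t'])) = \det (cM r).
  have dL : \det (block_mx 1%:M 0 (const_mx 1) 1%:M : 'M[R]_(1 + m)) = 1.
    by rewrite det_lblock !det1 mul1r.
  by rewrite EE det_mulmx [X in X * _]dL mul1r.
have n0 : n != 0.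
  by apply/eqP => n0; move: h0; rewrite n0 dotC dot0r ltxx.
have nn1 : dot n n = 1 by rewrite -enorm_sqr n1 expr1n.
have Z0 : \det (cM (r - dot n r *: n)) = 0.
  apply/eqP; rewrite -[_ == 0]negbK -unitfE -unitmxE; apply/negP => uZ.
  have Zn : cM (r - dot n r *: n) *m n^T = 0.
    rewrite /cM mul_col_mx (_ : _ *m n^T = 0); last first.
      apply/matrixP => x y; rewrite !ord1 -dot_mulmx dotC dotBr dotZr nn1 mulr1.
      by rewrite subrr mxE.
    rewrite (_ : Fe *m n^T = 0) ?col_mx0 //.
    apply/row_matrixP => i; rewrite row_mul row0; apply/matrixP => x y.
    by rewrite !ord1 -dot_mulmx dotC FeN mxE.
  move: n0; rewrite -(trmxK n) -(mulKmx uZ n^T) Zn mulmx0 trmx0.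
  by rewrite eqxx.
have row'cM x : row' 0 (cM x) = col_mx 0 Fe :> 'M[R]_(0 + m, m.+1).
  rewrite (_ : 0 = lshift m 0 :> 'I_(1 + m)); last exact: val_inj.
  by rewrite (row'Ku 0 x Fe); congr col_mx; apply/matrixP => -[].
have -> : \det (cM r) = dot n r * \det (cM n) + 1 * \det (cM (r - dot n r *: n)).
  apply: (@determinant_multilinear _ _ _ _ _ 0).
  - by rewrite /cM !row_col_mx0 scale1r subrKC.
  - by rewrite row'cM row'cM.
  - by rewrite row'cM row'cM.
rewrite Z0 mulr0 addr0 normrM hE ger0_norm; last by rewrite -hE ltW.
congr (_ * _); rewrite -sqrtr_sqr; congr Num.sqrt.
(* The rows are a unit vector and vectors orthogonal to it, so the Gram matrix is block diagonal,
   with blocks 1 and the Gram matrix of the facet. *)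
rewrite expr2 -[X in _ * X]det_tr -det_mulmx /cM tr_col_mx mul_col_row.
have -> : n *m n^T = 1%:M.
  by apply/matrixP => x y; rewrite !ord1 -dot_mulmx nn1 mxE eqxx.
have FeN' : Fe *m n^T = 0.
  apply/row_matrixP => i; rewrite row_mul row0; apply/matrixP => x y.
  by rewrite !ord1 -dot_mulmx dotC FeN mxE.
by rewrite FeN' det_ublock det1 mul1r.
Qed.

(** Enumerating [b] and [a] first makes the edge between them the first coordinate direction of the
    reference simplex. [facet_height] then converts the volume Jacobian into normal component times
    surface element; any other facet contains the whole edge, so its normal is orthogonal to it. *)
Lemma directional_divergence (a b : 'I_(nvert T)) (n : vset -> E) (g : E -> R) :
  (forall F, F \in facets K -> outward_unit_normal K F (n F)) ->
  a \in K -> b \in K -> a != b -> pfun g ->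
  vint (open_simplex K) ('D_(vtx T a - vtx T b) g) =
  \sum_(F in facets K) dot (n F) (vtx T a - vtx T b) * fint setT F g.
Proof.
move=> nF aS bS ab pg.
have [r rE] : exists r : m.-tuple 'I_(nvert T), tval r = enum (K :\ b :\ a).
  apply: card_enum_tuple.
  by have := cK; rewrite (cardsD1 b) bS (cardsD1 a) !inE ab aS !add1n => -[].
have rK k : (k \in tval r) = [&& k != a, k != b & k \in K] by rewrite rE mem_enum !inE.
have ur : uniq r by rewrite rE enum_uniq.
pose t := [tuple of b :: a :: r]; pose t1 := [tuple of a :: r]; pose t0 := [tuple of b :: r].
have ut1 : uniq t1 by rewrite /= ur andbT rK eqxx.
have ut0 : uniq t0 by rewrite /= ur andbT rK eqxx andbF.
have ut : uniq t by rewrite /= ur andbT !inE !rK !eqxx /= andbF orbF eq_sym ab.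
have t1F : t1 =i K :\ b.
  by move=> k; rewrite !inE rK; case: eqVneq => [->|//]; rewrite ab aS.
have t0F : t0 =i K :\ a.
  by move=> k; rewrite !inE rK; case: eqVneq => [->|_ /=]; rewrite ?bS ?andbT // eq_sym ab.
have tK : t =i K.
  move=> k; rewrite !inE rK; case: eqVneq => [->|_ /=]; rewrite ?bS //.
  by case: eqVneq => [->|_ /=]; rewrite ?aS.
rewrite (vint_simplex ut tK) ?pfun_derive //; last exact: pfun_derive.
have -> : simplex_int (pts t) ('D_(vtx T a - vtx T b) g) =
    simplex_int (pts t1) g - simplex_int (pts t0) g.
  rewrite /simplex_int.
  have e0E : row_mx 1%:M 0 = std_vertex R (lift ord0 ord0) :> 'rV[R]_(1 + m).
    apply/rowP => j; rewrite [RHS]mxE (inj_eq lift_inj).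
    case: (unliftP ord0 j) => [k|] ->.
      rewrite (_ : lift ord0 k = rshift 1 k); last exact: val_inj.
      by rewrite row_mxEr mxE.
    rewrite eqxx (_ : ord0 = lshift m ord0 :> 'I_(1 + m)); last exact: val_inj.
    by rewrite row_mxEl mxE eqxx.
  transitivity (\int[lebesgue_tuple R m.+1]_(y in @unit_simplex R m.+1)
      'D_(row_mx 1%:M 0 : 'rV[R]_(1 + m)) (fun y => g (simplex_map (pts t) y)) (row_of_tuple y)).
    apply: eq_Rintegral => y _; rewrite /simplex_map pfun_derive_affine e0E.
    by rewrite std_vertex_edges.
  rewrite simplex_FTC; last exact: pfun_simplex_map.
  have bE := @bary_row_mx R m.
  (* At the upper end of the slice the weight of [b] vanishes, at the lower end that of [a]. *)
  have E1 (y : 'rV[R]_m) : simplex_map (pts t) (row_mx (1 - \sum_j y 0 j)%:M y : 'rV_(1 + m)) =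
      simplex_map (pts t1) y.
    rewrite !simplex_mapE; have [b0 b1 b2] := bE (1 - \sum_j y 0 j) y.
    rewrite !big_ord_recl b0 b1 bary0 subKr subrr scale0r add0r.
    congr (_ *: _ + _).
    by apply: eq_bigr => j _; rewrite b2 bary_lift; congr (_ *: _); exact: pts_cons.
  have E0 (y : 'rV[R]_m) : simplex_map (pts t) (row_mx (0 : R)%:M y : 'rV_(1 + m)) =
      simplex_map (pts t0) y.
    rewrite !simplex_mapE; have [b0 b1 b2] := bE 0 y.
    rewrite !big_ord_recl b0 b1 bary0 subr0 scale0r add0r.
    congr (_ + _); apply: eq_bigr => j _; rewrite b2 bary_lift; congr (_ *: _).
    by rewrite (pts_cons b) (pts_cons b) (pts_cons a).
  rewrite -RintegralB.
  - by apply: eq_Rintegral => y _; rewrite E1 E0.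
  - exact: measurable_unit_simplex.
  - apply: (integrable_pfun_simplex _ _ (pfun_simplex_map (pts t1) pg)) => //.
    exact: measurable_unit_simplex.
  - apply: (integrable_pfun_simplex _ _ (pfun_simplex_map (pts t0) pg)) => //.
    exact: measurable_unit_simplex.
rewrite big_imset /=; last first.
  move=> i j iK jK /setP/(_ i); rewrite !inE eqxx /= iK andbT.
  by case: eqVneq => [->|].
have KF i : i \in K -> outward_unit_normal K (K :\ i) (n (K :\ i)).
  by move=> iK; apply: nF; exact: imset_f.
rewrite (bigD1 b) //= (bigD1 a) ?aS //= big1 ?addr0; last first.
  move=> i /andP[/andP[iK ib] ia]; have [_ nKi _] := KF i iK.
  by rewrite nKi ?mul0r //; apply: vtx_hull; rewrite !inE ?aS ?bS andbT eq_sym.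
rewrite (fint_simplex ut1 t1F pg) (fint_simplex ut0 t0F pg) !mulrA.
have aF : a \in K :\ b by rewrite !inE ab.
have bF : b \in K :\ a by rewrite !inE eq_sym ab.
rewrite -(facet_height ut tK ut1 t1F bS aF (KF b bS)).
rewrite -[X in dot (n (K :\ a)) X]opprB dotNr mulNr.
rewrite -(facet_height ut tK ut0 t0F aS bF (KF a aS)).
by rewrite mulNr mulrBr.
Qed.

Lemma fintegrable_pfun (F : vset) (g : E -> R) : pfun g -> fintegrable setT F g.
Proof.
move=> pg; rewrite /fintegrable preimage_setT setIT.
have pgF : pfun (fun y => g (facet_vertex F 0 + y *m facet_edges F)).
  rewrite (_ : (fun _ => _) = fun y => g (y *m facet_edges F + facet_vertex F 0)).
    exact: pfun_affine.
  by apply/funext => y; rewrite addrC.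
apply: (integrable_pfun_simplex _ _ pgF) => //; exact: measurable_unit_simplex.
Qed.

Lemma fint_sum I (r : seq I) (Q : pred I) (F : vset) (f : I -> E -> R) :
  (forall i, Q i -> fintegrable setT F (f i)) ->
  fint setT F (fun x => \sum_(i <- r | Q i) f i x) =
  \sum_(i <- r | Q i) fint setT F (f i).
Proof.
move=> fi; rewrite /fint -mulr_sumr; congr (_ * _).
have mD : measurable (@unit_simplex R m `&` facet_map F @^-1` setT).
  by rewrite preimage_setT setIT; exact: measurable_unit_simplex.
by have [_ ->] := Rintegral_sum r mD fi.
Qed.

Lemma vint_sum I (r : seq I) (Q : pred I) (f : I -> E -> R) :
  (forall i, Q i -> vintegrable (open_simplex K) (f i)) ->
  vint (open_simplex K) (fun x => \sum_(i <- r | Q i) f i x) =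
  \sum_(i <- r | Q i) vint (open_simplex K) (f i).
Proof. by move=> fi; have [_] := Rintegral_sum r measurable_open_simplex fi. Qed.

Lemma divergence_theorem (n : vset -> E) (f : E -> E) :
  (forall F, F \in facets K -> outward_unit_normal K F (n F)) ->
  (forall i, pfun (fun x => f x 0 i)) ->
  vint (open_simplex K) (divergence f) =
  \sum_(F in facets K) fint setT F (fun x => dot (f x) (n F)).
Proof.
move=> nF pf.
have [t tE] := card_enum_tuple cK.
have ut : uniq t by rewrite tE enum_uniq.
have tK : t =i K by move=> k; rewrite (_ : (k \in t) = (k \in tval t)) // tE mem_enum.
have uE := edges_unit ut tK.
(* The edges issuing from one vertex form a basis, so the identity extends from edges to all
   directions by linearity. *)
have dE (v : E) (g : E -> R) : pfun g ->
    vint (open_simplex K) ('D_v g) =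
    \sum_(F in facets K) dot (n F) v * fint setT F g.
  move=> pg; pose c := v *m invmx (edges (pts t)).
  have vE : v = \sum_j c 0 j *: (pts t (lift ord0 j) - pts t ord0).
    rewrite -[LHS](mulmxKV uE) mulmx_sum_row.
    by apply: eq_bigr => j _; rewrite rowK.
  have -> : 'D_v g = fun x => \sum_j c 0 j * 'D_(pts t (lift ord0 j) - pts t ord0) g x.
    apply/funext => x; rewrite pfun_derive_sum //.
    under [RHS]eq_bigr do rewrite (pfun_derive_sum _ _ pg) mulr_sumr.
    rewrite exchange_big /=; apply: eq_bigr => i _.
    rewrite {1}vE summxE mulr_suml; apply: eq_bigr => j _.
    by rewrite [X in X * _]mxE mulrA.
  rewrite vint_sum => [|j _]; last first.
    by apply: vintegrable_pfun; apply: pfunM; [exact: pfun_cst|exact: pfun_derive].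
  transitivity (\sum_j c 0 j * \sum_(F in facets K)
      dot (n F) (pts t (lift ord0 j) - pts t ord0) * fint setT F g).
    apply: eq_bigr => j _; rewrite vintZ; last by apply: vintegrable_pfun; exact: pfun_derive.
    congr (_ * _); apply: directional_divergence => //; rewrite -?tK ?mem_tnth //.
    by apply/eqP => /(tuple_uniqP _ ut)/eqP; rewrite eq_sym (negPf (neq_lift _ _)).
  under eq_bigr do rewrite mulr_sumr.
  rewrite exchange_big /=; apply: eq_bigr => F _.
  rewrite [in RHS]vE dot_sumr mulr_suml; apply: eq_bigr => j _.
  by rewrite dotZr mulrA.
rewrite /divergence /mxtrace.
under [in LHS]eq_fun do under eq_bigr do rewrite mxE.
rewrite vint_sum => [|i _]; last by apply: vintegrable_pfun; exact: pfun_derive.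
under eq_bigr do rewrite dE //.
rewrite exchange_big /=; apply: eq_bigr => F _.
rewrite fint_sum => [|i _]; last first.
  by apply: fintegrable_pfun; apply: pfunM => //; exact: pfun_cst.
apply: eq_bigr => i _.
rewrite /fint RintegralZr; last 2 first.
- by rewrite preimage_setT setIT; exact: measurable_unit_simplex.
- exact: (fintegrable_pfun F (pf i)).
rewrite [LHS]mulrC -mulrA; congr (_ * (_ * _)).
rewrite /dot (bigD1 i) //= mxE !eqxx mulr1 big1 ?addr0 // => j /negPf ji.
by rewrite mxE eqxx ji mulr0.
Qed.

End one_simplex.
End simplex_geometry.

(** * Adjacent simplices *)

Section adjacent_simplices.
Context (R : realType) (m : nat) (T : mesh R m.+1).
Local Notation E := 'rV[R]_m.+1.
Local Notation vset := {set 'I_(nvert T)}.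

Lemma hull_mono (S S' : vset) : S \subset S' -> hull S `<=` hull S'.
Proof.
move=> /fintype.subsetP SS x [w [w0 wS w1 ->]]; exists w; split => // i iS'.
by apply: wS; apply: contra iS'; exact: SS.
Qed.

(** Both normals are orthogonal to the shared facet, hence equal or opposite. Were they equal, the
    two simplices would lie on the same side of [F] and meet outside [F], against conformity. *)
Lemma opposite_normals (K1 K2 F : vset) (n1 n2 : E) :
  #|K1| = m.+2 -> #|K2| = m.+2 -> affinely_independent K1 ->
  K1 != K2 -> hull K1 `&` hull K2 = hull (K1 :&: K2) ->
  F \in facets K1 -> F \in facets K2 ->
  outward_unit_normal K1 F n1 -> outward_unit_normal K2 F n2 -> n1 = - n2.
Proof.
move=> c1 c2 a1 K12 conf /imsetP[b1 b1K FE1] /imsetP[b2 b2K FE2] N1 N2.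
have b1F : b1 \notin F by rewrite FE1 !inE eqxx.
have b2F : b2 \notin F by rewrite FE2 !inE eqxx.
have K1E : K1 = b1 |: F by rewrite FE1 finset.setD1K.
have K2E : K2 = b2 |: F by rewrite FE2 finset.setD1K.
have b12 : b1 != b2 by apply: contraNneq K12 => b12; rewrite K1E K2E b12.
have IF : K1 :&: K2 = F.
  apply/setP => k; rewrite K1E K2E !inE; case: eqVneq => [->|_ /=].
    by rewrite (negPf b12).
  by case: (k \in F); rewrite ?orbT ?andbF ?andbT.
have cF : #|F| = m.+1 by have := c1; rewrite K1E cardsU1 b1F add1n => -[].
have [t tE] := card_enum_tuple cF.
have ut : uniq t by rewrite tE enum_uniq.
have tF k : (k \in tval t) = (k \in F) by rewrite tE mem_enum.
pose t1 := [tuple of b1 :: t]; pose t2 := [tuple of b2 :: t].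
have ut1 : uniq t1 by rewrite /= ut tF b1F.
have ut2 : uniq t2 by rewrite /= ut tF b2F.
have t1K : t1 =i K1 by move=> k; rewrite K1E !inE tF.
have t2K : t2 =i K2 by move=> k; rewrite K2E !inE tF.
have tH i : hull F (pts t i) by apply: vtx_hull; rewrite -tF mem_tnth.
pose f0 := pts t ord0.
pose a0 := tnth t ord0.
have a0F : a0 \in F by rewrite -tF mem_tnth.
have h1 : 0 < dot n1 (f0 - vtx T b1).
  by apply: (facet_normal_gt0 c1 b1K); rewrite -FE1.
have h2 : 0 < dot n2 (f0 - vtx T b2).
  by apply: (facet_normal_gt0 c2 b2K); rewrite -FE2.
have uE := edges_unit a1 ut1 t1K.
have [e1 o1 _] := N1; have [e2 o2 _] := N2.
(* This scalar makes [n2 - c *: n1] orthogonal to the edges of [K1] issuing from [b1], which form a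
   basis. *)
pose c := dot n2 (f0 - vtx T b1) / dot n1 (f0 - vtx T b1).
have n2E : n2 = c *: n1.
  apply/eqP; rewrite -subr_eq0 -(inj_eq (@trmx_inj _ _ _)) trmx0; apply/eqP.
  rewrite -(mulKmx uE (_^T)) (_ : edges _ *m _ = 0) ?mulmx0 //.
  apply/row_matrixP => i; rewrite row_mul row0 rowK; apply/matrixP => x y.
  rewrite !ord1 -dot_mulmx mxE pts_cons.
  have P1 := o1 _ _ (tH i) (tH ord0); have P2 := o2 _ _ (tH i) (tH ord0).
  have cH : c * dot n1 (f0 - vtx T b1) = dot n2 (f0 - vtx T b1).
    by rewrite /c mulfVK // gt_eqF.
  have cP : c * dot n1 (pts t i) = c * dot n1 f0.
    by apply/eqP; rewrite -subr_eq0 -mulrBr -dotBr P1 mulr0.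
  move: P2 cH; rewrite (_ : pts t1 ord0 = vtx T b1) // !dotBr mulrBr -cP => P2 cH.
  by rewrite dotZr [dot _ n2]dotC [dot _ n1]dotC !dotBr; lra.
have n11 : dot n1 n1 = 1 by rewrite -enorm_sqr e1 expr1n.
have n22 : dot n2 n2 = 1 by rewrite -enorm_sqr e2 expr1n.
have c21 : c ^+ 2 = 1.
  by move: n22; rewrite n2E dotZr dotC dotZr n11 mulr1 expr2.
have [c1'|c1'] : c = 1 \/ c = -1.
- by move/eqP: c21; rewrite sqrf_eq1 => /orP[] /eqP; [left|right].
- exfalso; have n12 : n2 = n1 by rewrite n2E c1' scale1r.
  pose y := (vtx T b2 - vtx T b1) *m invmx (edges (pts t1)).
  have v2 : vtx T b2 = simplex_map (pts t1) y.
    by rewrite /simplex_map mulmxKV // addrC subrK.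
  have v2s : vtx T b2 = bary y ord0 *: vtx T b1 + \sum_i bary y (lift ord0 i) *: pts t i.
    rewrite {1}v2 simplex_mapE big_ord_recl; congr (_ + _).
    by apply: eq_bigr => i _; rewrite pts_cons.
  have s1 := sum_bary y; rewrite big_ord_recl in s1.
  have v2f : vtx T b2 - f0 = bary y ord0 *: (vtx T b1 - f0) +
      \sum_i bary y (lift ord0 i) *: (pts t i - f0).
    rewrite v2s -[X in _ - X]scale1r -s1 scalerDl opprD addrACA -scalerBr.
    by congr (_ + _); rewrite scaler_suml -sumrB; apply: eq_bigr => i _; rewrite scalerBr.
  (* As the normals agree, [b2] lies on the same side of [F] as [b1], so its barycentric coordinate
     at [b1] is positive. *)
  have y0 : 0 < bary y ord0.
    have : dot n1 (vtx T b2 - f0) = bary y ord0 * dot n1 (vtx T b1 - f0).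
      rewrite v2f [in LHS]dotDr [in LHS]dot_sumr big1 ?addr0 ?dotZr // => i _.
      by rewrite dotZr (o1 _ _ (tH i) (tH ord0)) mulr0.
    rewrite -[X in dot _ X = _]opprB -[X in _ * dot _ X]opprB !dotNr mulrN.
    move=> /oppr_inj Hy; have := h2; rewrite n12 Hy.
    by rewrite pmulr_lgt0.
  (* A common point of both simplices off [F]: weight [q^-1] at [b2] and [q^-1 * B] at each vertex
     of [F]. Rewritten in [K1], the weights stay nonnegative because [B] dominates the possibly
     negative coordinates of [b2]; [q] normalises the sum. *)
  pose B := \sum_i `|bary y (lift ord0 i)|.
  have B0 : 0 <= B by exact: sumr_ge0.
  pose q : R := 1 + m.+1%:R * B.
  have q0 : 0 < q by rewrite ltr_wpDr // mulr_ge0.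
  pose d1 (i : 'I_m.+2) : R :=
    if unlift ord0 i is Some j then q^-1 * (B + bary y i) else q^-1 * bary y i.
  pose d2 (i : 'I_m.+2) : R := if unlift ord0 i is Some j then q^-1 * B else q^-1.
  have d10 : d1 ord0 = q^-1 * bary y ord0 by rewrite /d1 unlift_none.
  have d1l j : d1 (lift ord0 j) = q^-1 * (B + bary y (lift ord0 j)) by rewrite /d1 liftK.
  have d20 : d2 ord0 = q^-1 by rewrite /d2 unlift_none.
  have d2l j : d2 (lift ord0 j) = q^-1 * B by rewrite /d2 liftK.
  have S1 : \sum_i d1 i = 1.
    rewrite big_ord_recl d10; under eq_bigr do rewrite d1l.
    rewrite -mulr_sumr -mulrDr big_split /= sumr_const card_ord addrCA s1.
    by rewrite -mulr_natl addrC mulVf // gt_eqF.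
  have S2 : \sum_i d2 i = 1.
    rewrite big_ord_recl d20; under eq_bigr do rewrite d2l.
    by rewrite sumr_const card_ord -mulrnAr -{1}[q^-1]mulr1 -mulrDr -mulr_natl mulVf // gt_eqF.
  pose x := simplex_map (pts t1) (\row_j d1 (lift ord0 j)).
  have xE : x = simplex_map (pts t2) (\row_j d2 (lift ord0 j)).
    rewrite /x !simplex_mapE (sum_lift_bary S1) (sum_lift_bary S2).
    rewrite [RHS]big_ord_recl d20 (_ : pts t2 ord0 = vtx T b2) // v2s.
    rewrite [LHS]big_ord_recl d10 (_ : pts t1 ord0 = vtx T b1) // scalerDr scalerA -addrA.
    congr (_ + _); rewrite scaler_sumr -big_split /=; apply: eq_bigr => j _.
    by rewrite d1l d2l !pts_cons scalerA -scalerDl -mulrDr [B + _]addrC.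
  have : hull F x.
    rewrite -IF -conf; split.
      apply/(hullP ut1 t1K); eexists; last by [].
      move=> i; rewrite (sum_lift_bary S1); case: (unliftP ord0 i) => [j|] ->.
        have : `|bary y (lift ord0 j)| <= B by rewrite /B (bigD1 j) //= lerDl sumr_ge0.
        rewrite ler_norml => /andP[yB _].
        by rewrite d1l mulr_ge0 ?invr_ge0 ?(ltW q0) //; lra.
      by rewrite d10 mulr_ge0 ?invr_ge0 ?(ltW q0) // ltW.
    apply/(hullP ut2 t2K); eexists; last exact: xE.
    move=> i; rewrite (sum_lift_bary S2); case: (unliftP ord0 i) => [j|] ->.
      by rewrite d2l mulr_ge0 ?invr_ge0 ?(ltW q0).
    by rewrite d20 invr_ge0 ltW.
  move=> Fx; have := o1 _ _ Fx (tH ord0).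
  rewrite xE simplex_mapE (sum_lift_bary S2) -[X in _ - X]scale1r -S2 scaler_suml.
  rewrite -sumrB dot_sumr big_ord_recl big1 ?addr0 => [|j _]; last first.
    by rewrite -scalerBr dotZr pts_cons (o1 _ _ (tH j) (tH ord0)) mulr0.
  rewrite -scalerBr dotZr d20 => /eqP; rewrite mulf_eq0 invr_eq0 gt_eqF //=.
  rewrite (_ : pts t2 ord0 = vtx T b2) // -opprB dotNr oppr_eq0 -n12.
  by rewrite gt_eqF.
- by rewrite n2E c1' scaleN1r opprK.
Qed.

(** Positivity of the element size makes [Cpen / h] a legitimate weight in Young's inequality. *)
Lemma diameter_gt0 (K : vset) : #|K| = m.+2 -> affinely_independent K ->
  0 < diameter (open_simplex K).
Proof.
move=> cK aK.
have [t tE] := card_enum_tuple cK.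
have ut : uniq t by rewrite tE enum_uniq.
have tK : t =i K by move=> k; rewrite (_ : (k \in t) = (k \in tval t)) // tE mem_enum.
have uE := edges_unit aK ut tK.
(* All [m.+2] vertices get weight [c] except one whose weight is doubled, hence the denominator
   [m.+3]. Two choices of the doubled vertex give distinct points of the open simplex. *)
pose c : R := (m.+3%:R)^-1.
have c0 : 0 < c by rewrite invr_gt0 ltr0n.
have cE : c * m.+3%:R = 1 by rewrite mulVf // pnatr_eq0.
pose d1 (i : 'I_m.+2) : R := if i == ord0 then c + c else c.
pose i1 : 'I_m.+2 := lift ord0 ord0.
pose d2 (i : 'I_m.+2) : R := if i == i1 then c + c else c.
have S (j : 'I_m.+2) : \sum_i (if i == j then c + c else c) = 1.
  rewrite (bigD1 j) //= eqxx (eq_bigr (fun=> c)) => [|i /negPf -> //].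
  by rewrite sumr_const cardC1 card_ord /= -mulr2n -mulrnDr -[LHS]mulr_natr.
have S1 : \sum_i d1 i = 1 by exact: S.
have S2 : \sum_i d2 i = 1 by exact: S.
have O (j : 'I_m.+2) : open_simplex K
    (simplex_map (pts t) (\row_k (if lift ord0 k == j then c + c else c))).
  apply/(open_simplexP ut tK); eexists; last by [].
  move=> i; rewrite (@sum_lift_bary _ _ (fun i => if i == j then c + c else c)) //.
  by case: ifP => _ //; exact: addr_gt0.
pose x := simplex_map (pts t) (\row_k (if lift ord0 k == ord0 then c + c else c) : 'rV[R]_m.+1).
pose y := simplex_map (pts t) (\row_k (if lift ord0 k == i1 then c + c else c) : 'rV[R]_m.+1).
have xy : x != y.
  apply/eqP => /addrI /(can_inj (mulmxK uE)) /rowP /(_ ord0).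
  rewrite !mxE /i1 eqxx /= => /eqP; rewrite -subr_eq0 opprD addrA subrr sub0r.
  by rewrite oppr_eq0 gt_eqF.
have [C HC] := open_simplex_bounded K.
have nxy : 0 < enorm (x - y).
  rewrite sqrtr_gt0 lt0r dot_ge0 andbT; apply: contra xy => /eqP /dot_eq0 /eqP.
  by rewrite subr_eq0.
apply: (lt_le_trans nxy); apply: ub_le_sup; last first.
  by exists (x, y) => //; split; [exact: (O ord0)|exact: (O i1)].
exists (Num.sqrt (\sum_(i < m.+1) (C + C) ^+ 2)) => _ [[u v] [/= uK vK] <-].
rewrite ler_wsqrtr // ler_sum // => i _; rewrite -expr2 -[X in X <= _]real_normK ?num_real //.
have CC : `|(u - v) 0 i| <= C + C.
  by rewrite !mxE (le_trans (ler_normB _ _)) // lerD // HC //; exact: open_simplex_hull.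
by rewrite lerXn2r ?nnegrE // (le_trans _ CC).
Qed.

(** A point of the closed simplex is the limit of its displacements towards the barycentre [g]. This
    places facets in the closure of the domain, where the signs of [nu] and [eta] are known. *)
Lemma hull_closure (K : vset) : #|K| = m.+2 ->
  hull K `<=` closure (open_simplex K).
Proof.
move=> cK x [w [w0 wK w1 xE]].
pose c : R := (m.+2%:R)^-1.
have c0 : 0 < c by rewrite invr_gt0 ltr0n.
pose g := \sum_k (if k \in K then c else 0) *: vtx T k.
pose p (e : R) := x + e *: (g - x).
have pO e : 0 < e -> e < 1 -> open_simplex K (p e).
  move=> e0 e1; exists (fun k => (1 - e) * w k + e * (if k \in K then c else 0)); split.
  - move=> k kK; rewrite kK ltr_wpDl ?mulr_gt0 // mulr_ge0 // subr_ge0 ltW //.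
  - by move=> k kK; rewrite wK // (negPf kK) !mulr0 addr0.
  - rewrite big_split /= -!mulr_sumr w1 -big_mkcond /= sumr_const cK.
    by rewrite -[c *+ _]mulr_natr mulVf ?pnatr_eq0 // !mulr1 subrK.
  - rewrite /p /g xE scalerBr !scaler_sumr -sumrB -big_split /=.
    by apply: eq_bigr => k _; rewrite !scalerA -scalerBl -scalerDl; congr (_ *: _); ring.
have pc : p e @[e --> 0^'+] --> x.
  rewrite -[X in _ --> X](_ : x + (0 : R) *: (g - x) = x); last by rewrite scale0r addr0.
  apply: cvg_at_right_filter; apply: cvgD; first exact: cvg_cst.
  by apply: cvgZr_tmp; exact: cvg_id.
move=> A xA.
have : \forall e \near 0^'+, A (p e) by exact: pc.
move=> pA.
have [e [[e0 e1] Ae]] : exists e : R, (0 < e /\ e < 1) /\ A (p e).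
  near (0 : R)^'+ => e; exists e; split; last by near: e.
  split; near: e; [exact: nbhs_right_gt|exact: nbhs_right_lt].
by exists (p e); split => //; exact: pO.
Unshelve. all: by end_near. Qed.

End adjacent_simplices.

(** * Time derivative of the energy *)

Section energy_derivative.
Context (R : realType) (m : nat) (T : mesh R m.+1) (K : {set 'I_(nvert T)}).
Local Notation E := 'rV[R]_m.+1.
Context (cK : #|K| = m.+2) (aK : affinely_independent K).

(** In the nodal basis the integral is a quadratic form, with constant Gram matrix [G], in finitely
    many scalar functions of time; no differentiation under the integral sign is involved. *)
Lemma is_derive_vint_sqr k (f : R -> E -> R) (t : R) : 0 < t ->
  (forall s, 0 <= s -> poly_on k setT (f s)) ->
  (forall x, derivable (f^~ x) t 1) ->
  pfun (fun x => derive1 (f^~ x) t) /\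
  is_derive t 1 (fun s => vint (open_simplex K) (fun x => f s x * f s x))
    (2 * vint (open_simplex K) (fun x => derive1 (f^~ x) t * f t x)).
Proof.
move=> t0 fp fd; have [phi [pphi interp]] := interpolation R m.+1 k.
pose node (a : {ffun 'I_m.+1 -> 'I_k.+1}) : E := \row_i (a i)%:R.
pose c a s := f s (node a).
have dc a : is_derive t 1 (c a) (derive1 (f^~ (node a)) t).
  by rewrite derive1E; apply: derivableP; exact: fd.
(* Polynomiality in space is known at nonnegative times only, so the expansion is used on a
   neighbourhood of [t]. *)
have near_pos : \forall s \near t, 0 <= s.
  by near=> s; apply/ltW; near: s; exact: lt_nbhsr.
have fE x : derive1 (f^~ x) t = \sum_a derive1 (f^~ (node a)) t * phi a x.
  rewrite derive1E; apply: derive_val; apply: (near_eq_is_derive (f := fun s => \sum_a c a s * phi a x)).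
    by near=> s; apply/esym/interp/fp; near: s.
  rewrite -fct_sumE; elim/big_ind2: _.
  - exact: is_derive_cst.
  - by move=> f1 d1 f2 d2 ? ?; exact: is_deriveD.
  - move=> a _; apply: (is_derive_eq (is_deriveM (dc a) (is_derive_cst (phi a x) t 1))).
    by rewrite scaler0 add0r /GRing.scale /= mulrC.
have pf' : pfun (fun x => derive1 (f^~ x) t).
  rewrite (_ : (fun _ => _) = fun x => \sum_a derive1 (f^~ (node a)) t * phi a x).
    by apply: pfun_sum => a _; apply: pfunM; [exact: pfun_cst|].
  by apply/funext => x.
split => //.
pose G a b := vint (open_simplex K) (fun x => phi a x * phi b x).
have bilin (p q : {ffun 'I_m.+1 -> 'I_k.+1} -> R) :
    vint (open_simplex K) (fun x => (\sum_a p a * phi a x) * (\sum_b q b * phi b x)) =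
    \sum_a \sum_b p a * q b * G a b.
  have -> : (fun x => (\sum_a p a * phi a x) * (\sum_b q b * phi b x)) =
      (fun x => \sum_a \sum_b (p a * q b) * (phi a x * phi b x)).
    apply/funext => x; rewrite mulr_suml; apply: eq_bigr => a _.
    by rewrite mulr_sumr; apply: eq_bigr => b _; ring.
  rewrite (vint_sum cK aK) => [|a _]; last first.
    apply: (vintegrable_pfun cK aK); apply: pfun_sum => b _.
    by apply: pfunM; [exact: pfun_cst|exact: pfunM].
  apply: eq_bigr => a _; rewrite (vint_sum cK aK) => [|b _]; last first.
    by apply: (vintegrable_pfun cK aK); apply: pfunM; [exact: pfun_cst|exact: pfunM].
  by apply: eq_bigr => b _; rewrite (vintZ cK aK) //; apply: (vintegrable_pfun cK aK); exact: pfunM.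
have GC a b : G a b = G b a by congr vint; apply/funext => x; rewrite mulrC.
have -> : 2 * vint (open_simplex K) (fun x => derive1 (f^~ x) t * f t x) =
    \sum_a \sum_b (derive1 (f^~ (node a)) t * c b t + c a t * derive1 (f^~ (node b)) t) * G a b.
  have -> : (fun x => derive1 (f^~ x) t * f t x) =
     (fun x => (\sum_a derive1 (f^~ (node a)) t * phi a x) * (\sum_b c b t * phi b x)).
    by apply/funext => x; rewrite fE (interp (f t)) //; apply: fp; exact: ltW.
  rewrite bilin; rewrite mulrDl mul1r.
  under [in RHS]eq_bigr do (under eq_bigr do rewrite mulrDl; rewrite big_split /=).
  rewrite [RHS]big_split /=; congr (_ + _).
  rewrite [RHS]exchange_big /=; apply: eq_bigr => a _; apply: eq_bigr => b _.
  by rewrite GC mulrC [c b t * _]mulrC mulrC.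
apply: (near_eq_is_derive (f := fun s => \sum_a \sum_b (c a s * c b s) * G a b)).
  near=> s; rewrite -bilin; congr vint; apply/funext => x.
  by rewrite (interp (f s)) //; apply: fp; near: s.
rewrite -fct_sumE; elim/big_ind2: _.
- exact: is_derive_cst.
- by move=> f1 d1 f2 d2 ? ?; exact: is_deriveD.
- move=> a _; rewrite -fct_sumE; elim/big_ind2: _.
  + exact: is_derive_cst.
  + by move=> f1 d1 f2 d2 ? ?; exact: is_deriveD.
  + move=> b _.
    have H := is_deriveM (is_deriveM (dc a) (dc b)) (is_derive_cst (G a b) t 1).
    apply: (is_derive_eq H); rewrite scaler0 add0r /GRing.scale /=; ring.
Unshelve. all: by end_near. Qed.

End energy_derivative.

(** * Integration along a facet *)

Section facet_integration.
Context (R : realType) (m : nat) (T : mesh R m.+1) (F : {set 'I_(nvert T)}).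
Local Notation E := 'rV[R]_m.+1.
Local Notation S := (@unit_simplex R m).
Context (cF : #|F| = m.+1).

Lemma facet_map_hull y : S y -> hull F (facet_map F y).
Proof.
have [t tF] := card_enum_tuple cF.
have ut : uniq t by rewrite tF enum_uniq.
have tF' : t =i F by move=> k; rewrite (_ : (k \in t) = (k \in tval t)) // tF mem_enum.
rewrite unit_simplexE => Sy; apply/(hullP ut tF'); exists (row_of_tuple y) => //.
rewrite /facet_map /simplex_map -(facet_vertexE ord0 tF); congr (_ + _ *m _).
by apply/row_matrixP => i; rewrite !rowK -!(facet_vertexE _ tF).
Qed.

(** Bounded measurable functions along the facet. Unlike polynomials they include the discontinuous
    upwind switch and the indicator of [GammaN], and they still multiply integrable coefficients. *)
Definition fbm (f : E -> R) :=
  measurable_fun S (fun y => f (facet_map F y)) /\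
  exists M, forall y, S y -> `|f (facet_map F y)| <= M.

Lemma fbm_eq f g : (forall x, hull F x -> f x = g x) -> fbm f -> fbm g.
Proof.
move=> fg [mf [M fM]]; split; last first.
  by exists M => y Sy; rewrite -fg; [exact: fM|exact: facet_map_hull].
apply: eq_measurable_fun mf => y; rewrite inE => Sy.
by apply: fg; exact: facet_map_hull.
Qed.

Lemma fbm_cst c : fbm (fun=> c).
Proof. by split; [exact: measurable_cst|exists `|c|]. Qed.

Lemma fbmD f g : fbm f -> fbm g -> fbm (fun x => f x + g x).
Proof.
move=> [mf [M fM]] [mg [N gN]]; split; first exact: measurable_funD.
by exists (M + N) => y Sy; rewrite (le_trans (ler_normD _ _)) // lerD ?fM ?gN.
Qed.

Lemma fbmM f g : fbm f -> fbm g -> fbm (fun x => f x * g x).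
Proof.
move=> [mf [M fM]] [mg [N gN]]; split; first exact: measurable_funM.
by exists (M * N) => y Sy; rewrite normrM ler_pM ?fM ?gN.
Qed.

Lemma fbmN f : fbm f -> fbm (fun x => - f x).
Proof.
move=> bf; apply: (fbm_eq _ (fbmM (fbm_cst (-1)) bf)) => x _.
by rewrite mulN1r.
Qed.

Lemma fbmB f g : fbm f -> fbm g -> fbm (fun x => f x - g x).
Proof. by move=> bf bg; apply: fbmD => //; exact: fbmN. Qed.

Lemma fbm_sum I (r : seq I) (Q : pred I) (f : I -> E -> R) :
  (forall i, Q i -> fbm (f i)) -> fbm (fun x => \sum_(i <- r | Q i) f i x).
Proof.
move=> bf; elim: r => [|i r IH].
  by apply: fbm_eq (fbm_cst 0) => x _; rewrite big_nil.
have [Qi|Qi] := boolP (Q i).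
  by apply: fbm_eq (fbmD (bf i Qi) IH) => x _; rewrite big_cons Qi.
by apply: fbm_eq IH => x _; rewrite big_cons (negPf Qi).
Qed.

Lemma fbm_pfun f : pfun f -> fbm f.
Proof.
move=> pf.
have pfF : pfun (fun y => f (facet_vertex F 0 + y *m facet_edges F)).
  rewrite (_ : (fun _ => _) = fun y => f (y *m facet_edges F + facet_vertex F 0)).
    exact: pfun_affine.
  by apply/funext => y; rewrite addrC.
split; first exact: (measurable_funTS (measurable_pfun pfF)).
have [M HM] := bounded_pfun 1 pfF; exists M => y.
by rewrite unit_simplexE => Sy; apply: HM => i; exact: csimplex_le1.
Qed.

Lemma fbm_poly_on k f : poly_on k (hull F) f -> fbm f.
Proof.
by move=> /poly_on_pfun [g pg fg]; apply: fbm_eq (fbm_pfun pg) => x /fg.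
Qed.

Lemma fbm_lt0 f : fbm f -> fbm (fun x => if f x < 0 then 1 else 0).
Proof.
move=> [mf _]; split; last by exists 1 => y _; case: ifP => _; rewrite ?normr1 ?normr0.
have mlt : measurable_fun S (fun y => f (facet_map F y) < 0).
  exact: measurable_fun_ltr.
have := @measurable_fun_if _ _ _ _ (fun=> (1 : R)) (fun=> 0) S (@measurable_unit_simplex R m) _ mlt.
by apply; exact: measurable_cst.
Qed.

Lemma fbm_indic A : measurable (S `&` facet_map F @^-1` A) -> fbm \1_A.
Proof.
move=> mA; split; last by exists 1 => y _; rewrite indicE; case: (_ \in _); rewrite ?normr1 ?normr0.
have := @measurable_indic _ _ R S _ mA; apply: eq_measurable_fun => y; rewrite inE => Sy.
by apply: eq_indic; split => [[]|].
Qed.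

Lemma fdomE : S `&` facet_map F @^-1` setT = S.
Proof. by rewrite preimage_setT setIT. Qed.

Lemma mfdom : measurable (S `&` facet_map F @^-1` setT).
Proof. rewrite fdomE; exact: measurable_unit_simplex. Qed.

Lemma fbm_fintegrable f : fbm f -> fintegrable setT F f.
Proof.
move=> [mf [M fM]]; rewrite /fintegrable fdomE.
apply: measurable_bounded_integrable => //.
- exact: measurable_unit_simplex.
- exact: unit_simplex_fin.
- exists M; split; first by rewrite num_real.
  by move=> N MN y Sy; apply/ltW; rewrite (le_lt_trans _ MN) //; exact: fM.
Qed.

Lemma fintegrableM f g : fbm f -> fintegrable setT F g ->
  fintegrable setT F (fun x => f x * g x).
Proof.
move=> [mf [M fM]]; rewrite /fintegrable fdomE => ig.
have bf : [bounded f (facet_map F y) | y in S].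
  exists M; split; first by rewrite num_real.
  by move=> N MN y Sy; apply/ltW; rewrite (le_lt_trans _ MN) //; exact: fM.
exact: (integrableMr (@measurable_unit_simplex R m) mf bf ig).
Qed.

Lemma fintegrable_eq f g : (forall x, hull F x -> f x = g x) ->
  fintegrable setT F f -> fintegrable setT F g.
Proof.
rewrite /fintegrable fdomE => fg.
apply: eq_integrable; first exact: measurable_unit_simplex.
by move=> y; rewrite inE => Sy; rewrite fg //; exact: facet_map_hull.
Qed.

Lemma fintegrableD f g : fintegrable setT F f -> fintegrable setT F g ->
  fintegrable setT F (fun x => f x + g x).
Proof. by move=> vf vg; apply: (integrableD mfdom vf vg). Qed.

Lemma fintegrableZ c f : fintegrable setT F f -> fintegrable setT F (fun x => c * f x).
Proof. by move=> vf; apply: (integrableZl mfdom c vf). Qed.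

Lemma fintD f g : fintegrable setT F f -> fintegrable setT F g ->
  fint setT F (fun x => f x + g x) = fint setT F f + fint setT F g.
Proof. by move=> vf vg; rewrite /fint RintegralD //; [rewrite mulrDr|exact: mfdom]. Qed.

Lemma fintZ c f : fintegrable setT F f ->
  fint setT F (fun x => c * f x) = c * fint setT F f.
Proof. by move=> vf; rewrite /fint RintegralZl //; [rewrite mulrCA|exact: mfdom]. Qed.

Lemma fint_eq A f g : (forall x, hull F x -> A x -> f x = g x) -> fint A F f = fint A F g.
Proof.
move=> fg; rewrite /fint; congr (_ * _); apply: eq_Rintegral => y.
by rewrite inE => -[Sy Ay]; apply: fg => //; exact: facet_map_hull.
Qed.

Lemma le_fint f g : fintegrable setT F f -> fintegrable setT F g ->
  (forall x, hull F x -> f x <= g x) -> fint setT F f <= fint setT F g.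
Proof.
move=> vf vg fg; rewrite /fint ler_wpM2l ?sqrtr_ge0 // le_Rintegral //; first exact: mfdom.
by move=> y [Sy _]; apply: fg; exact: facet_map_hull.
Qed.

Lemma fint0 A : fint A F (fun=> 0) = 0.
Proof.
rewrite /fint (_ : (\int[_]_(y in _) 0) = 0) ?mulr0 //.
by rewrite /Rintegral integral0.
Qed.

Lemma fint_indic A f : fint A F f = fint setT F (fun x => \1_A x * f x).
Proof.
rewrite /fint fdomE Rintegral_mkcondr; congr (_ * _); apply: eq_Rintegral => y _.
rewrite patchE indicE (_ : (y \in facet_map F @^-1` A) = (facet_map F y \in A)) //.
by case: (_ \in _); rewrite ?mul1r ?mul0r.
Qed.

Lemma fint_ae0 f : fbm f -> facet_ae F (fun x => f x = 0) -> fint setT F f = 0.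
Proof.
move=> bf f0; rewrite /fint fdomE /Rintegral.
rewrite (ae_eq_integral (cst 0%E)) ?integral0 ?mulr0 //.
- exact: measurable_unit_simplex.
- by apply/measurable_EFinP; case: bf.
- by move: f0; rewrite /facet_ae; apply: filterS => y fy Sy; rewrite fy.
Qed.

(** The integral of the square of [l * f + g] is nonnegative for every [l], and affine in [l] once
    the square of [f] integrates to zero; so its slope vanishes. *)
Lemma fint_orth f g : fbm f -> fbm g -> fint setT F (fun x => f x * f x) = 0 ->
  fint setT F (fun x => f x * g x) = 0.
Proof.
move=> bf bg ff.
have H l : 0 <= l * (2 * fint setT F (fun x => f x * g x)) + fint setT F (fun x => g x * g x).
  have <- : fint setT F (fun x => (l * f x + g x) * (l * f x + g x)) =
      l * (2 * fint setT F (fun x => f x * g x)) + fint setT F (fun x => g x * g x).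
    rewrite (@fint_eq _ _ (fun x => l ^+ 2 * (f x * f x) +
       (l * 2 * (f x * g x) + g x * g x))); last by move=> x _ _; ring.
    have iff := fbm_fintegrable (fbmM bf bf).
    have ifg := fbm_fintegrable (fbmM bf bg).
    have igg := fbm_fintegrable (fbmM bg bg).
    rewrite fintD ?fintD ?fintZ ?ff ?mulr0 ?add0r ?mulrA //.
    - exact: fintegrableZ.
    - exact: fintegrableZ.
    - by apply: fintegrableD => //; exact: fintegrableZ.
  rewrite -[X in X <= _](fint0 setT); apply: le_fint.
  - exact/fbm_fintegrable/fbm_cst.
  - apply: fbm_fintegrable; apply: fbmM; apply: fbmD => //; apply: fbmM => //; exact: fbm_cst.
  - by move=> x _; rewrite -expr2 sqr_ge0.
apply/eqP; apply/negP => /negP b0; set b := fint _ _ _ in H b0; set c := fint _ _ _ in H.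
have b2 : 2 * b != 0 by rewrite mulf_neq0 // pnatr_eq0.
(* At this value of [l] the affine function equals -1. *)
by have := H (- (c + 1) / (2 * b)); rewrite divfK //; lra.
Qed.

End facet_integration.

(** * Integration over an element *)

Section volume_integration.
Context (R : realType) (m : nat) (T : mesh R m.+1) (K : {set 'I_(nvert T)}).
Local Notation E := 'rV[R]_m.+1.
Context (cK : #|K| = m.+2) (aK : affinely_independent K).
Local Notation O := (open_simplex K).

Lemma eq_vint f g : (forall x, O x -> f x = g x) -> vint O f = vint O g.
Proof. by move=> fg; apply: eq_Rintegral => y; rewrite inE => Oy; exact: fg. Qed.

Lemma vintegrableD f g : vintegrable O f -> vintegrable O g ->
  vintegrable O (fun x => f x + g x).
Proof. by move=> vf vg; apply: (integrableD (measurable_open_simplex cK aK) vf vg). Qed.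

Lemma vintegrableM f g : pfun f -> vintegrable O g -> vintegrable O (fun x => f x * g x).
Proof.
move=> pf ig; have mf := measurable_funTS (D := @row_of_tuple R m.+1 @^-1` O) (measurable_pfun pf).
have [M HM] := bounded_pfun_hull K pf.
have bf : [bounded f (row_of_tuple y) | y in @row_of_tuple R m.+1 @^-1` O].
  exists M; split; first by rewrite num_real.
  move=> N MN y Dy; apply/ltW; rewrite (le_lt_trans _ MN) //; apply: HM.
  exact: open_simplex_hull.
exact: (integrableMr (measurable_open_simplex cK aK) mf bf ig).
Qed.

Lemma vint_orth f g : pfun f -> pfun g -> vint O (fun x => f x * f x) = 0 ->
  vint O (fun x => f x * g x) = 0.
Proof.
move=> pf pg ff.
have H l : 0 <= l * (2 * vint O (fun x => f x * g x)) + vint O (fun x => g x * g x).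
  have <- : vint O (fun x => (l * f x + g x) * (l * f x + g x)) =
      l * (2 * vint O (fun x => f x * g x)) + vint O (fun x => g x * g x).
    rewrite (@eq_vint _ (fun x => l ^+ 2 * (f x * f x) +
       (l * 2 * (f x * g x) + g x * g x))); last by move=> x _; ring.
    have iff := vintegrable_pfun cK aK (pfunM pf pf).
    have ifg := vintegrable_pfun cK aK (pfunM pf pg).
    have igg := vintegrable_pfun cK aK (pfunM pg pg).
    rewrite (vintD cK aK) ?(vintD cK aK) ?(vintZ cK aK) ?ff ?mulr0 ?add0r ?mulrA //.
    - by apply: vintegrableM => //; exact: pfun_cst.
    - by apply: vintegrableM => //; exact: pfun_cst.
    - by apply: vintegrableD => //; apply: vintegrableM => //; exact: pfun_cst.
  by apply: Rintegral_ge0 => y _; rewrite -expr2 sqr_ge0.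
apply/eqP; apply/negP => /negP b0; set b := vint _ _ in H b0; set c := vint _ _ in H.
have b2 : 2 * b != 0 by rewrite mulf_neq0 // pnatr_eq0.
by have := H (- (c + 1) / (2 * b)); rewrite divfK //; lra.
Qed.

End volume_integration.

(** * Pointwise energy balance *)

Section tensor_algebra.
Context (R : realType) (d : nat).
Local Notation E := 'rV[R]_d.
Implicit Types (A B C : 'M[R]_d) (a b n v w : E).

Lemma ddotC A B : ddot A B = ddot B A.
Proof. by apply: eq_bigr => i _; apply: eq_bigr => j _; rewrite mulrC. Qed.

Lemma ddotDl A B C : ddot (A + B) C = ddot A C + ddot B C.
Proof.
rewrite /ddot -big_split /=; apply: eq_bigr => i _.
by rewrite -big_split /=; apply: eq_bigr => j _; rewrite mxE mulrDl.
Qed.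

Lemma ddotZl k A C : ddot (k *: A) C = k * ddot A C.
Proof.
rewrite /ddot mulr_sumr; apply: eq_bigr => i _.
by rewrite mulr_sumr; apply: eq_bigr => j _; rewrite mxE mulrA.
Qed.

Lemma ddotNl A C : ddot (- A) C = - ddot A C.
Proof. by rewrite -scaleN1r ddotZl mulN1r. Qed.

Lemma ddot_ge0 A : 0 <= ddot A A.
Proof. by apply: sumr_ge0 => i _; apply: sumr_ge0 => j _; rewrite -expr2 sqr_ge0. Qed.

Lemma fnorm_sqr A : fnorm A ^+ 2 = ddot A A.
Proof. by rewrite sqr_sqrtr // ddot_ge0. Qed.

Lemma ddot_scalar k A : ddot k%:M A = k * \tr A.
Proof.
rewrite /mxtrace mulr_sumr; apply: eq_bigr => i _.
rewrite (bigD1 i) //= mxE eqxx mulr1n big1 ?addr0 // => j /negPf ji.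
by rewrite mxE eq_sym ji mulr0n mul0r.
Qed.

Lemma ddot_tens a b n v : ddot (tens a b) (tens n v) = dot a n * dot b v.
Proof.
rewrite /ddot /dot mulr_suml; apply: eq_bigr => i _.
by rewrite mulr_sumr; apply: eq_bigr => j _; rewrite !mxE; ring.
Qed.

Lemma ddot_scalar_tens k n v : ddot k%:M (tens n v) = k * dot n v.
Proof. by rewrite ddot_scalar; congr (_ * _); apply: eq_bigr => i _; rewrite mxE. Qed.

Lemma ddot_tens_mul A n w : ddot A (tens n w) = dot (n *m A) w.
Proof.
rewrite /ddot exchange_big /=; apply: eq_bigr => j _.
by rewrite mxE mulr_suml; apply: eq_bigr => i _; rewrite mxE; ring.
Qed.

Lemma mvmul_sgrad (f : E -> E) x n : n *m sgrad f x = mvmul (sgrad f x) n.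
Proof. by congr (_ *m _); apply/matrixP => i j; rewrite !mxE addrC. Qed.

Lemma mvmul_agrad (f : E -> E) x n : n *m agrad f x = - mvmul (agrad f x) n.
Proof.
by rewrite /mvmul -mulmxN; congr (_ *m _); apply/matrixP => i j; rewrite !mxE -mulrN opprB.
Qed.

(** This is the expansion of the square of [a - c *: v], multiplied by [2 * c^-1]. The factor 4
    accounts for two equal facet terms, the consistency and the symmetrisation term of the viscous
    flux. *)
Lemma young (c : R) a v : 0 < c ->
  4 * dot a v <= 2 * c^-1 * dot a a + 2 * c * dot v v.
Proof.
move=> c0; have := dot_ge0 (a - c *: v).
rewrite dotBr dotZr [dot (_ - _) a]dotC [dot (_ - _) v]dotC !dotBr !dotZr [dot v a]dotC => H.
have : 0 <= 2 * c^-1 * (dot a a - c * dot a v - c * (dot a v - c * dot v v)).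
  by rewrite mulr_ge0 // mulr_ge0 // invr_ge0 ltW.
move=> H'; rewrite -subr_ge0 [X in 0 <= X](_ : _ =
  2 * c^-1 * (dot a a - c * dot a v - c * (dot a v - c * dot v v))) //.
by field; rewrite gt_eqF.
Qed.

(* Upwinding: both signs of the normal velocity [a] leave a nonnegative jump term. *)
Lemma upwind_ge0 (a uu uv vv chi : R) : 0 <= uu - 2 * uv + vv -> 0 <= vv -> 0 <= chi ->
  let l := if a < 0 then 1 else 0 in
  0 <= (1 - l) * (a * (uu - uv)) + l * (a * (uv - vv)) + chi * ((1 - l) * (a * vv))
       + (1 - chi) * (a * (2^-1 * vv)) - 2^-1 * uu * a.
Proof.
move=> w0 v0 c0 /=; case: ifPn => [a0|]; last rewrite -leNgt => a0.
  have H1 : 0 <= - a * (uu - 2 * uv + vv) by rewrite mulr_ge0 // oppr_ge0 ltW.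
  have H2 : 0 <= chi * (- a * vv) by rewrite mulr_ge0 // mulr_ge0 // oppr_ge0 ltW.
  by lra.
have H1 : 0 <= a * (uu - 2 * uv + vv) by rewrite mulr_ge0.
have H2 : 0 <= chi * (a * vv) by rewrite mulr_ge0 // mulr_ge0.
by lra.
Qed.

Lemma is_derive_dot (w : E -> E) (x v : E) : (forall j, pfun (fun x => w x 0 j)) ->
  is_derive x v (fun y => dot (w y) (w y))
    (2 * \sum_j w x 0 j * 'D_v (fun y => w y 0 j) x).
Proof.
move=> pw; rewrite /dot mulr_sumr -fct_sumE; elim/big_ind2: _.
- exact: is_derive_cst.
- by move=> f1 d1 f2 d2 ? ?; exact: is_deriveD.
- move=> j _; have dj : is_derive x v (fun y => w y 0 j) ('D_v (fun y => w y 0 j) x).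
    by apply: derivableP; exact: pfun_derivable.
  by apply: (is_derive_eq (is_deriveM dj dj)); rewrite /GRing.scale /=; ring.
Qed.

Lemma pfun_dot (w w' : E -> E) : (forall j, pfun (fun x => w x 0 j)) ->
  (forall j, pfun (fun x => w' x 0 j)) -> pfun (fun x => dot (w x) (w' x)).
Proof. by move=> pw pw'; apply: pfun_sum => j _; exact: pfunM. Qed.

Lemma pfun_divergence (u : E -> E) : (forall j, pfun (fun x => u x 0 j)) ->
  pfun (divergence u).
Proof.
move=> pu; rewrite (_ : divergence u = fun x => \sum_i 'D_(delta_mx 0 i) (fun y => u y 0 i) x).
  by apply: pfun_sum => i _; exact: pfun_derive.
by apply/funext => x; apply: eq_bigr => i _; rewrite mxE.
Qed.

(** The first two terms are the convection terms of the momentum and induction equations. The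
    remainder is a polynomial multiple of the divergence, the form in which the mass equation
    disposes of it. *)
Lemma divergence_energy_flux (r s : R) (u b : E -> E) (x : E) :
  (forall j, pfun (fun x => u x 0 j)) -> (forall j, pfun (fun x => b x 0 j)) ->
  divergence (fun y => (2^-1 * (r * dot (u y) (u y) + s * dot (b y) (b y))) *: u y) x =
  r * ddot (tens (u x) (u x)) (grad u x) + s * ddot (tens (u x) (b x)) (grad b x) +
  2^-1 * (r * dot (u x) (u x) + s * dot (b x) (b x)) * divergence u x.
Proof.
move=> pu pb.
have [Q QE] : exists Q, Q = 2^-1 * (r * dot (u x) (u x) + s * dot (b x) (b x)) by eexists.
rewrite -QE /divergence /mxtrace /ddot !mulr_sumr -!big_split /=.
apply: eq_bigr => i _; rewrite mxE.
pose e : E := delta_mx 0 i.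
pose di := 'D_e (fun y => u y 0 i) x.
pose gu := \sum_j u x 0 j * 'D_e (fun y => u y 0 j) x.
pose gb := \sum_j b x 0 j * 'D_e (fun y => b y 0 j) x.
have du : is_derive x e (fun y => u y 0 i) di.
  by apply: derivableP; exact: pfun_derivable.
have dq : is_derive x e (fun y => 2^-1 * (r * dot (u y) (u y) + s * dot (b y) (b y)))
    (2^-1 * (r * (2 * gu) + s * (2 * gb))).
  have := is_deriveZ 2^-1 (is_deriveD (is_deriveZ r (is_derive_dot x e pu))
                          (is_deriveZ s (is_derive_dot x e pb))).
  by apply.
have H := is_deriveM dq du.
have -> : 'D_(delta_mx 0 i) (fun y => ((2^-1 * (r * dot (u y) (u y) +
    s * dot (b y) (b y))) *: u y) 0 i) x =
  'D_e ((fun y => 2^-1 * (r * dot (u y) (u y) + s * dot (b y) (b y))) *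
        (fun y => u y 0 i)) x.
  by congr ('D_e _ x); apply/funext => y; rewrite mxE.
rewrite (@derive_val _ _ _ _ _ _ _ H) /GRing.scale /=.
have -> : \sum_j tens (u x) (u x) i j * grad u x i j = u x 0 i * gu.
  by rewrite mulr_sumr; apply: eq_bigr => j _; rewrite !mxE mulrA.
have -> : \sum_j tens (u x) (b x) i j * grad b x i j = u x 0 i * gb.
  by rewrite mulr_sumr; apply: eq_bigr => j _; rewrite !mxE mulrA.
rewrite (_ : grad u x i i = di); last by rewrite mxE.
have alg (q1 q2 ui g1 g2 e1 : R) : 2^-1 * (r * q1 + s * q2) * e1 +
    ui * (2^-1 * (r * (2 * g1) + s * (2 * g2))) =
    r * (ui * g1) + s * (ui * g2) + 2^-1 * (r * q1 + s * q2) * e1 by field.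
by rewrite QE; exact: alg.
Qed.

End tensor_algebra.

(** * Numerical fluxes at a point of a facet *)

Section pointwise.
Context (R : realType) (d k : nat) (P : mhd_data R d) (T : mesh R d).
Local Notation E := 'rV[R]_d.
Local Notation vset := {set 'I_(nvert T)}.
Context (n : vset -> vset -> E) (Cpen : R) (X : discrete_state T).
Context (t : R) (K F : vset) (x : E).
Local Notation rho := (rho P).
Local Notation mu0 := (mu0 P).
Local Notation h := (diameter (open_simplex K)).
Local Notation u := (uh X t K x).
Local Notation u' := (uhat X t F x).
Local Notation B := (Bh X t K x).
Local Notation B' := (Bhat X t F x).
Local Notation nKF := (n K F).
Local Notation l := (lam n X t K F x).
Local Notation nux := (nu P x t).
Local Notation etax := (eta P x t).
Local Notation Su := (sgrad (uh X t K) x).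
Local Notation AB := (agrad (Bh X t K) x).

Lemma ddot_maxwell b v w : ddot (maxwell P b) (tens v w) =
  (rho * mu0)^-1 * (dot b v * dot b w - 2^-1 * dot b b * dot v w).
Proof. by rewrite ddotZl ddotDl ddotNl ddot_tens ddot_scalar_tens enorm_sqr. Qed.

Lemma momentum_fluxE v :
  ddot (momentum_flux P n Cpen X t K F x) (tens nKF v) =
  (1 - l) * (dot u nKF * dot u v) + l * (dot u nKF * dot u' v)
  + rho^-1 * phat X t F x * dot nKF v - 2 * nux * ddot Su (tens nKF v)
  + 2 * (Cpen / h) * nux * (dot nKF nKF * dot (u - u') v)
  - (rho * mu0)^-1 * (dot B' nKF * dot B' v - 2^-1 * dot B' B' * dot nKF v).
Proof.
by rewrite /momentum_flux !(ddotDl, ddotNl, ddotZl) ?ddot_maxwell !ddot_tens ddot_scalar_tens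
  -ddot_maxwell ddotZl ddotDl ddotNl ddot_tens ddot_scalar_tens enorm_sqr.
Qed.

Lemma induction_fluxE v :
  ddot (induction_flux P n Cpen X t K F x) (tens nKF v) =
  (1 - l) * (dot u nKF * dot B v) + l * (dot u nKF * dot B' v)
  + rhat X t F x * dot nKF v - 2 * (etax / mu0) * ddot AB (tens nKF v)
  + 2 * (etax / mu0) * (Cpen / h) * (dot nKF nKF * dot (B - B') v).
Proof.
by rewrite /induction_flux !(ddotDl, ddotNl, ddotZl) !ddot_tens ddot_scalar_tens.
Qed.

(** Young's inequality with weight [Cpen / h] uses up exactly the penalty term and leaves the factor
    [2 * (h / Cpen)] of the trace inequalities. The Maxwell flux tested with [u - u'] is cancelled
    by the extra trace term of the facet induction equation. [chi] stands for the indicator of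
    [GammaN], so all facets are treated alike. *)
Lemma facet_pointwise (chi : R) : 0 < rho -> 0 < mu0 -> 0 <= nux -> 0 <= etax ->
  0 < Cpen -> 0 < h -> enorm nKF = 1 -> 0 <= chi ->
  - (2 * (h / Cpen) * rho * nux * enorm (mvmul Su nKF) ^+ 2)
  - 2 * (h / Cpen) * (etax / mu0 ^+ 2) * enorm (mvmul AB nKF) ^+ 2
  + rho * (rho^-1 * dot (u - u') nKF * phat X t F x)
  + mu0^-1 * (dot (B - B') nKF * rhat X t F x)
  - (1 - chi) * (dot u nKF * (2^-1 * (rho * dot u' u' + mu0^-1 * dot B' B')))
  + dot ((2^-1 * (rho * dot u u + mu0^-1 * dot B B)) *: u) nKF <=
  rho * ddot (momentum_flux P n Cpen X t K F x) (tens nKF u)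
  - rho * ddot (momentum_flux P n Cpen X t K F x) (tens nKF u')
  - rho * (2 * nux * ddot (tens nKF (u - u')) Su)
  + mu0^-1 * ddot (induction_flux P n Cpen X t K F x) (tens nKF B)
  - mu0^-1 * ddot (induction_flux P n Cpen X t K F x) (tens nKF B')
  - mu0^-1 * (2 * (etax / mu0) * ddot (tens nKF (B - B')) AB)
  + mu0^-1 * ddot (tens B' B' - (2^-1 * dot B' B')%:M) (tens nKF (u - u'))
  + rho * (chi * ddot ((1 - l) *: tens u u') (tens nKF u'))
  + mu0^-1 * (chi * ddot ((1 - l) *: tens u B') (tens nKF B')).
Proof.
move=> r0 m0 nu0 eta0 C0 h0 n1 chi0.
have nn : dot nKF nKF = 1 by rewrite -enorm_sqr n1 expr1n.
rewrite -subr_ge0 !momentum_fluxE !induction_fluxE nn !enorm_sqr.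
have Y1 := young (mvmul Su nKF) (u - u') (divr_gt0 C0 h0).
(* The sign comes from the transposition in [mvmul]: the matrix [AB] is antisymmetric. *)
have Y2 := young (- mvmul AB nKF) (B - B') (divr_gt0 C0 h0).
rewrite invf_div in Y1; rewrite invf_div [dot (- _) (- _)]dotNr [dot (- _) (mvmul _ _)]dotC dotNr opprK in Y2.
have L1 := @upwind_ge0 R (dot u nKF) (dot u u) (dot u u') (dot u' u') chi.
have L2 := @upwind_ge0 R (dot u nKF) (dot B B) (dot B B') (dot B' B') chi.
have sq (v w : E) : dot (v - w) (v - w) = dot v v - 2 * dot v w + dot w w.
  by rewrite dotBr [dot _ v]dotC [dot _ w]dotC !dotBr [dot w v]dotC; ring.
have {L1}F1 := L1 (ltac:(by rewrite -sq dot_ge0)) (dot_ge0 _) chi0.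
have {L2}F2 := L2 (ltac:(by rewrite -sq dot_ge0)) (dot_ge0 _) chi0.
rewrite -/(lam n X t K F x) /= in F1 F2.
rewrite -subr_ge0 in Y1; rewrite -subr_ge0 in Y2.
rewrite [ddot (tens B' B' - _) _]ddotDl [ddot (- _) _]ddotNl.
rewrite ![ddot ((1 - l) *: _) _]ddotZl ![ddot (tens _ _) (tens _ _)]ddot_tens.
rewrite [ddot (_%:M) (tens _ _)]ddot_scalar_tens.
rewrite ![ddot (tens _ _) Su]ddotC ![ddot (tens _ _) AB]ddotC !ddot_tens_mul !mvmul_sgrad !mvmul_agrad.
rewrite ![dot (u - u') _]dotC ![dot (B - B') _]dotC [dot (_ *: u) _]dotC dotZr.
rewrite ![dot nKF _]dotC !sq in Y1 Y2 *.
rewrite !dotBr in Y1 Y2 *.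
move: F1 F2 Y1 Y2.
rewrite ![dot _ nKF]dotC ![dot u' u]dotC ![dot B' B]dotC.
set a := dot nKF u; set F1 := (X in 0 <= X -> _); set F2 := (X in _ -> 0 <= X -> _).
set Y1 := (X in _ -> _ -> 0 <= X -> _); set Y2 := (X in _ -> _ -> _ -> 0 <= X -> _).
move=> hF1 hF2 hY1 hY2.
(* The slack is a nonnegative combination of the two upwind remainders and the two Young
   remainders. *)
rewrite [X in 0 <= X](_ : _ = rho * F1 + mu0^-1 * F2 + rho * nux * Y1 +
    (etax / mu0 ^+ 2) * Y2); last first.
  rewrite /F1 /F2 /Y1 /Y2 /a !dotBr; field; rewrite ?gt_eqF //.
have mi : 0 <= mu0^-1 by rewrite invr_ge0 ltW.
have rn : 0 <= rho * nux by rewrite mulr_ge0 // ltW.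
have em : 0 <= etax / mu0 ^+ 2 by rewrite divr_ge0 // sqr_ge0.
by rewrite !addr_ge0 // mulr_ge0 // ltW.
Qed.

End pointwise.

(** * Energy decay *)

Section integral_calculus.
Context (R : realType) (m : nat) (T : mesh R m.+1).
Local Notation E := 'rV[R]_m.+1.
Local Notation vset := {set 'I_(nvert T)}.

(** Pairing integrability with the value lets a long linear combination be integrated by composing
    lemmas in the shape of the integrand. *)
Definition fvalue (F : vset) (f : E -> R) (v : R) :=
  fintegrable setT F f /\ fint setT F f = v.

Definition vvalue (K : vset) (f : E -> R) (v : R) :=
  vintegrable (open_simplex K) f /\ vint (open_simplex K) f = v.

Definition vfbm (F : vset) (a : E -> E) := forall j, fbm F (fun x => a x 0 j).

Section facet.
Context (F : vset) (cF : #|F| = m.+1).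

Lemma fvalueD f g a b : fvalue F f a -> fvalue F g b -> fvalue F (fun x => f x + g x) (a + b).
Proof. by move=> [vf <-] [vg <-]; split; [exact: fintegrableD|rewrite fintD]. Qed.

Lemma fvalueZ c f a : fvalue F f a -> fvalue F (fun x => c * f x) (c * a).
Proof. by move=> [vf <-]; split; [exact: fintegrableZ|rewrite fintZ]. Qed.

Lemma fvalueN f a : fvalue F f a -> fvalue F (fun x => - f x) (- a).
Proof.
move=> vf; have := fvalueZ (-1) vf; rewrite mulN1r.
by rewrite (_ : (fun x => -1 * f x) = (fun x => - f x)) //; apply/funext => x; rewrite mulN1r.
Qed.

Lemma fvalueB f g a b : fvalue F f a -> fvalue F g b -> fvalue F (fun x => f x - g x) (a - b).
Proof. by move=> vf vg; apply: fvalueD => //; exact: fvalueN. Qed.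

Lemma le_fvalue f g a b : fvalue F f a -> fvalue F g b ->
  (forall x, hull F x -> f x <= g x) -> a <= b.
Proof. by move=> [vf <-] [vg <-]; exact: le_fint. Qed.

Lemma vfbmB a b : vfbm F a -> vfbm F b -> vfbm F (fun x => a x - b x).
Proof.
move=> ba bb j; apply: (fbm_eq cF _ (fbmB cF (ba j) (bb j))) => x _.
by rewrite !mxE.
Qed.

Lemma vfbm_cst a : vfbm F (fun=> a).
Proof. by move=> j; exact: fbm_cst. Qed.

Lemma fbm_dot a b : vfbm F a -> vfbm F b -> fbm F (fun x => dot (a x) (b x)).
Proof. by move=> ba bb; apply: (fbm_sum cF) => j _; exact: (fbmM (ba j) (bb j)). Qed.

Lemma fbm_ddot_tens (S : E -> 'M[R]_m.+1) (v w : E -> E) :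
  (forall i j, fbm F (fun x => S x i j)) -> vfbm F v -> vfbm F w ->
  fbm F (fun x => ddot (S x) (tens (v x) (w x))).
Proof.
move=> bS bv bw; apply: (fbm_sum cF) => i _; apply: (fbm_sum cF) => j _.
apply: (fbm_eq cF _ (fbmM (bS i j) (fbmM (bv i) (bw j)))) => x _.
by rewrite mxE.
Qed.

Lemma vfbm_mvmul (S : E -> 'M[R]_m.+1) (a : E) :
  (forall i j, fbm F (fun x => S x i j)) -> vfbm F (fun x => mvmul (S x) a).
Proof.
move=> bS j.
have H : fbm F (fun x => \sum_i a 0 i * S x j i).
  by apply: (fbm_sum cF) => i _; apply: fbmM; [exact: fbm_cst|exact: bS].
apply: (fbm_eq cF _ H) => x _.
by rewrite mxE; apply: eq_bigr => i _; rewrite mxE.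
Qed.

End facet.

Section volume.
Context (K : vset) (cK : #|K| = m.+2) (aK : affinely_independent K).

Lemma vvalueD f g a b : vvalue K f a -> vvalue K g b -> vvalue K (fun x => f x + g x) (a + b).
Proof. by move=> [vf <-] [vg <-]; split; [exact: vintegrableD|rewrite (vintD cK aK)]. Qed.

Lemma vvalueZ c f a : vvalue K f a -> vvalue K (fun x => c * f x) (c * a).
Proof.
move=> [vf <-]; split; last by rewrite (vintZ cK aK).
by apply: vintegrableM => //; exact: pfun_cst.
Qed.

Lemma vvalueB f g a b : vvalue K f a -> vvalue K g b -> vvalue K (fun x => f x - g x) (a - b).
Proof.
move=> vf vg; have := vvalueD vf (vvalueZ (-1) vg); rewrite mulN1r.
by rewrite (_ : (fun x => f x + -1 * g x) = (fun x => f x - g x)) //;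
  apply/funext => x; rewrite mulN1r.
Qed.

Lemma eq_vvalue f g a b : (forall x, open_simplex K x -> f x = g x) ->
  vvalue K f a -> vvalue K g b -> a = b.
Proof. by move=> fg [_ <-] [_ <-]; exact: eq_vint. Qed.

Lemma vvalue_pfun f : pfun f -> vvalue K f (vint (open_simplex K) f).
Proof. by move=> pf; split => //; exact: vintegrable_pfun. Qed.

Lemma vintegrable_eq f g : (forall x, open_simplex K x -> f x = g x) ->
  vintegrable (open_simplex K) f -> vintegrable (open_simplex K) g.
Proof.
move=> fg; apply: eq_integrable; first exact: measurable_open_simplex.
by move=> y; rewrite inE => Oy; rewrite fg.
Qed.

End volume.

(** Grouped by facet, the contributions of the elements on its two sides can cancel. *)
Lemma sum_facets (V : nmodType) (f : vset -> vset -> V) :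
  \sum_(K in elements T) \sum_(F in facets K) f K F =
  \sum_(F in mesh_facets T) \sum_(K in elements T | F \in facets K) f K F.
Proof.
rewrite (exchange_big_dep (fun F => F \in mesh_facets T)) //= => K F KT FK.
by apply/finset.bigcupP; exists K.
Qed.

End integral_calculus.

(** The letters [i], [a], [c] denote the volume, flux and symmetrisation parts of an equation, with
    1 and 2 for momentum on elements and facets, 5 and 6 for induction; [n2], [n6] are the
    corrections on [GammaN] and [d6] is the magnetic trace term. Further, [e] is the energy rate,
    [v1], [v2] the dissipation, [t1], [t2] the facet side of the trace inequalities, [ph], [rh] the
    pressure terms, [mm] the flux of the trace energy and [g] the flux of the element energy. The
    facet equations are subtracted, so that fluxes act on jumps. *)
Lemma energy_balance (R : realDomainType)
    (r s e v1 v2 t1 t2 ph rh mm g i1 a1 c1 a2 n2 i5 a5 c5 a6 d6 n6 : R) :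
  i1 + a1 - c1 = 0 -> a2 - n2 = 0 -> i5 + a5 - c5 = 0 -> a6 - d6 - n6 = 0 ->
  ph = 0 -> rh = 0 -> mm = 0 -> t1 <= v1 -> t2 <= v2 ->
  r * i1 + s * i5 = e + v1 + v2 - g ->
  - t1 - t2 + r * ph + s * rh - mm + g <=
  r * a1 - r * a2 - r * c1 + s * a5 - s * a6 - s * c5 + s * d6 + r * n2 + s * n6 ->
  e <= 0.
Proof.
move=> S1 S2 S5 S6 -> -> -> L1 L2 VI FI.
have E1 : r * (i1 + a1 - c1) = 0 by rewrite S1 mulr0.
have E2 : r * (a2 - n2) = 0 by rewrite S2 mulr0.
have E5 : s * (i5 + a5 - c5) = 0 by rewrite S5 mulr0.
have E6 : s * (a6 - d6 - n6) = 0 by rewrite S6 mulr0.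
by lra.
Qed.

(** * Summation over elements and facets *)

Section balance.
Context (R : realDomainType) (m : nat) (V : realType) (T : mesh V m).
Local Notation vset := {set 'I_(nvert T)}.

Lemma sum_volume_balance (r s : R) (e v1 v2 g i1 i5 : vset -> R) :
  (forall K, K \in elements T -> r * i1 K + s * i5 K = e K + v1 K + v2 K - g K) ->
  r * (\sum_(K in elements T) i1 K) + s * (\sum_(K in elements T) i5 K) =
  \sum_(K in elements T) e K + \sum_(K in elements T) v1 K +
  \sum_(K in elements T) v2 K - \sum_(K in elements T) g K.
Proof.
move=> H; rewrite !mulr_sumr -big_split /= -!big_split /= -sumrB.
exact: eq_bigr.
Qed.

Let sum2D (f g : vset -> vset -> R) :
  \sum_(K in elements T) \sum_(F in facets K) (f K F + g K F) =
  \sum_(K in elements T) \sum_(F in facets K) f K F +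
  \sum_(K in elements T) \sum_(F in facets K) g K F.
Proof. by rewrite -big_split; apply: eq_bigr => K _; rewrite -big_split. Qed.

Let sum2Z c (f : vset -> vset -> R) :
  \sum_(K in elements T) \sum_(F in facets K) (c * f K F) =
  c * \sum_(K in elements T) \sum_(F in facets K) f K F.
Proof. by rewrite mulr_sumr; apply: eq_bigr => K _; rewrite mulr_sumr. Qed.

Let sum2N (f : vset -> vset -> R) :
  \sum_(K in elements T) \sum_(F in facets K) (- f K F) =
  - \sum_(K in elements T) \sum_(F in facets K) f K F.
Proof. by rewrite -sumrN; apply: eq_bigr => K _; rewrite sumrN. Qed.

Lemma sum_facet_balance (r s : R)
    (t1 t2 ph rh mm g a1 a2 c1 a5 a6 c5 d6 n2 n6 : vset -> vset -> R) :
  let S f := \sum_(K in elements T) \sum_(F in facets K) f K F in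
  (forall K F, K \in elements T -> F \in facets K ->
    - t1 K F - t2 K F + r * ph K F + s * rh K F - mm K F + g K F <=
    r * a1 K F - r * a2 K F - r * c1 K F + s * a5 K F - s * a6 K F - s * c5 K F +
    s * d6 K F + r * n2 K F + s * n6 K F) ->
  - S t1 - S t2 + r * S ph + s * S rh - S mm + S g <=
  r * S a1 - r * S a2 - r * S c1 + s * S a5 - s * S a6 - s * S c5 +
  s * S d6 + r * S n2 + s * S n6.
Proof.
move=> S H.
have := ler_sum (index_enum _) (fun K KT => ler_sum (index_enum _) (fun F FK => H K F KT FK)).
by rewrite !(sum2D, sum2N, sum2Z).
Qed.

End balance.

(** * The energy law of a solution at a fixed time *)

Section energy_decay.
Context (R : realType) (m k : nat) (P : mhd_data R m.+1) (T : mesh R m.+1).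
Local Notation E := 'rV[R]_m.+1.
Local Notation vset := {set 'I_(nvert T)}.
Context (n : vset -> vset -> E) (Cpen : R) (X : discrete_state T).
Context (adm : admissible_data P T)
  (normal : forall K F, K \in elements T -> F \in facets K ->
    outward_unit_normal K F (n K F))
  (Cpen_gt0 : 0 < Cpen)
  (f_v0 : forall x (t : R), Omega P x -> 0 < t -> f_v P x t = 0)
  (f_m0 : forall x (t : R), Omega P x -> 0 < t -> f_m P x t = 0)
  (g_v0 : forall x (t : R), GammaD P x -> 0 < t -> g_v P x t = 0)
  (g_m0 : forall x (t : R), GammaD P x -> 0 < t -> g_m P x t = 0)
  (h_v0 : forall x (t : R), GammaN P x -> 0 < t -> h_v P x t = 0)
  (h_m0 : forall x (t : R), GammaN P x -> 0 < t -> h_m P x t = 0)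
  (Cpen_large : large_penalty k P n Cpen)
  (sol : hdg_solution k P n Cpen X) (t : R) (t0 : 0 < t).
Local Notation rho := (rho P).
Local Notation mu0 := (mu0 P).
Local Notation O K := (open_simplex K).
Local Notation h K := (diameter (open_simplex K)).
Local Notation u := (uh X t).
Local Notation u' := (uhat X t).
Local Notation B := (Bh X t).
Local Notation B' := (Bhat X t).
Local Notation nux x := (nu P x t).
Local Notation etax x := (eta P x t).

Let tri := adm_mesh adm.

Let cK K : K \in elements T -> #|K| = m.+2.
Proof. exact: (tri_card tri). Qed.

Let aK K : K \in elements T -> affinely_independent K.
Proof. exact: (tri_indep tri). Qed.

Let cF K F : K \in elements T -> F \in facets K -> #|F| = m.+1.
Proof.
by move=> /cK c /imsetP[b bK ->]; move: c; rewrite (cardsD1 b) bK add1n => -[].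
Qed.

Let cFm F : F \in mesh_facets T -> #|F| = m.+1.
Proof. by move=> /finset.bigcupP[K KT FK]; exact: cF KT FK. Qed.

Let facet_mesh K F : K \in elements T -> F \in facets K -> F \in mesh_facets T.
Proof. by move=> KT FK; apply/finset.bigcupP; exists K. Qed.

Let facet_closure K F x : K \in elements T -> F \in facets K -> hull F x ->
  closure (Omega P) x.
Proof.
move=> KT /imsetP[b bK FE] Fx; apply: (closure_subset (tri_sub tri KT)).
apply: (hull_closure (cK KT)); apply: hull_mono Fx; rewrite FE.
exact: subD1set.
Qed.

Let pu K j : K \in elements T -> pfun (fun x => u K x 0 j).
Proof. by move=> KT; apply: poly_onT_pfun; exact: (sol_uh sol (ltW t0) KT j). Qed.

Let pB K j : K \in elements T -> pfun (fun x => B K x 0 j).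
Proof. by move=> KT; apply: poly_onT_pfun; exact: (sol_Bh sol (ltW t0) KT j). Qed.

Let bu' F : F \in mesh_facets T -> vfbm F (u' F).
Proof. by move=> FT j; apply: fbm_poly_on (sol_uhat sol (ltW t0) FT j); exact: cFm. Qed.

Let bB' F : F \in mesh_facets T -> vfbm F (B' F).
Proof. by move=> FT j; apply: fbm_poly_on (sol_Bhat sol (ltW t0) FT j); exact: cFm. Qed.

Let pgrad (w : E -> E) i j : (forall j, pfun (fun x => w x 0 j)) ->
  pfun (fun x => sgrad w x i j) /\ pfun (fun x => agrad w x i j).
Proof.
move=> pw; have pg i' j' : pfun (fun x => grad w x i' j').
  rewrite (_ : (fun _ => _) = 'D_(delta_mx 0 i') (fun x => w x 0 j')).
    exact: pfun_derive.
  by apply/funext => x; rewrite mxE.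
split.
  rewrite (_ : (fun _ => _) = fun x => 2^-1 * (grad w x i j + grad w x j i)).
    by apply: pfunM; [exact: pfun_cst|exact: pfunD].
  by apply/funext => x; rewrite !mxE.
rewrite (_ : (fun _ => _) = fun x => 2^-1 * (grad w x i j - grad w x j i)).
  by apply: pfunM; [exact: pfun_cst|exact: pfunB].
by apply/funext => x; rewrite !mxE.
Qed.

Definition W K x := (2^-1 * (rho * dot (u K x) (u K x) + mu0^-1 * dot (B K x) (B K x))) *: u K x.

(** Energy density of the facet unknowns. It has one value for both neighbouring elements, so the
    jump of the normal velocity factors out of its flux. *)
Definition mean_energy F x := 2^-1 * (rho * dot (u' F x) (u' F x) + mu0^-1 * dot (B' F x) (B' F x)).

(** This is [facet_pointwise] integrated. Integrability comes from splitting each flux into a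
    bounded part and a bounded multiple of [nu] or [eta]; integrals over [GammaN] become integrals
    over the facet with its indicator as [chi]. *)
Lemma facet_inequality K F : K \in elements T -> F \in facets K ->
  - fint setT F (fun x => 2 * (h K / Cpen) * rho * nux x *
       enorm (mvmul (sgrad (u K) x) (n K F)) ^+ 2)
  - fint setT F (fun x => 2 * (h K / Cpen) * (etax x / mu0 ^+ 2) *
       enorm (mvmul (agrad (B K) x) (n K F)) ^+ 2)
  + rho * fint setT F (fun x => rho^-1 * dot (u K x - u' F x) (n K F) * phat X t F x)
  + mu0^-1 * fint setT F (fun x => dot (B K x - B' F x) (n K F) * rhat X t F x)
  - fint setT F (fun x => (1 - \1_(GammaN P) x) * (dot (u K x) (n K F) * mean_energy F x))
  + fint setT F (fun x => dot (W K x) (n K F)) <=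
  rho * fint setT F (fun x => ddot (momentum_flux P n Cpen X t K F x) (tens (n K F) (u K x)))
  - rho * fint setT F (fun x => ddot (momentum_flux P n Cpen X t K F x) (tens (n K F) (u' F x)))
  - rho * fint setT F (fun x => 2 * nux x * ddot (tens (n K F) (u K x - u' F x)) (sgrad (u K) x))
  + mu0^-1 * fint setT F (fun x => ddot (induction_flux P n Cpen X t K F x) (tens (n K F) (B K x)))
  - mu0^-1 * fint setT F (fun x => ddot (induction_flux P n Cpen X t K F x) (tens (n K F) (B' F x)))
  - mu0^-1 * fint setT F (fun x => 2 * (etax x / mu0) *
       ddot (tens (n K F) (B K x - B' F x)) (agrad (B K) x))
  + mu0^-1 * fint setT F (fun x => ddot (tens (B' F x) (B' F x) -
       (2^-1 * dot (B' F x) (B' F x))%:M) (tens (n K F) (u K x - u' F x)))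
  + rho * fint (GammaN P) F (fun x => ddot ((1 - lam n X t K F x) *: tens (u K x) (u' F x))
       (tens (n K F) (u' F x)))
  + mu0^-1 * fint (GammaN P) F (fun x => ddot ((1 - lam n X t K F x) *: tens (u K x) (B' F x))
       (tens (n K F) (B' F x))).
Proof.
move=> KT FK; have c := cF KT FK; have FT := facet_mesh KT FK.
have vu : vfbm F (u K) by move=> j; apply: fbm_pfun; exact: pu.
have vB : vfbm F (B K) by move=> j; apply: fbm_pfun; exact: pB.
have vu' := bu' FT; have vB' := bB' FT.
have bS i j : fbm F (fun x => sgrad (u K) x i j).
  by apply: fbm_pfun; have [] := @pgrad (u K) i j (fun j => pu j KT).
have bA i j : fbm F (fun x => agrad (B K) x i j).
  by apply: fbm_pfun; have [] := @pgrad (B K) i j (fun j => pB j KT).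
have vn : vfbm F (fun=> n K F) by exact: vfbm_cst.
have bp : fbm F (phat X t F) by apply: (fbm_poly_on c (sol_phat sol (ltW t0) FT)).
have br : fbm F (rhat X t F) by apply: (fbm_poly_on c (sol_rhat sol (ltW t0) FT)).
have bl : fbm F (lam n X t K F) by apply: fbm_lt0; exact: (fbm_dot c).
have bchi : fbm F \1_(GammaN P) by apply: fbm_indic; exact: (adm_GammaN adm FT).
have bc a : fbm F (fun=> a) by exact: fbm_cst.
have inu : fintegrable setT F (fun x => nux x) by exact: adm_nu_fint adm _ _ t0 FT.
have ieta : fintegrable setT F (fun x => etax x) by exact: adm_eta_fint adm _ _ t0 FT.
have vsu := vfbmB c vu vu'; have vsB := vfbmB c vB vB'.
have bd := fbm_dot c; have bDD := fbmD (F := F); have bMM := fbmM (F := F).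
have bBB := fbmB c.
have refl f : fintegrable setT F f -> fvalue F f (fint setT F f) by [].
have bme : fbm F (mean_energy F).
  by apply: (bMM) => //; apply: (bDD); apply: (bMM) => //; exact: bd.
have iflux v : vfbm F v ->
    fintegrable setT F (fun x => ddot (momentum_flux P n Cpen X t K F x) (tens (n K F) (v x))).
  move=> bv.
  apply: (fintegrable_eq c (f := fun x =>
    ((1 - lam n X t K F x) * (dot (u K x) (n K F) * dot (u K x) (v x))
     + lam n X t K F x * (dot (u K x) (n K F) * dot (u' F x) (v x))
     + rho^-1 * (phat X t F x * dot (n K F) (v x))
     - (rho * mu0)^-1 * (dot (B' F x) (n K F) * dot (B' F x) (v x)
                         - 2^-1 * (dot (B' F x) (B' F x) * dot (n K F) (v x))))
    + (2 * (Cpen / h K) * (dot (n K F) (n K F) * dot (u K x - u' F x) (v x))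
       - 2 * ddot (sgrad (u K) x) (tens (n K F) (v x))) * nux x)).
    by move=> x _; rewrite momentum_fluxE; ring.
  apply: fintegrableD; last first.
    apply: fintegrableM => //; apply: (bBB); apply: (bMM) => //.
      by apply: (bMM); exact: bd.
    exact: fbm_ddot_tens.
  apply: fbm_fintegrable; apply: (bBB).
    apply: (bDD); first apply: (bDD).
    - by apply: (bMM); [exact: bBB|apply: (bMM); exact: bd].
    - by apply: (bMM) => //; apply: (bMM); exact: bd.
    - by apply: (bMM) => //; apply: (bMM) => //; exact: bd.
  apply: (bMM) => //; apply: (bBB); first by apply: (bMM); exact: bd.
  by apply: (bMM) => //; apply: (bMM); exact: bd.
have iiflux v : vfbm F v ->
    fintegrable setT F (fun x => ddot (induction_flux P n Cpen X t K F x) (tens (n K F) (v x))).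
  move=> bv.
  apply: (fintegrable_eq c (f := fun x =>
    ((1 - lam n X t K F x) * (dot (u K x) (n K F) * dot (B K x) (v x))
     + lam n X t K F x * (dot (u K x) (n K F) * dot (B' F x) (v x))
     + rhat X t F x * dot (n K F) (v x))
    + (2 / mu0 * (Cpen / h K) * (dot (n K F) (n K F) * dot (B K x - B' F x) (v x))
       - 2 / mu0 * ddot (agrad (B K) x) (tens (n K F) (v x))) * etax x)).
    by move=> x _; rewrite induction_fluxE; ring.
  apply: fintegrableD; last first.
    apply: fintegrableM => //; apply: (bBB); apply: (bMM) => //.
      by apply: (bMM); exact: bd.
    exact: fbm_ddot_tens.
  apply: fbm_fintegrable.
  apply: (bDD); first apply: (bDD).
  - by apply: (bMM); [exact: bBB|apply: (bMM); exact: bd].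
  - by apply: (bMM) => //; apply: (bMM); exact: bd.
  - by apply: (bMM) => //; exact: bd.
have itr1 : fintegrable setT F (fun x => 2 * (h K / Cpen) * rho * nux x *
       enorm (mvmul (sgrad (u K) x) (n K F)) ^+ 2).
  apply: (fintegrable_eq c (f := fun x => (2 * (h K / Cpen) * rho *
     dot (mvmul (sgrad (u K) x) (n K F)) (mvmul (sgrad (u K) x) (n K F))) * nux x)).
    by move=> x _; rewrite enorm_sqr; ring.
  by apply: fintegrableM => //; apply: (bMM) => //; apply: (bd); exact: vfbm_mvmul.
have itr2 : fintegrable setT F (fun x => 2 * (h K / Cpen) * (etax x / mu0 ^+ 2) *
       enorm (mvmul (agrad (B K) x) (n K F)) ^+ 2).
  apply: (fintegrable_eq c (f := fun x => (2 * (h K / Cpen) / mu0 ^+ 2 *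
     dot (mvmul (agrad (B K) x) (n K F)) (mvmul (agrad (B K) x) (n K F))) * etax x)).
    by move=> x _; rewrite enorm_sqr; ring.
  by apply: fintegrableM => //; apply: (bMM) => //; apply: (bd); exact: vfbm_mvmul.
have ic1 : fintegrable setT F (fun x => 2 * nux x *
    ddot (tens (n K F) (u K x - u' F x)) (sgrad (u K) x)).
  apply: (fintegrable_eq c (f := fun x => (2 *
    ddot (sgrad (u K) x) (tens (n K F) (u K x - u' F x))) * nux x)).
    by move=> x _; rewrite ddotC; ring.
  by apply: fintegrableM => //; apply: (bMM) => //; exact: fbm_ddot_tens.
have ic5 : fintegrable setT F (fun x => 2 * (etax x / mu0) *
       ddot (tens (n K F) (B K x - B' F x)) (agrad (B K) x)).
  apply: (fintegrable_eq c (f := fun x => (2 / mu0 *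
    ddot (agrad (B K) x) (tens (n K F) (B K x - B' F x))) * etax x)).
    by move=> x _; rewrite ddotC; ring.
  by apply: fintegrableM => //; apply: (bMM) => //; exact: fbm_ddot_tens.
have id6 : fintegrable setT F (fun x => ddot (tens (B' F x) (B' F x) -
       (2^-1 * dot (B' F x) (B' F x))%:M) (tens (n K F) (u K x - u' F x))).
  apply: fbm_fintegrable.
  apply: (fbm_eq c (f := fun x => dot (B' F x) (n K F) * dot (B' F x) (u K x - u' F x) -
    2^-1 * dot (B' F x) (B' F x) * dot (n K F) (u K x - u' F x))).
    by move=> x _; rewrite ddotDl ddotNl ddot_tens ddot_scalar_tens.
  apply: (bBB); first by apply: (bMM); exact: bd.
  by apply: (bMM); [apply: (bMM) => //|]; exact: bd.
have in2 w : vfbm F w -> fvalue F (fun x => \1_(GammaN P) x *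
    ddot ((1 - lam n X t K F x) *: tens (u K x) (w x)) (tens (n K F) (w x)))
    (fint (GammaN P) F (fun x => ddot ((1 - lam n X t K F x) *: tens (u K x) (w x))
      (tens (n K F) (w x)))).
  move=> bw; split; last by rewrite -fint_indic.
  apply: fbm_fintegrable; apply: (bMM) => //.
  apply: (fbm_eq c (f := fun x => (1 - lam n X t K F x) *
    (dot (u K x) (n K F) * dot (w x) (w x)))).
    by move=> x _; rewrite ddotZl ddot_tens.
  by apply: (bMM); [exact: bBB|apply: (bMM); exact: bd].
have iph : fintegrable setT F (fun x => rho^-1 * dot (u K x - u' F x) (n K F) * phat X t F x).
  by apply: fbm_fintegrable; apply: (bMM) => //; apply: (bMM) => //; exact: bd.
have irh : fintegrable setT F (fun x => dot (B K x - B' F x) (n K F) * rhat X t F x).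
  by apply: fbm_fintegrable; apply: (bMM) => //; exact: bd.
have imm : fintegrable setT F (fun x => (1 - \1_(GammaN P) x) *
    (dot (u K x) (n K F) * mean_energy F x)).
  apply: fbm_fintegrable; apply: (bMM); first exact: bBB.
  by apply: (bMM) => //; exact: bd.
have iG : fintegrable setT F (fun x => dot (W K x) (n K F)).
  apply: fbm_fintegrable.
  apply: (fbm_eq c (f := fun x => 2^-1 * (rho * dot (u K x) (u K x) +
    mu0^-1 * dot (B K x) (B K x)) * dot (u K x) (n K F))).
    by move=> x _; rewrite [RHS]dotC dotZr [dot (n K F) _]dotC.
  apply: (bMM); last exact: bd.
  by apply: (bMM) => //; apply: (bDD); apply: (bMM) => //; exact: bd.
have HL := fvalueD (fvalueB (fvalueD (fvalueD (fvalueB (fvalueN (refl _ itr1)) (refl _ itr2))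
  (fvalueZ rho (refl _ iph))) (fvalueZ mu0^-1 (refl _ irh))) (refl _ imm)) (refl _ iG).
have HR := fvalueD (fvalueD (fvalueD (fvalueB (fvalueB (fvalueD (fvalueB (fvalueB
  (fvalueZ rho (refl _ (iflux _ vu))) (fvalueZ rho (refl _ (iflux _ vu'))))
  (fvalueZ rho (refl _ ic1))) (fvalueZ mu0^-1 (refl _ (iiflux _ vB))))
  (fvalueZ mu0^-1 (refl _ (iiflux _ vB')))) (fvalueZ mu0^-1 (refl _ ic5)))
  (fvalueZ mu0^-1 (refl _ id6))) (fvalueZ rho (in2 _ vu'))) (fvalueZ mu0^-1 (in2 _ vB')).
apply: (le_fvalue c HL HR) => x Fx.
have xc := facet_closure KT FK Fx.
apply: facet_pointwise => //.
- exact: adm_rho adm.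
- exact: adm_mu0 adm.
- exact: adm_nu_ge0 adm _ _ xc t0.
- exact: adm_eta_ge0 adm _ _ xc t0.
- exact: diameter_gt0 (cK KT) (aK KT).
- by have [] := normal KT FK.
Qed.

(** Extended by zero outside [K], the divergence is an admissible test function of degree [k.-1], so
    its square integrates to zero; the weight [s] may then have any degree. *)
Lemma div_orth (w : vset -> E -> E) K (s : E -> R) : K \in elements T ->
  vbroken k w -> (forall q, sbroken k.-1 q ->
    \sum_(K in elements T) vint (O K) (fun x => q K x * divergence (w K) x) = 0) ->
  pfun s -> vint (O K) (fun x => divergence (w K) x * s x) = 0.
Proof.
move=> KT bw mass ps.
have pdiv : poly_on k.-1 setT (divergence (w K)).
  rewrite (_ : divergence (w K) = fun x => \sum_i 'D_(delta_mx 0 i) (fun y => w K y 0 i) x).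
    by apply: poly_on_sum => i _; apply: poly_on_derive; exact: bw.
  by apply/funext => x; apply: eq_bigr => i _; rewrite mxE.
apply: (vint_orth (cK KT) (aK KT)) => //; first exact: poly_onT_pfun pdiv.
have := mass (fun K' x => if K' == K then divergence (w K) x else 0).
rewrite (bigD1 K) //= eqxx big1 => [|K' /andP[K'T /negPf ->]]; last first.
  under eq_fun do rewrite mul0r.
  by rewrite /vint Rintegral_cst ?mul0r //; exact: (measurable_open_simplex (cK K'T) (aK K'T)).
rewrite addr0; apply => K' K'T; case: eqP => _ //; exact: poly_on0.
Qed.

Lemma derive1_coord (f : R -> E) j : derivable f t 1 ->
  derivable (fun s => f s 0 j) t 1 /\
  (derive1 f t) 0 j = derive1 (fun s => f s 0 j) t.
Proof.
move=> df; split; first by have /derivable_mxP := df; apply.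
by rewrite !derive1E derive_mx // mxE.
Qed.

Definition power K x :=
  rho * dot (derive1 (fun s => uh X s K x) t) (u K x) +
  mu0^-1 * dot (derive1 (fun s => Bh X s K x) t) (B K x).

Let sqr_derive (w : R -> vset -> E -> E) K j : K \in elements T ->
  (forall s, 0 <= s -> vbroken k (w s)) ->
  (forall x, derivable (fun s => w s K x) t 1) ->
  pfun (fun x => (derive1 (fun s => w s K x) t) 0 j) /\
  is_derive t 1 (fun s => vint (O K) (fun x => w s K x 0 j * w s K x 0 j))
    (2 * vint (O K) (fun x => (derive1 (fun s => w s K x) t) 0 j * w t K x 0 j)).
Proof.
move=> KT bw dw.
have E1 : (fun x => (derive1 (fun s => w s K x) t) 0 j) =
    (fun x => derive1 (fun s => w s K x 0 j) t).
  by apply/funext => x; have [_ ->] := derive1_coord j (dw x).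
have E2 : (fun x => (derive1 (fun s => w s K x) t) 0 j * w t K x 0 j) =
    (fun x => derive1 (fun s => w s K x 0 j) t * w t K x 0 j).
  by apply/funext => x; have [_ ->] := derive1_coord j (dw x).
rewrite E1 E2.
apply: (is_derive_vint_sqr (cK KT) (aK KT) (k := k) (f := fun s x => w s K x 0 j) t0).
- by move=> s s0; exact: bw.
- by move=> x; have [] := derive1_coord j (dw x).
Qed.

Let dpu K j : K \in elements T ->
  pfun (fun x => (derive1 (fun s => uh X s K x) t) 0 j).
Proof.
move=> KT; have [] := @sqr_derive (uh X) K j KT (fun s => sol_uh sol (t := s))
  (fun x => sol_uh_diff sol t0 KT); by [].
Qed.

Let dpB K j : K \in elements T ->
  pfun (fun x => (derive1 (fun s => Bh X s K x) t) 0 j).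
Proof.
move=> KT; have [] := @sqr_derive (Bh X) K j KT (fun s => sol_Bh sol (t := s))
  (fun x => sol_Bh_diff sol t0 KT); by [].
Qed.

Let vint_dot (v w : E -> E) K : K \in elements T ->
  (forall j, pfun (fun x => v x 0 j)) -> (forall j, pfun (fun x => w x 0 j)) ->
  vint (O K) (fun x => dot (v x) (w x)) = \sum_j vint (O K) (fun x => v x 0 j * w x 0 j).
Proof.
move=> KT pv pw; rewrite (vint_sum (cK KT) (aK KT)) // => j _.
by apply: vintegrable_pfun; [exact: cK|exact: aK|exact: pfunM].
Qed.

Lemma is_derive_energy :
  is_derive t 1 (energy P X) (\sum_(K in elements T) vint (O K) (power K)).
Proof.
have near_pos : \forall s \near t, 0 <= s.
  by near=> s; apply/ltW; near: s; exact: lt_nbhsr.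
pose D (w : R -> vset -> E -> E) K j s := vint (O K) (fun x => w s K x 0 j * w s K x 0 j).
apply: (near_eq_is_derive (f := fun s => \sum_(K in elements T)
  2^-1 * (rho * \sum_j D (uh X) K j s + mu0^-1 * \sum_j D (Bh X) K j s))).
  near=> s; have s0 : 0 <= s by near: s.
  apply: eq_bigr => K KT.
  have pus j : pfun (fun x => uh X s K x 0 j) by apply: poly_onT_pfun; exact: (sol_uh sol s0 KT j).
  have pBs j : pfun (fun x => Bh X s K x 0 j) by apply: poly_onT_pfun; exact: (sol_Bh sol s0 KT j).
  have vp f (pf : pfun f) := vvalue_pfun (cK KT) (aK KT) pf.
  have := vvalueZ (cK KT) (aK KT) 2^-1 (vvalueD (cK KT) (aK KT)
    (vvalueZ (cK KT) (aK KT) rho (vp _ (pfun_dot pus pus)))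
    (vvalueZ (cK KT) (aK KT) mu0^-1 (vp _ (pfun_dot pBs pBs)))).
  rewrite (vint_dot KT pus pus) (vint_dot KT pBs pBs) => -[_ <-].
  by apply: eq_vint => x _; rewrite !enorm_sqr.
rewrite -fct_sumE; elim/big_ind2: _.
- exact: is_derive_cst.
- by move=> f1 d1 f2 d2 ? ?; exact: is_deriveD.
- move=> K KT.
  have dsum (w : R -> vset -> E -> E) : (forall s, 0 <= s -> vbroken k (w s)) ->
      (forall x, derivable (fun s => w s K x) t 1) ->
      is_derive t 1 (fun s => \sum_j D w K j s)
        (2 * vint (O K) (fun x => dot (derive1 (fun s => w s K x) t) (w t K x))).
    move=> bw dw; rewrite vint_dot //; last 2 first.
    - by move=> j; have [] := sqr_derive j KT bw dw.
    - by move=> j; apply: poly_onT_pfun; exact: (bw t (ltW t0) K KT j).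
    rewrite mulr_sumr -fct_sumE; elim/big_ind2: _.
    - exact: is_derive_cst.
    - by move=> f1 d1 f2 d2 ? ?; exact: is_deriveD.
    - by move=> j _; have [] := sqr_derive j KT bw dw.
  have du := dsum (uh X) (fun s => sol_uh sol (t := s)) (fun x => sol_uh_diff sol t0 KT).
  have dB := dsum (Bh X) (fun s => sol_Bh sol (t := s)) (fun x => sol_Bh_diff sol t0 KT).
  apply: (is_derive_eq (is_deriveZ 2^-1 (is_deriveD (is_deriveZ rho du) (is_deriveZ mu0^-1 dB)))).
  have vp f (pf : pfun f) := vvalue_pfun (cK KT) (aK KT) pf.
  have [_ ->] := vvalueD (cK KT) (aK KT)
    (vvalueZ (cK KT) (aK KT) rho (vp _ (pfun_dot (fun j => dpu j KT) (fun j => pu j KT))))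
    (vvalueZ (cK KT) (aK KT) mu0^-1 (vp _ (pfun_dot (fun j => dpB j KT) (fun j => pB j KT)))).
  by rewrite /GRing.scale /=; field; rewrite gt_eqF //; exact: adm_mu0 adm.
Unshelve. all: by end_near. Qed.

Lemma volume_identity K : K \in elements T ->
  rho * vint (O K) (fun x =>
     dot (derive1 (fun s => uh X s K x) t) (u K x)
     - ddot (tens (u K x) (u K x)) (grad (u K) x)
     - ddot ((rho^-1 * ph X t K x)%:M) (grad (u K) x)
     + 2 * nux x * ddot (sgrad (u K) x) (sgrad (u K) x)
     + ddot (maxwell P (B K x)) (grad (u K) x)
     - dot (f_v P x t) (u K x)) +
  mu0^-1 * vint (O K) (fun x =>
     dot (derive1 (fun s => Bh X s K x) t) (B K x)
     - ddot (tens (u K x) (B K x)) (grad (B K) x)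
     - ddot ((rh X t K x)%:M) (grad (B K) x)
     + 2 * (etax x / mu0) * ddot (agrad (B K) x) (agrad (B K) x)
     - ddot (tens (B K x) (B K x)) (grad (u K) x)
     - dot (f_m P x t) (B K x)) =
  vint (O K) (power K)
  + vint (O K) (fun x => 2 * rho * nux x * fnorm (sgrad (u K) x) ^+ 2)
  + vint (O K) (fun x => 2 * (etax x / mu0 ^+ 2) * fnorm (agrad (B K) x) ^+ 2)
  - \sum_(F in facets K) fint setT F (fun x => dot (W K x) (n K F)).
Proof.
move=> KT; have c := cK KT; have a := aK KT.
have pu0 j := pu j KT; have pB0 j := pB j KT.
have r0 := adm_rho adm; have m0 := adm_mu0 adm.
have pp : pfun (ph X t K) by apply: poly_onT_pfun; exact: (sol_ph sol (ltW t0) KT).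
have pr : pfun (rh X t K) by apply: poly_onT_pfun; exact: (sol_rh sol (ltW t0) KT).
have pW j : pfun (fun x => W K x 0 j).
  rewrite (_ : (fun _ => _) = fun x => (2^-1 * (rho * dot (u K x) (u K x) +
      mu0^-1 * dot (B K x) (B K x))) * u K x 0 j); last by apply/funext => x; rewrite mxE.
  apply: pfunM => //; apply: pfunM; first exact: pfun_cst.
  by apply: pfunD; apply: pfunM; rewrite ?pfun_dot; [exact: pfun_cst|exact: pfun_dot|exact: pfun_cst|exact: pfun_dot].
rewrite -(divergence_theorem c a (n := fun F => n K F)) //; last first.
  by move=> F FK; exact: normal.
have vp f (pf : pfun f) := vvalue_pfun c a pf.
have pdu : pfun (divergence (u K)) by exact: pfun_divergence.
have pdB : pfun (divergence (B K)) by exact: pfun_divergence.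
(* [ps1] collects all factors of the velocity divergence: the remainder of the energy flux, the
   pressure and the isotropic part of the Maxwell stress. [ps2] is the corresponding factor of the
   magnetic divergence. *)
have ps1 : pfun (fun x => 2^-1 * (rho * dot (u K x) (u K x) + mu0^-1 * dot (B K x) (B K x))
    - ph X t K x - mu0^-1 * (2^-1 * dot (B K x) (B K x))).
  have pc (z : R) : pfun (fun _ : E => z) by exact: pfun_cst.
  have puu := pfun_dot pu0 pu0; have pBB := pfun_dot pB0 pB0.
  apply: pfunB; first (apply: pfunB => //; apply: pfunM => //; apply: pfunD; exact: pfunM).
  by apply: pfunM => //; exact: pfunM.
have ps2 : pfun (fun x => - mu0^-1 * rh X t K x) by apply: pfunM => //; exact: pfun_cst.
have z1 := vp _ (pfunM pdu ps1); rewrite (div_orth KT (sol_uh sol (ltW t0)) _ ps1) in z1; last first.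
  (* The factor [rho] in the test function compensates the weight [rho^-1] of the mass equation. *)
  move=> q Qq; rewrite -[RHS](sol_mass sol t0 (q := fun K x => rho * q K x)); last first.
    by move=> K' K'T; apply: poly_onZ; exact: Qq.
  by apply: eq_bigr => K' _; apply: eq_vint => x _; field; rewrite gt_eqF.
have z2 := vp _ (pfunM pdB ps2); rewrite (div_orth KT (sol_Bh sol (ltW t0)) _ ps2) in z2; last first.
  by move=> q Qq; exact: (sol_solenoidal sol t0 Qq).
have pc (z : R) : pfun (fun _ : E => z) by exact: pfun_cst.
have pg (w : E -> E) i j : (forall j, pfun (fun x => w x 0 j)) -> pfun (fun x => grad w x i j).
  move=> pw; rewrite (_ : (fun _ => _) = 'D_(delta_mx 0 i) (fun x => w x 0 j)).
    exact: pfun_derive.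
  by apply/funext => x; rewrite mxE.
have pT (v b w : E -> E) : (forall j, pfun (fun x => v x 0 j)) -> (forall j, pfun (fun x => b x 0 j)) ->
    (forall j, pfun (fun x => w x 0 j)) -> pfun (fun x => ddot (tens (v x) (b x)) (grad w x)).
  move=> pv pb pw.
  rewrite (_ : (fun _ => _) = fun x => \sum_i \sum_j (v x 0 i * b x 0 j) * grad w x i j).
    by apply: pfun_sum => i _; apply: pfun_sum => j _; apply: pfunM; [exact: pfunM|exact: pg].
  by apply/funext => x; apply: eq_bigr => i _; apply: eq_bigr => j _; rewrite mxE.
have pSS : pfun (fun x => ddot (sgrad (u K) x) (sgrad (u K) x)).
  by apply: pfun_sum => i _; apply: pfun_sum => j _; have [H _] := @pgrad (u K) i j pu0; exact: pfunM.
have pAA : pfun (fun x => ddot (agrad (B K) x) (agrad (B K) x)).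
  by apply: pfun_sum => i _; apply: pfun_sum => j _; have [_ H] := @pgrad (B K) i j pB0; exact: pfunM.
have put := pfun_dot (fun j => dpu j KT) pu0; have pBt := pfun_dot (fun j => dpB j KT) pB0.
have puu := pfun_dot pu0 pu0; have pBB := pfun_dot pB0 pB0.
have inu : vintegrable (O K) (fun x => nux x) by exact: (adm_nu_vint adm t0 KT).
have ieta : vintegrable (O K) (fun x => etax x) by exact: (adm_eta_vint adm t0 KT).
have OO x : O K x -> Omega P x by exact: (tri_sub tri KT).
have mxw (b : E) (M : 'M[R]_m.+1) : ddot (maxwell P b) M =
    (rho * mu0)^-1 * (ddot (tens b b) M - 2^-1 * dot b b * \tr M).
  by rewrite /maxwell ddotZl ddotDl ddotNl ddot_scalar enorm_sqr.
have i1 : vintegrable (O K) (fun x =>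
     dot (derive1 (fun s => uh X s K x) t) (u K x)
     - ddot (tens (u K x) (u K x)) (grad (u K) x)
     - ddot ((rho^-1 * ph X t K x)%:M) (grad (u K) x)
     + 2 * nux x * ddot (sgrad (u K) x) (sgrad (u K) x)
     + ddot (maxwell P (B K x)) (grad (u K) x)
     - dot (f_v P x t) (u K x)).
  apply: (vintegrable_eq c a (f := fun x =>
     (dot (derive1 (fun s => uh X s K x) t) (u K x)
     - ddot (tens (u K x) (u K x)) (grad (u K) x)
     - rho^-1 * ph X t K x * divergence (u K) x
     + (rho * mu0)^-1 * (ddot (tens (B K x) (B K x)) (grad (u K) x)
        - 2^-1 * dot (B K x) (B K x) * divergence (u K) x))
     + 2 * ddot (sgrad (u K) x) (sgrad (u K) x) * nux x)).
    move=> x Ox; rewrite (f_v0 (OO x Ox) t0) [dot 0 _]dotC dot0r mxw ddot_scalar.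
    by rewrite -!/(divergence (u K) x); ring.
  apply: vintegrableD => //; last by apply: vintegrableM => //; exact: pfunM.
  apply: vintegrable_pfun => //; apply: pfunD; first apply: pfunB; first apply: pfunB => //.
  - exact: pT.
  - by apply: pfunM => //; exact: pfunM.
  - apply: pfunM => //; apply: pfunB; first exact: pT.
    by apply: pfunM => //; exact: pfunM.
have i5 : vintegrable (O K) (fun x =>
     dot (derive1 (fun s => Bh X s K x) t) (B K x)
     - ddot (tens (u K x) (B K x)) (grad (B K) x)
     - ddot ((rh X t K x)%:M) (grad (B K) x)
     + 2 * (etax x / mu0) * ddot (agrad (B K) x) (agrad (B K) x)
     - ddot (tens (B K x) (B K x)) (grad (u K) x)
     - dot (f_m P x t) (B K x)).
  apply: (vintegrable_eq c a (f := fun x =>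
     (dot (derive1 (fun s => Bh X s K x) t) (B K x)
     - ddot (tens (u K x) (B K x)) (grad (B K) x)
     - rh X t K x * divergence (B K) x
     - ddot (tens (B K x) (B K x)) (grad (u K) x))
     + 2 / mu0 * ddot (agrad (B K) x) (agrad (B K) x) * etax x)).
    move=> x Ox; rewrite (f_m0 (OO x Ox) t0) [dot 0 _]dotC dot0r ddot_scalar.
    by rewrite -!/(divergence (B K) x); ring.
  apply: vintegrableD => //; last by apply: vintegrableM => //; exact: pfunM.
  apply: vintegrable_pfun => //; apply: pfunB; first apply: pfunB; first apply: pfunB => //.
  - exact: pT.
  - exact: pfunM.
  - exact: pT.
have iv1 : vintegrable (O K) (fun x => 2 * rho * nux x * fnorm (sgrad (u K) x) ^+ 2).
  apply: (vintegrable_eq c a (f := fun x => 2 * rho * ddot (sgrad (u K) x) (sgrad (u K) x) * nux x)).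
    by move=> x _; rewrite fnorm_sqr; ring.
  by apply: vintegrableM => //; exact: pfunM.
have iv2 : vintegrable (O K) (fun x => 2 * (etax x / mu0 ^+ 2) * fnorm (agrad (B K) x) ^+ 2).
  apply: (vintegrable_eq c a (f := fun x => 2 / mu0 ^+ 2 * ddot (agrad (B K) x) (agrad (B K) x) * etax x)).
    by move=> x _; rewrite fnorm_sqr; ring.
  by apply: vintegrableM => //; exact: pfunM.
have refl f : vintegrable (O K) f -> vvalue K f (vint (O K) f) by [].
have pe : pfun (power K) by apply: pfunD; exact: pfunM.
have HL := vvalueD c a (vvalueZ c a rho (refl _ i1)) (vvalueZ c a mu0^-1 (refl _ i5)).
(* Adding the two vanishing integrals [z1] and [z2] turns the identity into a pointwise one. *)
have HR := vvalueD c a (vvalueD c a (vvalueB c a (vvalueD c a (vvalueD c a (vp _ pe)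
  (refl _ iv1)) (refl _ iv2)) (vp _ (pfun_divergence pW))) z1) z2.
rewrite !addr0 in HR; apply: (eq_vvalue _ HL HR) => x Ox.
rewrite (f_v0 (OO x Ox) t0) (f_m0 (OO x Ox) t0) ![dot 0 _]dotC !dot0r mxw ![ddot (_%:M) _]ddot_scalar.
rewrite (divergence_energy_flux rho mu0^-1 x pu0 pB0) !fnorm_sqr /power.
rewrite -!/(divergence (u K) x) -!/(divergence (B K) x); field.
by rewrite !gt_eqF.
Qed.

(** Opposite normals eliminate the single-valued [uhat] from the jump, leaving that of the normal
    component of [uh]. The weight is merely bounded and measurable, hence the passage through
    [fint_orth]. *)
Lemma interior_jump F : F \in mesh_facets T -> ~ (hull F `<=` frontier (Omega P)) ->
  fint setT F (fun x => (\sum_(K in elements T | F \in facets K) dot (u K x) (n K F)) *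
    ((1 - \1_(GammaN P) x) * mean_energy F x)) = 0.
Proof.
move=> FT iF; have c := cFm FT.
have nsum : \sum_(K in elements T | F \in facets K) n K F = 0.
  have /eqP/cards2P [K1 [K2 [K12 EK]]] := tri_interior tri FT iF.
  have EKE K : (K \in elements T) && (F \in facets K) = (K == K1) || (K == K2).
    by have := congr1 (fun A : {set vset} => K \in A) EK; rewrite !inE.
  have /andP[T1 F1] : (K1 \in elements T) && (F \in facets K1) by rewrite EKE eqxx.
  have /andP[T2 F2] : (K2 \in elements T) && (F \in facets K2) by rewrite EKE eqxx orbT.
  rewrite (eq_bigl _ _ EKE) (bigD1 K1) ?eqxx //= (bigD1 K2) /=; last first.
    by rewrite eqxx orbT eq_sym.
  rewrite big1 ?addr0; last first.
    by move=> K /andP[/andP[/orP[] /eqP -> ]]; rewrite ?eqxx.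
  rewrite (opposite_normals (cK T1) (cK T2) (aK T1) K12 (tri_conforming tri T1 T2) F1 F2
    (normal T1 F1) (normal T2 F2)).
  by rewrite addNr.
pose jump x := \sum_(K in elements T | F \in facets K) dot (u K x - u' F x) (n K F).
have jumpE x : jump x = \sum_(K in elements T | F \in facets K) dot (u K x) (n K F).
  rewrite /jump; under eq_bigr do rewrite dotC dotBr.
  rewrite sumrB [X in _ - X](_ : _ = 0) ?subr0; last first.
    by under eq_bigr do rewrite dotC; rewrite -dot_sumr nsum dot0r.
  by apply: eq_bigr => K _; rewrite dotC.
have pj : poly_on k (hull F) jump.
  apply: poly_on_sum => K /andP[KT _].
  apply: poly_on_sum => j _.
  rewrite (_ : (fun _ => _) = fun x => n K F 0 j * (u K x 0 j + -1 * u' F x 0 j)); last first.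
    by apply/funext => x; rewrite !mxE; ring.
  apply: poly_onZ; apply: poly_onD.
    by apply: poly_on_subset (sol_uh sol (ltW t0) KT j).
  by apply: poly_onZ; exact: (sol_uhat sol (ltW t0) FT j).
have bj : fbm F jump by exact: fbm_poly_on pj.
have bdj K : K \in elements T -> F \in facets K ->
    fbm F (fun x => dot (u K x - u' F x) (n K F)).
  move=> KT FK; apply: (fbm_dot c); last exact: vfbm_cst.
  apply: (vfbmB c); last exact: bu'.
  by move=> j; apply: fbm_pfun; exact: pu.
have j0 : fint setT F (fun x => jump x * jump x) = 0.
  have := sol_mass_facets sol t0 (q := fun F' x => if F' == F then jump x else 0).
  rewrite sum_facets (bigD1 F) //= eqxx [X in _ + X]big1 ?addr0; last first.
    move=> F' /andP[_ /negPf ->]; rewrite big1 // => K _.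
    by under eq_fun do rewrite mulr0; exact: fint0.
  have r0 := adm_rho adm.
  have -> : \sum_(K in elements T | F \in facets K) fint setT F (fun x =>
      rho^-1 * dot (u K x - u' F x) (n K F) * jump x) =
      rho^-1 * fint setT F (fun x => jump x * jump x).
    rewrite -fintZ; last exact/fbm_fintegrable/fbmM.
    rewrite -fint_sum; last first.
      move=> K /andP[KT FK]; apply: fbm_fintegrable; apply: fbmM => //.
      by apply: fbmM; [exact: fbm_cst|exact: bdj].
    apply: (fint_eq c) => x _ _; rewrite {2}/jump mulr_suml mulr_sumr.
    by apply: eq_bigr => K _; rewrite mulrA.
  move=> H; have /eqP : rho^-1 * fint setT F (fun x => jump x * jump x) = 0.
    by apply: H => F' _; case: eqP => [->|_]; [exact: pj|exact: poly_on0].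
  by rewrite mulf_eq0 invr_eq0 gt_eqF //= => /eqP.
under eq_fun do rewrite -jumpE.
apply: (fint_orth c) => //; apply: fbmM.
  apply: (fbmB c); first exact: fbm_cst.
  by apply: fbm_indic; exact: (adm_GammaN adm FT).
have bu0 := bu' FT; have bB0 := bB' FT.
by apply: fbmM; [exact: fbm_cst|apply: fbmD; apply: fbmM; try exact: fbm_cst; exact: fbm_dot].
Qed.

(** On [GammaD] both facet unknowns vanish with the boundary data, on [GammaN] the prefactor does,
    and together these parts cover almost all of the facet. *)
Lemma facet_mean_vanish (F : vset) : F \in mesh_facets T -> hull F `<=` frontier (Omega P) ->
  facet_ae F (fun x => (1 - \1_(GammaN P) x) * mean_energy F x = 0).
Proof.
move=> FT bF.
have a1 := adm_cover adm FT bF.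
have a2 := sol_g_v sol t0 FT; have a3 := sol_g_m sol t0 FT.
move: a1 a2 a3; rewrite /facet_ae; apply: filterS3 => y /= b1 b2 b3 Sy.
have [GD|GN] := b1 Sy; last by rewrite indicE mem_set // subrr mul0r.
rewrite /mean_energy (b2 Sy GD) (b3 Sy GD) g_v0 // g_m0 // !dot0r.
by rewrite !mulr0 addr0 mulr0 mulr0.
Qed.

Lemma mean_flux_vanish :
  \sum_(K in elements T) \sum_(F in facets K) fint setT F (fun x =>
    (1 - \1_(GammaN P) x) * (dot (u K x) (n K F) * mean_energy F x)) = 0.
Proof.
rewrite sum_facets big1 // => F FT; have c := cFm FT.
have bu0 := bu' FT; have bB0 := bB' FT.
have bme : fbm F (mean_energy F).
  by apply: fbmM; [exact: fbm_cst|apply: fbmD; apply: fbmM; try exact: fbm_cst; exact: fbm_dot].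
have bchi : fbm F (fun x => 1 - \1_(GammaN P) x).
  apply: (fbmB c); first exact: fbm_cst.
  by apply: fbm_indic; exact: (adm_GammaN adm FT).
have bdu K : K \in elements T -> fbm F (fun x => dot (u K x) (n K F)).
  move=> KT; apply: (fbm_dot c); last exact: vfbm_cst.
  by move=> j; apply: fbm_pfun; exact: pu.
have [bF|iF] := pselect (hull F `<=` frontier (Omega P)); last first.
  rewrite -[RHS](interior_jump FT iF) -fint_sum; last first.
    by move=> K /andP[KT _]; apply: fbm_fintegrable; apply: fbmM => //; apply: fbmM => //; exact: bdu.
  apply: (fint_eq c) => x _ _; rewrite mulr_suml; apply: eq_bigr => K _; ring.
rewrite big1 // => K /andP[KT _]; apply: fint_ae0.
  by apply: fbmM => //; apply: fbmM => //; exact: bdu.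
have := facet_mean_vanish FT bF; rewrite /facet_ae; apply: filterS => y /= H Sy.
by rewrite mulrCA H // mulr0.
Qed.

Lemma power_le0 : \sum_(K in elements T) vint (O K) (power K) <= 0.
Proof.
have r0 := adm_rho adm; have m0 := adm_mu0 adm.
have hN (w : vset -> E -> E) (g : E -> R -> E) :
    (forall x (t : R), GammaN P x -> 0 < t -> g x t = 0) ->
    \sum_(K in elements T) \sum_(F in facets K)
       fint (GammaN P) F (fun x => dot (g x t) (w F x)) = 0.
  move=> g0; rewrite big1 // => K KT; rewrite big1 // => F FK.
  rewrite -[RHS](fint0 F (GammaN P)); apply: (fint_eq (cF KT FK)) => x _ Nx.
  by rewrite g0 // dotC dot0r.
(* Homogeneous Dirichlet data make the facet unknowns themselves admissible as test functions. *)
have hD (w : vset -> E -> E) (g : E -> R -> E) :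
    (forall x (t : R), GammaD P x -> 0 < t -> g x t = 0) ->
    facet_eq_on (T := T) (GammaD P) w (fun x => g x t) -> facet_eq_on (GammaD P) w (fun=> 0).
  move=> g0 H F FT; have := H F FT; rewrite /facet_ae; apply: filterS => y Hy Sy Dy.
  by rewrite Hy // g0.
have S1 := sol_momentum sol t0 (sol_uh sol (ltW t0)).
have S2 := sol_momentum_facets sol t0 (conj (sol_uhat sol (ltW t0)) (hD _ _ g_v0 (sol_g_v sol t0))).
have S5 := sol_induction sol t0 (sol_Bh sol (ltW t0)).
have S6 := sol_induction_facets sol t0 (conj (sol_Bhat sol (ltW t0)) (hD _ _ g_m0 (sol_g_m sol t0))).
have S4 := sol_mass_facets sol t0 (sol_phat sol (ltW t0)).
have S8 := sol_solenoidal_facets sol t0 (sol_rhat sol (ltW t0)).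
have [L1 L2] := Cpen_large t0 (sol_uh sol (ltW t0)) (sol_Bh sol (ltW t0)).
have VI := sum_volume_balance volume_identity.
have FI := sum_facet_balance facet_inequality.
have MV := mean_flux_vanish.
rewrite (hN _ _ h_v0) addr0 in S2; rewrite (hN _ _ h_m0) addr0 in S6.
exact: (energy_balance S1 S2 S5 S6 S4 S8 MV L1 L2 VI FI).
Qed.

Lemma energy_decay : derivable (energy P X) t 1 /\ derive1 (energy P X) t <= 0.
Proof.
have [de dv] := is_derive_energy; split => //.
by rewrite derive1E dv; exact: power_le0.
Qed.

End energy_decay.

Theorem proposition5 (R : realType) (d k : nat)
  (P : mhd_data R d) (T : mesh R d)
  (n : {set 'I_(nvert T)} -> {set 'I_(nvert T)} -> 'rV[R]_d) (Cpen : R)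
  (X : discrete_state T)
  (d_eq : d = 2%N \/ d = 3%N) (k_ge1 : (1 <= k)%N)
  (adm : admissible_data P T)
  (normal : forall K F, K \in elements T -> F \in facets K ->
    outward_unit_normal K F (n K F))
  (Cpen_gt0 : 0 < Cpen)
  (f_v0 : forall x (t : R), Omega P x -> 0 < t -> f_v P x t = 0)
  (f_m0 : forall x (t : R), Omega P x -> 0 < t -> f_m P x t = 0)
  (g_v0 : forall x (t : R), GammaD P x -> 0 < t -> g_v P x t = 0)
  (g_m0 : forall x (t : R), GammaD P x -> 0 < t -> g_m P x t = 0)
  (h_v0 : forall x (t : R), GammaN P x -> 0 < t -> h_v P x t = 0)
  (h_m0 : forall x (t : R), GammaN P x -> 0 < t -> h_m P x t = 0)
  (Cpen_large : large_penalty k P n Cpen)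
  (sol : hdg_solution k P n Cpen X) :
  forall t : R, 0 < t ->
    derivable (energy P X) t 1 /\ derive1 (energy P X) t <= 0.
Proof.
(* A numeral dimension has the form [m.+1], with [m] the dimension of the facets. *)
move=> t t0; case: d_eq => dE; subst d.
  exact: (energy_decay adm normal Cpen_gt0 f_v0 f_m0 g_v0 g_m0 h_v0 h_m0 Cpen_large sol t0).
exact: (energy_decay adm normal Cpen_gt0 f_v0 f_m0 g_v0 g_m0 h_v0 h_m0 Cpen_large sol t0).
Qed.
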